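(* Let $(\mu_t)_{t\in[0,1]}$ be a Monge geodesic, parametrized proportionally to length, in the Wasserstein space of a compact Riemannian manifold $N$, and let $T=(T_{p,q})_{p,q\in[0,1]}$ be the family of operators $T_{p,q}=\mathrm{proj}_{T\mu_q}\circ ParT_{p,q}:T\mu_p\to T\mu_q$. There exists a function $F:[0,\infty)\to[0,\infty)$ with $F(t)=o(t)$ as $t\to0^+$ such that the following holds. Let $A_1\subset A_2\subset\cdots$ be any increasing sequence of finite subsets of $[0,1]$ whose union $A=\bigcup_kA_k$ is dense in $[0,1]$, and let $S^k$ be the homogenization of the restriction of $T$ to $A_k$. Then: (a) for all $p,q\in A$ the sequence $S^k_{p,q}$ (defined for $k$ large) converges in operator norm to an operator $S_{p,q}:T\mu_p\to T\mu_q$, and the convergence is uniform in $p,q$ (that is, $\sup_{p,q\in A_k}\|S^k_{p,q}-S_{p,q}\|\to0$ as $k\to\infty$); (b) the family $(S_{p,q})_{p,q\in A}$ satisfies the composition property and is an $F$-approximation of $T$, and it is the only family of operators on $A$ with these two properties; (c) the limit operator $S_{p,q}$ between two given points $p,q$ does not depend on the increasing sequence $(A_k)$ or on the limiting dense set $A$ containing $p,q$, so that $S_{p,q}$ is well defined for all $p,q\in[0,1]$; (d) every operator $S_{p,q}:T\mu_p\to T\mu_q$ is unitary.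
   Context: $W$ denotes the 2-Wasserstein distance $W_2$ between probability measures on $N$. A Wasserstein geodesic corresponds to an optimal transport plan, viewed as a probability distribution on geodesic segments of $N$. It is called Monge if the projections of these segments to both endpoints are one-to-one for almost all segments. Thus there are transport maps $\phi_{s,t}$ (almost everywhere defined and invertible) with $(\phi_{s,t})_*\mu_s=\mu_t$, and $t\mapsto\phi_{s,t}(x)$ is a geodesic of $N$. Let $L^2(\mathrm{supp}(\mu_t),\mu_t)$ be the Hilbert space of square-integrable vector fields along $\mathrm{supp}(\mu_t)$. The normal space $N\mu_t$ is the closure in this Hilbert space of the space of vector fields that preserve $\mu_t$ (i.e. $V$ with $\int df(V)\,d\mu_t=0$ for all smooth $f$). The linear tangent space $T\mu_t$ is the orthogonal complement of $N\mu_t$, and $\mathrm{proj}_{T\mu_t}$ is the orthogonal projection onto it. $ParT_{s,t}:L^2(\mathrm{supp}(\mu_s),\mu_s)\to L^2(\mathrm{supp}(\mu_t),\mu_t)$ is the unitary operator that parallel transports (with respect to the Levi-Civita connection of $N$) the value at $x$ of a vector field along the geodesic $\tau\mapsto\phi_{s,\tau}(x)$ from $x$ to $\phi_{s,t}(x)$. $Push_{s,t}$ is the pushforward of vector fields by $\phi_{s,t}$, whenever defined. Standing facts/assumptions: $Push_{s,t}$ is defined on $N\mu_s$ and $Push_{s,t}N\mu_s=N\mu_t$; the Monge transport field has bounded first derivative, and there is a constant $C$, depending only on this first derivative, with $\|Push_{s,t}-ParT_{s,t}\|\le C\,W(\mu_s,\mu_t)$ in operator norm for all $s,t$. A family of operators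 $S$ on a subset $A\subset[0,1]$ consists of operators $S_{p,q}:T\mu_p\to T\mu_q$ for $p,q\in A$. It is an $F$-approximation of $T$ if $\|S_{p,q}-T_{p,q}\|\le F(|q-p|)$ in operator norm for all $p,q\in A$. It satisfies the composition property if $S_{p,p}=\mathrm{id}$ and $S_{q,r}\circ S_{p,q}=S_{p,r}$ whenever $q$ lies between $p$ and $r$. For a finite $A=\{p_1<\dots<p_n\}$, the homogenization of $S$ is the family obtained by composing the operators associated to neighboring points: from $p_i$ to $p_j$ with $i<j$ it is $S_{p_{j-1},p_j}\circ\dots\circ S_{p_i,p_{i+1}}$, with $i>j$ it is $S_{p_{j+1},p_j}\circ\dots\circ S_{p_i,p_{i-1}}$, and for $i=j$ it is the identity. *)

(* Defs.v *)
From HB Require Import structures.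
From mathcomp Require Import all_boot all_order all_algebra.
From mathcomp Require Import finmap.
From mathcomp Require Import all_classical all_reals all_analysis.

Set Implicit Arguments.
Unset Strict Implicit.
Unset Printing Implicit Defensive.
Import Order.TTheory GRing.Theory Num.Theory.
Import numFieldNormedType.Exports.

Local Open Scope classical_set_scope.
Local Open Scope ring_scope.

(** * Riemannian manifolds *)

Definition partial (R : realType) (d : nat) (k : 'I_d)
    (f : 'rV[R]_d -> R) (x : 'rV[R]_d) : R :=
  'D_(delta_mx ord0 k) f x.

Fixpoint Ck_on (R : realType) (d : nat) (m : nat) (U : set 'rV[R]_d)
    (f : 'rV[R]_d -> R) : Prop :=
  (forall x, U x -> {for x, continuous f}) /\
  match m with
  | 0%N => True
  | m'.+1 => forall k : 'I_d,
      (forall x, U x -> derivable f x (delta_mx ord0 k)) /\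
      Ck_on m' U (partial k f)
  end.

Definition smooth_on (R : realType) (d : nat) (U : set 'rV[R]_d)
    (f : 'rV[R]_d -> R) : Prop := forall m, Ck_on m U f.

(** A smooth Hausdorff manifold of dimension [d] given by an atlas, with a
    Riemannian metric given by its matrix in every chart.  [mcenter x] selects
    one chart around [x]: a tangent vector at [x] is represented by its
    coordinates (a row vector) in the chart [mcenter x].  No continuity in [x]
    is asked of this selection; regularity of vector fields is always tested
    in a fixed chart (see [tcoord]).  Row vectors being acted upon on the right,
    a tangent vector [v] read in chart [i] is [v *m 'J _ _] in chart [j], and
    [v g v^T] is its squared length.  Second countability is not recorded,
    since it is automatic in the compact case. *)
Record riemannianManifold (R : realType) (d : nat) := RiemannianManifold {
  mcarrier :> ptopologicalType ;
  mindex : Type ;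
  mdom : mindex -> set mcarrier ;
  mchart : mindex -> mcarrier -> 'rV[R]_d ;
  mchartV : mindex -> 'rV[R]_d -> mcarrier ;
  mmetric : mindex -> 'rV[R]_d -> 'M[R]_d ;
  mcenter : mcarrier -> mindex ;
  mhausdorff : hausdorff_space mcarrier ;
  mdom_open : forall i, open (mdom i) ;
  mdom_center : forall x, mdom (mcenter x) x ;
  mcod_open : forall i, open (mchart i @` mdom i) ;
  mchartK : forall i x, mdom i x -> mchartV i (mchart i x) = x ;
  mchart_continuous : forall i x, mdom i x -> {for x, continuous (mchart i)} ;
  mchartV_continuous : forall i y, (mchart i @` mdom i) y ->
    {for y, continuous (mchartV i)} ;
  mtransition_smooth : forall i j (k : 'I_d),
    smooth_on (mchart i @` (mdom i `&` mdom j))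
      (fun y => mchart j (mchartV i y) ord0 k) ;
  mmetric_smooth : forall i (a b : 'I_d),
    smooth_on (mchart i @` mdom i) (fun y => mmetric i y a b) ;
  mmetric_sym : forall i y, (mchart i @` mdom i) y ->
    (mmetric i y)^T = mmetric i y ;
  mmetric_pos : forall i y (v : 'rV[R]_d), (mchart i @` mdom i) y -> v != 0 ->
    0 < (v *m mmetric i y *m v^T) ord0 ord0 ;
  mmetric_compat : forall i j x, mdom i x -> mdom j x ->
    let J := 'J (fun y => mchart j (mchartV i y)) (mchart i x) in
    mmetric i (mchart i x) = J *m mmetric j (mchart j x) *m J^T
}.

Section Riemannian.
Context (R : realType) (d : nat) (N : riemannianManifold R d).

(** Coordinates, in the chart [i], of the tangent vector at [x] represented by
    [v] (meaningful for [x] in the domain of [i]). *)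
Definition tcoord (i : mindex N) (x : N) (v : 'rV[R]_d) : 'rV[R]_d :=
  v *m 'J (fun y => mchart i (mchartV (mcenter x) y)) (mchart (mcenter x) x).

Definition tdot (x : N) (v w : 'rV[R]_d) : R :=
  (v *m mmetric (mcenter x) (mchart (mcenter x) x) *m w^T) ord0 ord0.

Definition tnorm (x : N) (v : 'rV[R]_d) : R := Num.sqrt (tdot x v v).

Definition smooth_fun (f : N -> R) : Prop :=
  forall i, smooth_on (mchart i @` mdom i) (f \o mchartV i).

(** [dfun f x v] is the differential of [f] at [x] applied to [v]. *)
Definition dfun (f : N -> R) (x : N) (v : 'rV[R]_d) : R :=
  'D_v (f \o mchartV (mcenter x)) (mchart (mcenter x) x).

Definition velocity (c : R -> N) (t : R) : 'rV[R]_d :=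
  derive1 (mchart (mcenter (c t)) \o c) t.

Definition C1_curve (c : R -> N) : Prop :=
  continuous c /\
  forall t i, mdom i (c t) ->
    derivable (mchart i \o c) t 1 /\
    {for t, continuous (derive1 (mchart i \o c))}.

Definition curve_length (c : R -> N) : \bar R :=
  (\int[lebesgue_measure]_(t in `[0%R, 1%R])
     (tnorm (c t) (velocity c t))%:E)%E.

(** Riemannian distance.  Allowing piecewise C^1 curves would not change the
    infimum: slowing down at the corners makes such a curve C^1.  It is
    infinite between different components. *)
Definition rdist (x y : N) : \bar R :=
  ereal_inf [set curve_length c | c in
    [set c : R -> N | [/\ C1_curve c, c 0 = x & c 1 = y]]].

(** Christoffel symbol [Gamma^k_(ab)] of the Levi-Civita connection in the
    chart [i]. *)
Definition christoffel (i : mindex N) (y : 'rV[R]_d) (a b k : 'I_d) : R :=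
  2^-1 * \sum_(l < d) invmx (mmetric i y) k l *
    (partial a (fun z => mmetric i z b l) y
     + partial b (fun z => mmetric i z a l) y
     - partial l (fun z => mmetric i z a b) y).

(** The vector field [V] along the curve [c] is parallel: its covariant
    derivative vanishes, in every chart. *)
Definition parallel_along (c : R -> N) (V : R -> 'rV[R]_d) : Prop :=
  forall t i, mdom i (c t) ->
    let Y := fun s => tcoord i (c s) (V s) in
    let u := derive1 (mchart i \o c) t in
    derivable Y t 1 /\
    forall k : 'I_d, (derive1 Y t) ord0 k =
      - \sum_(a < d) \sum_(b < d)
          christoffel i (mchart i (c t)) a b k * u ord0 a * (Y t) ord0 b.

Definition parallel_transport (c : R -> N) (s t : R) (v w : 'rV[R]_d) : Prop :=
  exists V, [/\ parallel_along c V, V s = v & V t = w].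

Definition geodesic (c : R -> N) : Prop :=
  C1_curve c /\ parallel_along c (velocity c).

(** Minimizing geodesics defined on [0, 1], with constant speed.  On a compact
    manifold every geodesic extends to the whole line, in a unique way: a
    segment is represented by this extension, so that derivatives at the
    endpoints are ordinary ones. *)
Definition geodesic_segment (c : R -> N) : Prop :=
  geodesic c /\
  forall s t : R, s \in `[0, 1] -> t \in `[0, 1] ->
    rdist (c s) (c t) = (`|s - t|%:E * rdist (c 0%R) (c 1%R))%E.

(** * The space of geodesic segments *)

Definition segment := {c : R -> N | geodesic_segment c}.

Definition seg_fun (g : segment) : R -> N := sval g.
Coercion seg_fun : segment >-> Funclass.

Lemma cst_C1 (x : N) : C1_curve (cst x).
Proof.
split; first exact: cst_continuous.
move=> t i _; rewrite (_ : mchart i \o cst x = cst (mchart i x))//.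
split; first exact: derivable_cst.
rewrite (_ : derive1 (cst (mchart i x)) = cst 0); first exact: cst_continuous.
by apply/funext => s; rewrite derive1_cst.
Qed.

Lemma velocity_cst (x : N) t : velocity (cst x) t = 0.
Proof.
rewrite /velocity /= (_ : _ \o _ = cst (mchart (mcenter x) x))//.
by rewrite derive1_cst.
Qed.

Lemma rdist_refl (x : N) : rdist x x = 0%E.
Proof.
apply/eqP; rewrite eq_le; apply/andP; split.
  apply: ereal_inf_lbound; exists (cst x) => /=; first by split=> //; exact: cst_C1.
  rewrite /curve_length; apply: integral0_eq => t _.
  by rewrite velocity_cst /tnorm /tdot !mul0mx mxE sqrtr0.
apply/ereal_infP => _ [c _ <-]; apply: integral_ge0 => t _.
by rewrite lee_fin; exact: sqrtr_ge0.
Qed.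

Lemma geodesic_segment_cst (x : N) : geodesic_segment (cst x).
Proof.
split; last by move=> s t _ _ /=; rewrite rdist_refl mule0.
split; first exact: cst_C1.
move=> t i _ /=.
have -> : (fun s => tcoord i x (velocity (cst x) s)) = cst 0.
  by apply/funext => s; rewrite velocity_cst /tcoord mul0mx.
split; first exact: derivable_cst.
move=> k; rewrite derive1_cst !mxE big1 ?oppr0// => a _.
by rewrite big1// => b _; rewrite /cst /= velocity_cst /tcoord mul0mx mxE mulr0.
Qed.

HB.instance Definition _ := gen_eqMixin segment.
HB.instance Definition _ := gen_choiceMixin segment.
HB.instance Definition _ := isPointed.Build segment
  (exist _ _ (geodesic_segment_cst point)).

Definition seg_cylinder : set (set segment) :=
  [set E | exists t (U : set N),
     [/\ t \in `[0, 1], open U & E = [set g : segment | U (g t)]]].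

(** Segments with the sigma-algebra generated by the evaluations at times in
    [0, 1]. *)
Definition segments := g_sigma_algebraType seg_cylinder.

Definition ev (t : R) (g : segments) : N := (g : segment) t.

Definition borel := g_sigma_algebraType (@open N).

(** * The Wasserstein space *)

Definition coupling (mu nu : probability borel R)
    (pi : probability (borel * borel)%type R) : Prop :=
  forall B : set borel, measurable B ->
    pi (B `*` setT) = mu B /\ pi (setT `*` B) = nu B.

Definition wasserstein (mu nu : probability borel R) : \bar R :=
  (ereal_inf [set \int[pi]_z (rdist z.1 z.2 ^+ 2)
     | pi in coupling mu nu] `^ 2^-1)%E.

Definition wasserstein_geodesic (mu : R -> probability borel R) : Prop :=
  (wasserstein (mu 0%R) (mu 1%R) < +oo)%E /\
  forall s t : R, s \in `[0, 1] -> t \in `[0, 1] ->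
    wasserstein (mu s) (mu t) =
    (`|s - t|%:E * wasserstein (mu 0%R) (mu 1%R))%E.

(** [Pi] is an optimal plan between [mu 0] and [mu 1], seen as a distribution
    on segments, which induces the curve [mu]. *)
Definition optimal_segments (mu : R -> probability borel R)
    (Pi : probability segments R) : Prop :=
  (forall t (B : set borel), t \in `[0, 1] -> measurable B ->
     mu t B = Pi (ev t @^-1` B)) /\
  (\int[Pi]_g (rdist (ev 0%R g) (ev 1%R g) ^+ 2) =
   wasserstein (mu 0%R) (mu 1%R) ^+ 2)%E.

Definition monge (Pi : probability segments R) : Prop :=
  exists G : set segments,
    [/\ {ae Pi, forall g, G g},
        (forall g h : segments, G g -> G h -> ev 0 g = ev 0 h -> g = h) &
        (forall g h : segments, G g -> G h -> ev 1 g = ev 1 h -> g = h)].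

(** [phi s t] is the transport map from [mu s] to [mu t]: almost every segment
    [g] is [t |-> phi s t (ev s g)], for all [s].  In particular the maps
    [phi s t] and [phi t s] are inverse of each other almost everywhere, and
    [phi s t] pushes [mu s] forward to [mu t]. *)
Definition transport_maps (Pi : probability segments R)
    (phi : R -> R -> borel -> borel) : Prop :=
  (forall s t : R, s \in `[0, 1] -> t \in `[0, 1] ->
     measurable_fun setT (phi s t)) /\
  {ae Pi, forall g, forall s t : R, s \in `[0, 1] -> t \in `[0, 1] ->
     phi s t (ev s g) = ev t g}.

Definition monge_geodesic (mu : R -> probability borel R)
    (Pi : probability segments R) (phi : R -> R -> borel -> borel) : Prop :=
  [/\ wasserstein_geodesic mu, optimal_segments mu Pi, monge Pi &
      transport_maps Pi phi].

(** * Square-integrable vector fields *)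

(** Elements of the Hilbert space L^2(supp mu, mu) are represented by vector
    fields satisfying [L2 mu]; two of them are the same element when they
    are equal [mu]-almost everywhere. *)
Definition vfield := N -> 'rV[R]_d.

Definition measurable_field (V : vfield) : Prop :=
  forall i (k : 'I_d),
    measurable_fun (mdom i : set borel) (fun x : borel => tcoord i x (V x) ord0 k).

Definition L2 (mu : probability borel R) : set vfield :=
  [set V | measurable_field V /\
     (\int[mu]_x (tdot x (V x) (V x))%:E < +oo)%E].

Definition L2dot (mu : probability borel R) (V W : vfield) : R :=
  \int[mu]_x tdot x (V x) (W x).

Definition L2norm (mu : probability borel R) (V : vfield) : R :=
  Num.sqrt (L2dot mu V V).

Definition preserves (mu : probability borel R) (V : vfield) : Prop :=
  L2 mu V /\ forall f, smooth_fun f -> \int[mu]_x dfun f x (V x) = 0.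

Definition Wnormal_space (mu : probability borel R) : set vfield :=
  [set V | L2 mu V /\ forall e, 0 < e ->
     exists2 W, preserves mu W & L2norm mu (V - W) < e].

Definition Wtangent_space (mu : probability borel R) : set vfield :=
  [set V | L2 mu V /\ forall W, Wnormal_space mu W -> L2dot mu V W = 0].

(** Orthogonal projection onto the tangent space. *)
Definition proj_tangent (mu : probability borel R) (V : vfield) : vfield :=
  xget 0 [set U | Wtangent_space mu U /\
                  forall W, Wtangent_space mu W -> L2dot mu (V - U) W = 0].

(** * Operators between subspaces of L^2 spaces *)

(** Norm of the restriction to the subspace [D] of L^2(mu) of an operator with
    values in L^2(nu). *)
Definition opnorm (mu nu : probability borel R) (D : set vfield)
    (S : vfield -> vfield) : \bar R :=
  ereal_sup [set (L2norm nu (S V))%:E | V in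
    [set V | D V /\ L2norm mu V <= 1]].

(** Only the values of [S] on [D] matter.  By linearity and boundedness, [S] is
    compatible with almost everywhere equality. *)
Definition bounded_operator (mu nu : probability borel R) (D E : set vfield)
    (S : vfield -> vfield) : Prop :=
  [/\ forall V, D V -> E (S V),
      forall (a : R) V W, D V -> D W ->
        {ae nu, forall x, S (a *: V + W) x = a *: S V x + S W x} &
      (opnorm mu nu D S < +oo)%E].

Definition unitary_operator (mu nu : probability borel R) (D E : set vfield)
    (S : vfield -> vfield) : Prop :=
  [/\ bounded_operator mu nu D E S,
      forall V W, D V -> D W -> L2dot nu (S V) (S W) = L2dot mu V W &
      forall W, E W -> exists2 V, D V & {ae nu, forall x, S V x = W x}].

(** * Parallel transport and push-forward along a Monge geodesic *)

(** Parallel transport of [V x] along the geodesic [tau |-> phi s tau x], from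
    [x] to [phi s t x]: for almost every [x] this geodesic is the segment [g]
    of the plan with [ev s g = x]. *)
Definition is_transported (Pi : probability segments R) (s t : R)
    (V W : vfield) : Prop :=
  {ae Pi, forall g, parallel_transport (g : segment) s t
                      (V (ev s g)) (W (ev t g))}.

Definition ParT (mu : R -> probability borel R) (Pi : probability segments R)
    (s t : R) (V : vfield) : vfield :=
  xget 0 [set W | L2 (mu t) W /\ is_transported Pi s t V W].

(** The derivative at [x] in the direction [v] of the map [psi] exists and is
    the tangent vector [w] at [psi x]. *)
Definition is_diff_along (psi : N -> N) (x : N) (v w : 'rV[R]_d) : Prop :=
  let c := fun h : R => psi (mchartV (mcenter x) (mchart (mcenter x) x + h *: v)) in
  {for 0, continuous c} /\
  is_derive (0 : R) (1 : R) (mchart (mcenter (psi x)) \o c) w.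

Definition lipschitz_map (psi : N -> N) : Prop :=
  exists L : R, forall x y, (rdist (psi x) (psi y) <= L%:E * rdist x y)%E.

(** [W] is the push-forward of [V] by [f], a map defined [mu]-almost
    everywhere.  As the support of [mu] may have empty interior, the derivative
    of [f] in the direction of [V] is that of a Lipschitz map which agrees
    with [f] almost everywhere. *)
Definition is_pushforward (mu : probability borel R) (f : borel -> borel)
    (V W : vfield) : Prop :=
  exists psi : borel -> borel,
    [/\ lipschitz_map psi, {ae mu, forall x, psi x = f x} &
        {ae mu, forall x, is_diff_along psi x (V x) (W (psi x))}].

Definition Push (mu : R -> probability borel R)
    (phi : R -> R -> borel -> borel) (s t : R) (V : vfield) : vfield :=
  xget 0 [set W | L2 (mu t) W /\ is_pushforward (mu s) (phi s t) V W].

(** The push-forward is defined on the normal spaces and maps them onto each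
    other. *)
Definition push_normal (mu : R -> probability borel R)
    (phi : R -> R -> borel -> borel) (s t : R) : Prop :=
  [/\ forall V, Wnormal_space (mu s) V ->
        is_pushforward (mu s) (phi s t) V (Push mu phi s t V),
      forall V, Wnormal_space (mu s) V ->
        Wnormal_space (mu t) (Push mu phi s t V) &
      forall W, Wnormal_space (mu t) W -> exists2 V, Wnormal_space (mu s) V &
        {ae mu t, forall x, Push mu phi s t V x = W x}].

(** [X t] is the velocity field at time [t] of the transport. *)
Definition transport_field (Pi : probability segments R)
    (X : R -> vfield) : Prop :=
  forall t : R, t \in `[0, 1] ->
    {ae Pi, forall g, X t (ev t g) = velocity (g : segment) t}.

(** A vector field defined [mu]-almost everywhere has first (covariant)
    derivative bounded by [B]: its values are [B]-Lipschitz when compared by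
    parallel transport along minimizing geodesics. *)
Definition bounded_derivative (mu : probability borel R) (X : vfield)
    (B : R) : Prop :=
  exists D : set borel, {ae mu, forall x, D x} /\
    forall (g : segment) w, D (g 0) -> D (g 1) ->
      parallel_transport g 0 1 (X (g 0)) w ->
      ((tnorm (g 1%R) (X (g 1%R) - w))%:E <= B%:E * rdist (g 0%R) (g 1%R))%E.

(** * Families of operators *)

Definition opfamily := R -> R -> vfield -> vfield.

Definition tangent_operator (mu : R -> probability borel R) (p q : R)
    (S : vfield -> vfield) : Prop :=
  bounded_operator (mu p) (mu q) (Wtangent_space (mu p)) (Wtangent_space (mu q)) S.

Definition tangent_opnorm (mu : R -> probability borel R) (p q : R)
    (S : vfield -> vfield) : \bar R :=
  opnorm (mu p) (mu q) (Wtangent_space (mu p)) S.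

Definition projT (mu : R -> probability borel R)
    (Pi : probability segments R) : opfamily :=
  fun p q V => proj_tangent (mu q) (ParT mu Pi p q V).

Definition family_on (mu : R -> probability borel R) (A : set R)
    (S : opfamily) : Prop :=
  forall p q, A p -> A q -> tangent_operator mu p q (S p q).

Definition F_approximation (mu : R -> probability borel R) (F : R -> R)
    (A : set R) (S T : opfamily) : Prop :=
  forall p q, A p -> A q ->
    (tangent_opnorm mu p q (fun V => S p q V - T p q V)%R
       <= (F `|q - p|%R)%:E)%E.

Definition composition_property (mu : R -> probability borel R) (A : set R)
    (S : opfamily) : Prop :=
  (forall p V, A p -> Wtangent_space (mu p) V ->
     {ae mu p, forall x, S p p V x = V x}) /\
  (forall p q r V, A p -> A q -> A r -> (p <= q <= r) || (r <= q <= p) ->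
     Wtangent_space (mu p) V ->
     {ae mu r, forall x, S q r (S p q V) x = S p r V x}).

Fixpoint compose_along (S : opfamily) (p : R) (s : seq R) : vfield -> vfield :=
  match s with
  | [::] => id
  | q :: s' => compose_along S q s' \o S p q
  end.

Definition homogenization (A : {fset R}) (S : opfamily) : opfamily :=
  fun p q =>
    if p <= q
    then compose_along S p [seq x <- sort <=%R (enum_fset A) | p < x <= q]
    else compose_along S p [seq x <- sort >=%R (enum_fset A) | q <= x < p].

Definition dense_exhaustion (A : nat -> {fset R}) : Prop :=
  [/\ forall k, [set` A k] `<=` [set` `[0%R, 1%R]],
      forall k, [set` A k] `<=` [set` A k.+1] &
      [set` `[0%R, 1%R]] `<=` closure (\bigcup_k [set` A k])].

Definition operator_cvg (mu : R -> probability borel R) (p q : R)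
    (Sk : nat -> vfield -> vfield) (S : vfield -> vfield) : Prop :=
  tangent_opnorm mu p q (fun V => Sk k V - S V) @[k --> \oo] --> 0%E.

End Riemannian.

(* Main.v *)
Require Import Defs.
From HB Require Import structures.
From mathcomp Require Import all_boot all_order all_algebra.
From mathcomp Require Import finmap.
From mathcomp Require Import all_classical all_reals all_analysis.
From mathcomp Require Import measurable_realfun.
From mathcomp Require Import ring lra.

Set Implicit Arguments.
Unset Strict Implicit.
Unset Printing Implicit Defensive.
Import Order.TTheory GRing.Theory Num.Theory.
Import numFieldNormedType.Exports.

Local Open Scope classical_set_scope.
Local Open Scope ring_scope.

(** The push-forward maps normal fields to normal fields and is close to parallel
    transport, so [ParT_{s,t}] maps a unit normal field to one whose tangent
    component is at most [c |s - t|], where [c = C W(mu_0, mu_1)].  Dually, the normal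
    component of the transport of a unit tangent field is at most [c |s - t|].
    As [ParT] is functorial, [T_{q,r} T_{p,q} - T_{p,r}] only sees the detour of
    [ParT_{p,q} V] through the normal space at [q], which costs one factor on the
    way in and one on the way out: its norm is at most [K |q - p| |r - q|] with
    [K = c^2].

    For contractions with this property, inserting a point into a chain of step
    at most [dl] changes the composition by at most [K dl] times the length of
    the segment travelled, so that compositions along two fine chains from [p] to
    [q] are [K dl |q - p|]-close: they converge, uniformly, to a functorial family
    [S] with [|S - T| <= K t^2 = o(t)].  A round trip satisfies
    [S_{q,p} S_{p,q} = id + O(|q - p|^2)] and, by halving the interval repeatedly,
    [S_{q,p} S_{p,q} = id]; a contraction with a contraction as inverse is
    unitary. *)

(** * Seminormed spaces and bounded operators *)

(** Fields are functions, not classes, and [ParT], [Push] and [proj_tangent] pick representatives by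
    [xget]. Identities therefore hold only up to null fields, which imposes seminorms and operators
    that are linear modulo null vectors.

    Functoriality of [ParT] holds segment by segment: a parallel field that vanishes once vanishes
    identically, by Gronwall. The splitting into tangent and normal parts rests on orthogonal
    projection, hence on completeness of [L2]. Compactness of [N] supplies a finite atlas, used for
    measurability, and bounds on differentials. The rate [c] multiplies [|s - t|] because
    [W(mu_s, mu_t) = |s - t| W(mu_0, mu_1)].

    The limit is described by an estimate against all chains from [p] to [q], not through one
    exhaustion, so that it is defined on the whole of [[0, 1]] and does not depend on the
    exhaustion. The quadratic error serves three times: it sums to order [dl] along a chain, it
    shrinks under halving in round trips, and it forces two functorial families close to [T] to
    coincide. *)

Section SeminormedSpaces.
Context (R : realType) (V : lmodType R).

(** The spaces L^2 and T mu are represented by sets [D] of vectors with a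
    seminorm [n], two vectors being identified when their difference has
    seminorm 0; [seminormed] and [oper] are stable under this identification. *)
Definition seminormed (D : set V) (n : V -> R) : Prop :=
  [/\ D 0, forall a u v, D u -> D v -> D (a *: u + v),
      forall u v, D u -> D v -> n (u + v) <= n u + n v &
      forall a u, D u -> n (a *: u) = `|a| * n u].

Definition complete_seminormed (D : set V) (n : V -> R) : Prop :=
  forall u : nat -> V, (forall k, D (u k)) ->
    (forall e : R, 0 < e -> exists M, forall i j, (M <= i)%N -> (M <= j)%N ->
      n (u i - u j) <= e) ->
    exists2 v, D v &
      forall e : R, 0 < e -> exists M, forall i, (M <= i)%N -> n (u i - v) <= e.

(** Linearity is asked only up to a null vector, because a choice of representatives by [xget] need
    not respect sums. [M] is some bound, not the norm. *)
Definition oper (D : set V) (n : V -> R) (E : set V) (m : V -> R) (M : R)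
    (S : V -> V) : Prop :=
  [/\ forall u, D u -> E (S u),
      forall a u v, D u -> D v -> m (S (a *: u + v) - (a *: S u + S v)) = 0 &
      forall u, D u -> m (S u) <= M * n u].

Section OneSpace.
Variables (D : set V) (n : V -> R).
Hypothesis Dn : seminormed D n.

Lemma sn_mem0 : D 0. Proof. by case: Dn. Qed.

Lemma sn_memD u v : D u -> D v -> D (u + v).
Proof. by case: Dn => _ + _ _ Du Dv => /(_ 1 u v Du Dv); rewrite scale1r. Qed.

Lemma sn_memZ a u : D u -> D (a *: u).
Proof. by case: Dn => D0 + _ _ Du => /(_ a u 0 Du D0); rewrite addr0. Qed.

Lemma sn_memN u : D u -> D (- u).
Proof. by move=> /(sn_memZ (-1)); rewrite scaleN1r. Qed.

Lemma sn_memB u v : D u -> D v -> D (u - v).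
Proof. by move=> Du Dv; apply: sn_memD => //; exact: sn_memN. Qed.

Lemma snZ a u : D u -> n (a *: u) = `|a| * n u.
Proof. by case: Dn => _ _ _; apply. Qed.

Lemma sn0 : n 0 = 0.
Proof. by have := snZ 0 sn_mem0; rewrite scale0r normr0 mul0r. Qed.

Lemma snN u : D u -> n (- u) = n u.
Proof. by move=> Du; rewrite -scaleN1r snZ// normrN1 mul1r. Qed.

Lemma snD u v : D u -> D v -> n (u + v) <= n u + n v.
Proof. by case: Dn => _ _ + _; apply. Qed.

Lemma sn_ge0 u : D u -> 0 <= n u.
Proof.
move=> Du; have := snD Du (sn_memN Du); rewrite subrr sn0 snN//.
by lra.
Qed.

Lemma snC u v : D u -> D v -> n (u - v) = n (v - u).
Proof. by move=> Du Dv; rewrite -(snN (sn_memB Du Dv)) opprB. Qed.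

Lemma sn_tri w u v : D u -> D v -> D w -> n (u - v) <= n (u - w) + n (w - v).
Proof.
move=> Du Dv Dw; rewrite -[u - v](subrKA w).
by apply: snD; exact: sn_memB.
Qed.

Lemma sn_le u v : D u -> D v -> n u <= n (u - v) + n v.
Proof.
by move=> Du Dv; rewrite -{1}(subrK v u); apply: snD => //; exact: sn_memB.
Qed.

(** Meant for the values [u], [v], [w] of an operator at two vectors and at their difference:
    additivity up to a null vector is enough to bound [u - v] by [w]. *)
Lemma sn_le_remainder u v w : D u -> D v -> D w ->
  n (u - (w + v)) = 0 -> n (u - v) <= n w.
Proof.
move=> Du Dv Dw h; have := sn_le (sn_memB Du Dv) Dw.
by rewrite -addrA -opprD (addrC v) h add0r.
Qed.

Lemma oper_id : oper D n D n 1 id.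
Proof. by split=> //= [a u v _ _|u _]; rewrite ?subrr ?sn0 ?mul1r. Qed.

End OneSpace.

Section TwoSpaces.
Variables (D E : set V) (n m : V -> R) (M : R) (S : V -> V).
Hypotheses (Dn : seminormed D n) (Em : seminormed E m) (SM : oper D n E m M S).

Lemma oper_sub u v : D u -> D v -> m (S u - S v) <= M * n (u - v).
Proof.
case: SM => SE Sl Sb Du Dv; have Duv := sn_memB Dn Du Dv.
have := Sl 1 _ _ Duv Dv; rewrite !scale1r subrK => l0.
have := sn_le Em (sn_memB Em (SE _ Du) (SE _ Dv)) (SE _ Duv).
have -> : S u - S v - S (u - v) = S u - (S (u - v) + S v).
  by rewrite opprD addrA addrAC.
by rewrite l0 add0r => /le_trans; apply; exact: Sb.
Qed.

(** This is what allows representatives to be exchanged: an operator descends to the quotient by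
    null vectors. *)
Lemma oper_null u v : D u -> D v -> n (u - v) = 0 -> m (S u - S v) = 0.
Proof.
move=> Du Dv uv0; have := oper_sub Du Dv; rewrite uv0 mulr0 => le0.
case: SM => SE _ _; apply/eqP; rewrite eq_le le0/=.
by apply: (sn_ge0 Em); apply: (sn_memB Em); exact: SE.
Qed.

End TwoSpaces.

Lemma oper_comp (D E F : set V) (n m l : V -> R) (M M' : R) (S S' : V -> V) :
  seminormed D n -> seminormed E m -> seminormed F l -> 0 <= M' ->
  oper D n E m M S -> oper E m F l M' S' -> oper D n F l (M' * M) (S' \o S).
Proof.
move=> Dn Em Fl M'0 SM S'M; case: (SM) => SE Sl Sb; case: (S'M) => S'F S'l S'b.
split=> /= [u Du|a u v Du Dv|u Du]; first exact/S'F/SE.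
- have Ez : E (a *: S u + S v) by case: Em => _ + _ _; apply; exact: SE.
  have Dz : D (a *: u + v) by case: Dn => _ + _ _; exact.
  have Fz : F (a *: S' (S u) + S' (S v)).
    by case: Fl => _ + _ _; apply; apply/S'F/SE.
  apply/eqP; rewrite eq_le; apply/andP; split; last first.
    by apply/(sn_ge0 Fl)/(sn_memB Fl) => //; exact/S'F/SE.
  apply: (le_trans (sn_tri Fl _ Fz (S'F _ Ez))); first exact/S'F/SE.
  by rewrite (oper_null Em Fl S'M) ?S'l ?addr0 ?Sl//; exact: SE.
- apply: (le_trans (S'b _ (SE _ Du))).
  by rewrite -mulrA ler_wpM2l// Sb.
Qed.

End SeminormedSpaces.

(** * Sewing of almost functorial contractions *)

Section Chains.
Context (R : realType).

(** The flag [b] is the direction of travel: homogenization goes both ways, and one set of estimates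
    covers upward and downward chains. *)
Definition ordered (b : bool) (x y : R) : bool := if b then x <= y else y <= x.

Definition step (b : bool) (dl x y : R) : bool :=
  ordered b x y && (`|y - x| <= dl).

Lemma ordered_refl b x : ordered b x x.
Proof. by case: b => /=. Qed.

Lemma ordered_trans b y x z : ordered b x y -> ordered b y z -> ordered b x z.
Proof. by case: b => /= xy yz; [exact: le_trans yz|exact: le_trans xy]. Qed.

Lemma ordered_total b x y : ordered b x y || ordered b y x.
Proof. by case: b => /=; exact: le_total. Qed.

Lemma ordered_antisym b b' x y : b != b' -> ordered b x y -> ordered b' x y ->
  y = x.
Proof.
by case: b b' => -[]//= _ xy yx; apply/eqP; rewrite eq_le xy yx.
Qed.

Lemma ordered_dist b x y z : ordered b x y -> ordered b y z ->
  `|z - x| = `|y - x| + `|z - y|.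
Proof.
case: b => /= xy yz.
  by rewrite !ger0_norm ?subr_ge0//; [lra|exact: le_trans yz].
by rewrite !ler0_norm ?subr_le0//; [lra|exact: le_trans xy].
Qed.

Lemma ordered_itv b (x y z : R) : ordered b x y -> ordered b y z ->
  x \in `[0, 1] -> z \in `[0, 1] -> y \in `[0, 1].
Proof. by case: b; rewrite !in_itv /=; lra. Qed.

Lemma dist_itv (x y : R) : x \in `[0, 1] -> y \in `[0, 1] -> `|y - x| <= 1.
Proof. by rewrite !in_itv/= ler_norml; lra. Qed.

Lemma path_ordered b dl p s : path (step b dl) p s -> ordered b p (last p s).
Proof.
elim: s p => [|x s IH] p /=; first by rewrite ordered_refl.
by case/andP => /andP[px _] /IH; exact: ordered_trans.
Qed.

Lemma path_step_le b dl dl' p s : dl <= dl' ->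
  path (step b dl) p s -> path (step b dl') p s.
Proof.
move=> le; apply: sub_path => x y /andP[xy d]; rewrite /step xy/=.
exact: le_trans le.
Qed.

Lemma path_itv b dl p x s : path (step b dl) p (x :: s) ->
  p \in `[0, 1] -> last x s \in `[0, 1] -> x \in `[0, 1].
Proof.
by case/andP => /andP[px _] /path_ordered xl; exact: (ordered_itv px xl).
Qed.

(** By bisection: [m] halvings bring the length [|q - p|] below [dl]. *)
Lemma exists_chain b (dl p q : R) : 0 < dl -> ordered b p q ->
  exists2 s, path (step b dl) p s & last p s = q.
Proof.
move=> dl0 pq.
have [m le] : exists m, `|q - p| <= dl * 2 ^+ m.
  exists (Num.bound (`|q - p| / dl)); rewrite mulrC -ler_pdivrMr//.
  apply: (le_trans (ltW (archi_boundP _))); first by rewrite divr_ge0// ltW.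
  rewrite -natrX ler_nat; elim: (Num.bound _) => // n IH.
  by rewrite expnS; apply: (leq_ltn_trans IH); rewrite ltn_Pmull// expn_gt0.
elim: m p q pq le => [|m IH] p q pq le.
  by exists [:: q] => //=; rewrite /step pq/= andbT; rewrite expr0 mulr1 in le.
pose x := (p + q) / 2.
have px : ordered b p x by case: b pq {IH} => /=; rewrite /x; lra.
have xq : ordered b x q by case: b pq {IH px} => /=; rewrite /x; lra.
have dx : `|q - x| = `|x - p| by congr (`|_|); rewrite /x; field.
have dpq := ordered_dist px xq.
rewrite exprS in le.
have le1 : `|x - p| <= dl * 2 ^+ m by lra.
have le2 : `|q - x| <= dl * 2 ^+ m by lra.
have [s ps sx] := IH _ _ px le1; have [t pt tq] := IH _ _ xq le2.
by exists (s ++ t); rewrite ?cat_path ?last_cat ?sx ?ps.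
Qed.

(** Turns an estimate along chains of step [e], with an error [c * e], into an exact inequality. *)
Lemma ler_addeps (x y : R) (c : R) :
  (forall e : R, 0 < e -> x <= y + c * e) -> x <= y.
Proof.
move=> h; rewrite leNgt; apply/negP => yx.
have c0 : 0 < `|c| + 1 by rewrite ltr_wpDl.
(* Half the gap, divided by [|c| + 1] rather than [c], which may vanish or be negative. *)
have := h ((x - y) / 2 / (`|c| + 1)).
rewrite !divr_gt0 ?subr_gt0// => /(_ isT).
apply/negP; rewrite -ltNge -ltrBrDl.
apply: (@le_lt_trans _ _ ((x - y) / 2)); last by lra.
rewrite mulrCA -[leRHS]mulr1; apply: ler_wpM2l; first by lra.
by rewrite ler_pdivrMr// mul1r; have := ler_norm c; lra.
Qed.

End Chains.

Section Along.
Context (R : realType) (V : lmodType R).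
Implicit Types T S : R -> R -> V -> V.

Fixpoint along T (p : R) (s : seq R) : V -> V :=
  if s is q :: s' then along T q s' \o T p q else id.

Lemma along_cat T p s t u :
  along T p (s ++ t) u = along T (last p s) t (along T p s u).
Proof. by elim: s p u => //= x s IH p u; rewrite IH. Qed.

End Along.

(** * The limit of compositions along fine chains *)

Section Sewing.
Context (R : realType) (V : lmodType R).
Variables (D : R -> set V) (n : R -> V -> R) (K : R) (T : R -> R -> V -> V).
Implicit Types p q r x y e dl : R.
Hypothesis K0 : 0 <= K.
Hypothesis Dn : forall p, p \in `[0, 1] -> seminormed (D p) (n p).
Hypothesis Dcomplete : forall p, p \in `[0, 1] -> complete_seminormed (D p) (n p).
Hypothesis Top : forall p q, p \in `[0, 1] -> q \in `[0, 1] ->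
  oper (D p) (n p) (D q) (n q) 1 (T p q).
Hypothesis Tid : forall p u, p \in `[0, 1] -> D p u -> n p (T p p u - u) = 0.
Hypothesis Tcomp : forall p q r u, p \in `[0, 1] -> q \in `[0, 1] ->
  r \in `[0, 1] -> D p u ->
  n r (T q r (T p q u) - T p r u) <= K * `|q - p| * `|r - q| * n p u.

Lemma T_mem p q u : p \in `[0, 1] -> q \in `[0, 1] -> D p u -> D q (T p q u).
Proof. by move=> pI qI; case: (Top pI qI) => + _ _; apply. Qed.

(** The bound stays 1 whatever the length of the chain, so that errors made on the way add up
    without being amplified. *)
Lemma along_oper b dl p s : path (step b dl) p s -> p \in `[0, 1] ->
  last p s \in `[0, 1] ->
  oper (D p) (n p) (D (last p s)) (n (last p s)) 1 (along T p s).
Proof.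
elim: s p => [|x s IH] p; first by move=> _ pI _; exact/oper_id/Dn.
move=> ps pI lI; have xI := path_itv ps pI lI; case/andP: ps => _ xs.
rewrite -[1](mulr1 1).
exact: (oper_comp (Dn pI) (Dn xI) (Dn lI) ler01 (Top pI xI) (IH _ xs xI lI)).
Qed.

Lemma along_mem b dl p s u : path (step b dl) p s -> p \in `[0, 1] ->
  last p s \in `[0, 1] -> D p u -> D (last p s) (along T p s u).
Proof. by move=> ps pI lI; case: (along_oper ps pI lI) => + _ _; apply. Qed.

(** A monotone chain that returns to [p] is constant, but it still applies [T p p], which is the
    identity only up to null vectors. *)
Lemma along_loop b dl p s u : path (step b dl) p s -> p \in `[0, 1] ->
  last p s = p -> D p u -> n p (along T p s u - u) = 0.
Proof.
elim: s p u => [|x s IH] p u ps pI lp Du.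
  by rewrite subrr (sn0 (Dn pI)).
have lp' : last x s = p := lp.
have xp : x = p.
  case/andP: ps => /andP[px _] /path_ordered; rewrite lp' => xp.
  have := ordered_dist px xp; rewrite subrr normr0 => /eqP.
  rewrite eq_sym paddr_eq0// normr_eq0 subr_eq0 => /andP[/eqP-> _] //.
move: ps lp'; rewrite xp => /andP[_ ps'] lp' /=.
have DTu : D p (T p p u) by exact: T_mem.
have := along_mem ps' pI; rewrite lp' => /(_ _ pI DTu) DA.
apply/eqP; rewrite eq_le (sn_ge0 (Dn pI)) ?andbT; last exact: (sn_memB (Dn pI)).
apply: (le_trans (sn_tri (Dn pI) DA Du DTu)).
by rewrite IH// Tid// addr0.
Qed.

(** The merged chain is built step by step: the chain whose next point is
    farther is refined by the next point of the other one. *)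
Lemma along_close b dl p s t u : path (step b dl) p s -> path (step b dl) p t ->
  last p s = last p t -> p \in `[0, 1] -> last p t \in `[0, 1] -> D p u ->
  n (last p t) (along T p s u - along T p t u)
    <= K * dl * `|last p t - p| * n p u.
Proof.
move: {2}(size s + size t)%N (leqnn (size s + size t)) => m.
elim: m p s t u => [|m IH] p s t u.
  rewrite leqn0 addn_eq0 => /andP[/nilP-> /nilP->] _ _ _ pI _ Du /=.
  by rewrite !subrr (sn0 (Dn pI)) normr0 mulr0 mul0r.
wlog: s t / match s, t with x :: _, y :: _ => ordered b x y | [::], _ => true
   | _, _ => false end.
  move=> W szm ps pt lst pI lI Du.
  have sym : n (last p t) (along T p s u - along T p t u) =
             n (last p t) (along T p t u - along T p s u).
    apply: (snC (Dn lI)); last exact: along_mem pt pI lI Du.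
    by have := along_mem ps pI; rewrite lst; exact.
  case: s t => [|x s] [|y t] in W szm ps pt lst lI sym *.
  - exact: W.
  - exact: W.
  - by rewrite sym -lst; apply: W; rewrite // ?lst// addnC.
  - case/orP: (ordered_total b x y) => xy; first exact: W.
    by rewrite sym -lst; apply: W; rewrite // ?lst// addnC.
case: s => [|x s].
  move=> _ _ _ pt lpt pI lI Du; rewrite /= in lpt.
  have := along_loop pt pI (esym lpt) Du.
  rewrite -lpt /= => loop0; rewrite subrr normr0 mulr0 mul0r (snC (Dn pI)) ?loop0//.
  by have := along_mem pt pI; rewrite -lpt; exact.
case: t => [//|y t] xy szm ps pt lst pI lI Du.
have xI : x \in `[0, 1] by apply: (path_itv ps) => //; move: lst => /= ->.
have yI : y \in `[0, 1] by exact: (path_itv pt).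
case/andP: (ps) => /andP[px dx] ps'; case/andP: (pt) => /andP[py dy] pt'.
have dxy : `|y - x| <= dl.
  by apply: le_trans dy; rewrite (ordered_dist px xy) lerDr.
(* Since [x] lies between [p] and [y], inserting it into the second chain keeps the step at most
   [dl]; both chains then go through [x], and the induction hypothesis applies from there. *)
have pt2 : path (step b dl) x (y :: t) by rewrite /= /step xy dxy.
have yl : ordered b y (last y t) by exact: path_ordered pt'.
have Dx := T_mem pI xI Du; have Dy := T_mem pI yI Du.
have Dxy := T_mem xI yI Dx.
have := IH x s (y :: t) (T p x u) szm ps' pt2 lst xI lI Dx => /= IH1.
have lI' : last y t \in `[0, 1] by [].
have A1 : D (last y t) (along T x s (T p x u)).
  by have := along_mem ps' xI; move: lst => /= -> /(_ _ lI Dx).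
have A2 := along_mem pt' yI lI' Dy; have A3 := along_mem pt' yI lI' Dxy.
apply: (le_trans (sn_tri (Dn lI') A1 A2 A3)).
(* The insertion replaces [T p y] by [T p x] followed by [T x y], at a cost [K * |x - p| * |y - x|
   <= K * dl * |x - p|]; the rest of the chain is a contraction. The lengths then add up by
   [ordered_dist]. *)
have := oper_sub (Dn yI) (Dn lI') (along_oper pt' yI lI') Dxy Dy.
rewrite mul1r => le2.
have {le2} le2 := le_trans le2 (Tcomp pI xI yI Du).
have nx : n x (T p x u) <= n p u.
  by case: (Top pI xI) => _ _ /(_ u Du); rewrite mul1r.
have nu0 := sn_ge0 (Dn pI) Du.
have dl0 : 0 <= dl by exact: le_trans dx.
have xl : ordered b x (last y t) by exact: ordered_trans yl.
rewrite (ordered_dist px xl) mulrDr mulrDl [leRHS]addrC; apply: lerD.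
  apply: (le_trans IH1); apply: ler_wpM2l => //.
  by rewrite !mulr_ge0.
apply: (le_trans le2); rewrite ler_wpM2r//.
by rewrite -!mulrA ler_wpM2l// mulrC ler_wpM2r.
Qed.

(** The limit is required to be close to every chain from [p] to [q], in either direction, instead
    of being the limit of one sequence: this determines it up to a null vector and involves no
    exhaustion. *)
Definition sew_spec p q u v := D q v /\
  forall b dl s, 0 < dl -> path (step b dl) p s -> last p s = q ->
    n q (along T p s u - v) <= K * dl * `|q - p| * n p u.

Definition sew p q u := xget 0 (sew_spec p q u).

(* Without this generalization [lra] compares the seminorms up to conversion. *)
Ltac lran :=
  repeat match goal with |- context [n ?p ?w] =>
    let x := fresh "x" in set x := (n p w); move: x => x end;
  clear - K0 Dn Dcomplete Top Tid Tcomp; intros; lra.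

Lemma sew_spec_ex p q u : p \in `[0, 1] -> q \in `[0, 1] -> D p u ->
  exists v, sew_spec p q u v.
Proof.
move=> pI qI Du; have nu0 := sn_ge0 (Dn pI) Du.
pose b := p <= q.
have pq : ordered b p q by rewrite /ordered /b; case: leP => // /ltW.
have inv0 k : 0 < k.+1%:R^-1 :> R by rewrite invr_gt0.
have ch k := cid2 (exists_chain (inv0 k) pq).
pose s k := sval (ch k).
have ps k : path (step b k.+1%:R^-1) p (s k) by rewrite /s; case: (ch k).
have ls k : last p (s k) = q by rewrite /s; case: (ch k).
have Dl b' dl t : path (step b' dl) p t -> last p t = q -> D q (along T p t u).
  by move=> pt lt; have := along_mem pt pI; rewrite lt; exact.
have close dl t k : path (step b dl) p t -> last p t = q -> k.+1%:R^-1 <= dl ->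
    n q (along T p t u - along T p (s k) u) <= K * dl * `|q - p| * n p u.
  move=> pt lt kd; have := along_close pt (path_step_le kd (ps k)).
  by rewrite lt ls; exact.
have [v Dv vlim] : exists2 v, D q v & forall e, 0 < e ->
    exists M, forall i, (M <= i)%N -> n q (along T p (s i) u - v) <= e.
  apply: (Dcomplete qI) => [k|e e0]; first exact: Dl (ps k) (ls k).
  (* The added 1 keeps [c] positive when the product vanishes, so that [c / e] can be used to choose
     the rank. *)
  pose c := K * `|q - p| * n p u + 1.
  have c0 : 0 < c by rewrite ltr_wpDl// !mulr_ge0.
  pose M := Num.bound (c / e).
  have Me : M.+1%:R^-1 * c <= e.
    rewrite mulrC ler_pdivrMr ?ltr0Sn// -ler_pdivrMl// mulrC.
    rewrite -natr1; have := archi_boundP (ltW (divr_gt0 c0 e0)).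
    by rewrite -/M; lra.
  have inv i : (M <= i)%N -> i.+1%:R^-1 <= M.+1%:R^-1 :> R.
    by move=> Mi; rewrite lef_pV2 ?posrE ?ltr0Sn// ler_nat.
  exists M => i j Mi Mj; apply: le_trans Me.
  apply: (le_trans (close _ _ _ (path_step_le (inv _ Mi) (ps i)) (ls i) (inv _ Mj))).
  rewrite /c mulrDr mulr1 -!mulrA mulrCA.
  by rewrite lerDl invr_ge0 ler0n.
exists v; split=> // b' dl t dl0 pt lt.
have [bb|bb] := eqVneq b' b.
  move: pt; rewrite bb => pt.
  apply: (@ler_addeps _ _ _ 1) => e e0; rewrite mul1r.
  have [M Me] := vlim e e0.
  pose k := maxn M (Num.bound dl^-1).
  have kdl : k.+1%:R^-1 <= dl.
    rewrite invf_ple ?posrE ?ltr0Sn//.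
    apply: (le_trans (ltW (archi_boundP _))); first by rewrite invr_ge0 ltW.
    by rewrite ler_nat leqW// leq_maxr.
  apply: (le_trans (sn_tri (Dn qI) (Dl _ _ _ pt lt) Dv (Dl _ _ _ (ps k) (ls k)))).
  by apply: lerD; [exact: close|apply: Me; rewrite leq_maxl].
(* A chain in the other direction exists only if [q = p]; all chains are then loops, and the limit
   is [u] up to a null vector. *)
have qp : q = p.
  have := path_ordered pt; rewrite lt => pq'.
  by have := ordered_antisym bb pq' pq.
have -> : `|q - p| = 0 by rewrite qp subrr normr0.
rewrite mulr0 mul0r.
have Duq : D q u by rewrite qp.
have loop b1 dl1 s1 : path (step b1 dl1) p s1 -> last p s1 = q ->
    n q (along T p s1 u - u) = 0.
  by move=> ps1 ls1; rewrite [X in n X]qp; exact: (along_loop ps1 pI (etrans ls1 qp)).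
have Dt := Dl _ _ _ pt lt.
apply: (le_trans (sn_tri (Dn qI) Dt Dv Duq)).
rewrite (loop _ _ _ pt lt) add0r.
apply: (@ler_addeps _ _ _ 1) => e e0; rewrite mul1r add0r.
have [M /(_ M (leqnn _)) Me] := vlim e e0; apply: le_trans Me.
have Ds := Dl _ _ _ (ps M) (ls M).
apply: (le_trans (sn_tri (Dn qI) Duq Dv Ds)).
by rewrite (snC (Dn qI) Duq Ds) (loop _ _ _ (ps M) (ls M)) add0r.
Qed.

Lemma sewP p q u : p \in `[0, 1] -> q \in `[0, 1] -> D p u ->
  sew_spec p q u (sew p q u).
Proof. by move=> pI qI Du; apply: xgetPex; exact: sew_spec_ex. Qed.

Lemma sew_mem p q u : p \in `[0, 1] -> q \in `[0, 1] -> D p u -> D q (sew p q u).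
Proof. by move=> pI qI Du; case: (sewP pI qI Du). Qed.

Lemma sew_along b dl p q u s : p \in `[0, 1] -> q \in `[0, 1] -> D p u ->
  0 < dl -> path (step b dl) p s -> last p s = q ->
  n q (along T p s u - sew p q u) <= K * dl * `|q - p| * n p u.
Proof. by move=> pI qI Du dl0 ps ls; case: (sewP pI qI Du) => _ h; exact: h ps ls. Qed.

Lemma ordered_ex (p q : R) : exists b, ordered b p q.
Proof. by case/orP: (le_total p q); [exists true|exists false]. Qed.

(** [T p q] is the composition along the one-point chain [[:: q]], whose step is [|q - p|]; this
    gives the second factor [|q - p|]. An extra [e] keeps the step positive when [p = q]. *)
Lemma sew_approx p q u : p \in `[0, 1] -> q \in `[0, 1] -> D p u ->
  n q (T p q u - sew p q u) <= K * `|q - p| ^+ 2 * n p u.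
Proof.
move=> pI qI Du; have [b pq] := ordered_ex p q.
have nu0 := sn_ge0 (Dn pI) Du.
apply: (@ler_addeps _ _ _ (K * `|q - p| * n p u)) => e e0.
have dl0 : 0 < `|q - p| + e by rewrite ltr_wpDl.
have := @sew_along b _ p q u [:: q] pI qI Du dl0.
rewrite /= /step pq lerDl (ltW e0) => /(_ isT erefl) /le_trans; apply.
by rewrite mulrDr !mulrDl expr2 !mulrA lerD2l -!mulrA (mulrCA e) (mulrC e) !mulrA.
Qed.

(** Linearity and the bound hold along each fine chain and pass to the limit; for linearity one
    chain serves all the vectors involved. *)
Lemma sew_oper p q : p \in `[0, 1] -> q \in `[0, 1] ->
  oper (D p) (n p) (D q) (n q) 1 (sew p q).
Proof.
move=> pI qI; have [b pq] := ordered_ex p q.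
have est u e : D p u -> 0 < e ->
    exists s, [/\ path (step b e) p s, last p s = q,
      D q (along T p s u) & n q (along T p s u - sew p q u) <= K * e * n p u].
  move=> Du e0; have [s ps ls] := exists_chain e0 pq; exists s; split=> //.
    by have := along_mem ps pI; rewrite ls; exact.
  apply: (le_trans (sew_along pI qI Du e0 ps ls)).
  rewrite ler_wpM2r ?(sn_ge0 (Dn pI))// ler_piMr ?mulr_ge0 ?(ltW e0)//.
  exact: dist_itv.
split=> [u Du|a u v Du Dv|u Du]; first exact: sew_mem.
- have Dw : D p (a *: u + v) by case: (Dn pI) => _ + _ _; exact.
  have Sw := sew_mem pI qI Dw; have Su := sew_mem pI qI Du.
  have Sv := sew_mem pI qI Dv; have Dq := Dn qI.
  have Sz : D q (a *: sew p q u + sew p q v) by case: Dq => _ + _ _; exact.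
  apply/eqP; rewrite eq_le (sn_ge0 Dq) ?andbT; last exact: (sn_memB Dq).
  apply: (@ler_addeps _ _ _ (K * n p (a *: u + v) + `|a| * (K * n p u) + K * n p v)).
  move=> e e0; rewrite add0r.
  have [s [ps ls Aw lew]] := est _ e Dw e0.
  have Au : D q (along T p s u) by have := along_mem ps pI; rewrite ls; exact.
  have Av : D q (along T p s v) by have := along_mem ps pI; rewrite ls; exact.
  have leu := sew_along pI qI Du e0 ps ls.
  have lev := sew_along pI qI Dv e0 ps ls.
  have Az : D q (a *: along T p s u + along T p s v) by case: Dq => _ + _ _; exact.
  have qp1 := dist_itv pI qI.
  have le1 (w : V) : D p w -> K * e * `|q - p| * n p w <= K * e * n p w.
    move=> Dpw; rewrite ler_wpM2r ?(sn_ge0 (Dn pI))//.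
    by rewrite ler_piMr ?mulr_ge0 ?(ltW e0).
  apply: (le_trans (sn_tri Dq Sw Sz Aw)); rewrite (snC Dq Sw Aw).
  apply: (le_trans (lerD lew (sn_tri Dq Aw Sz Az))).
  have -> : n q (along T p s (a *: u + v) - (a *: along T p s u + along T p s v)) = 0.
    by have := along_oper ps pI; rewrite ls => /(_ qI)[_ + _]; exact.
  rewrite add0r.
  have -> : a *: along T p s u + along T p s v - (a *: sew p q u + sew p q v)
     = a *: (along T p s u - sew p q u) + (along T p s v - sew p q v).
    by rewrite scalerBr opprD !addrA; congr (_ - _); rewrite addrAC.
  have Bu := sn_memB Dq Au Su; have Bv := sn_memB Dq Av Sv.
  apply: (le_trans (lerD (lexx _) (snD Dq (sn_memZ Dq a Bu) Bv))).
  rewrite (snZ Dq)//.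
  have := ler_wpM2l (normr_ge0 a) (le_trans leu (le1 _ Du)).
  have := le_trans lev (le1 _ Dv); move: lew; lran.
- apply: (@ler_addeps _ _ _ (K * n p u)) => e e0.
  have [s [ps ls As les]] := est _ e Du e0; have Dq := Dn qI.
  have Su := sew_mem pI qI Du.
  apply: (le_trans (sn_le Dq Su As)); rewrite (snC Dq Su As).
  have : n q (along T p s u) <= 1 * n p u.
    by have := along_oper ps pI; rewrite ls => /(_ qI)[_ _]; exact.
  move: les; lran.
Qed.

Lemma sew_le p q u : p \in `[0, 1] -> q \in `[0, 1] -> D p u ->
  n q (sew p q u) <= n p u.
Proof.
by move=> pI qI Du; case: (sew_oper pI qI) => _ _ /(_ u Du); rewrite mul1r.
Qed.

Lemma sew_sub p q u v : p \in `[0, 1] -> q \in `[0, 1] -> D p u -> D p v ->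
  n q (sew p q u - sew p q v) <= n p (u - v).
Proof.
move=> pI qI Du Dv.
by have := oper_sub (Dn pI) (Dn qI) (sew_oper pI qI) Du Dv; rewrite mul1r.
Qed.

(** As the two parts go in the same direction, a fine chain from [p] to [q] followed by one from [q]
    to [r] is a fine chain from [p] to [r]. The constant 3 counts the three comparisons of [sew]
    with a chain. *)
Lemma sew_comp b p q r u : p \in `[0, 1] -> q \in `[0, 1] -> r \in `[0, 1] ->
  ordered b p q -> ordered b q r -> D p u ->
  n r (sew q r (sew p q u) - sew p r u) = 0.
Proof.
move=> pI qI rI pq qr Du; have Dr := Dn rI; have nu0 := sn_ge0 (Dn pI) Du.
have Sq := sew_mem pI qI Du; have Sr := sew_mem qI rI Sq.
have Spr := sew_mem pI rI Du.
apply/eqP; rewrite eq_le (sn_ge0 Dr) ?andbT; last exact: (sn_memB Dr).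
apply: (@ler_addeps _ _ _ (3 * K * n p u)) => e e0; rewrite add0r.
have [s ps ls] := exists_chain e0 pq; have [t qt lt] := exists_chain e0 qr.
have pst : path (step b e) p (s ++ t) by rewrite cat_path ps ls.
have lst : last p (s ++ t) = r by rewrite last_cat ls.
have As : D q (along T p s u) by have := along_mem ps pI; rewrite ls; exact.
have Ast : D r (along T p (s ++ t) u).
  by have := along_mem pst pI; rewrite lst; exact.
have SA := sew_mem qI rI As.
have le1 x y (w : V) z : D z w -> x \in `[0, 1] -> y \in `[0, 1] ->
    z \in `[0, 1] -> K * e * `|y - x| * n z w <= K * e * n z w.
  move=> Dpw xI yI zI; rewrite ler_wpM2r ?(sn_ge0 (Dn zI))//.
  by rewrite ler_piMr ?mulr_ge0 ?(ltW e0)// dist_itv.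
apply: (le_trans (sn_tri Dr Sr Spr SA)).
have h1 : n r (sew q r (sew p q u) - sew q r (along T p s u)) <= K * e * n p u.
  apply: (le_trans (sew_sub qI rI Sq As)); rewrite (snC (Dn qI))//.
  exact: le_trans (sew_along pI qI Du e0 ps ls) (le1 _ _ _ _ Du pI qI pI).
have h2 : n r (sew q r (along T p s u) - along T p (s ++ t) u) <= K * e * n p u.
  rewrite (snC Dr)// along_cat ls.
  apply: (le_trans (sew_along qI rI As e0 qt lt)).
  apply: (le_trans (le1 _ _ _ _ As qI rI qI)).
  rewrite ler_wpM2l ?mulr_ge0 ?(ltW e0)//.
  by have := along_oper ps pI; rewrite ls => /(_ qI)[_ _ /(_ u Du)]; rewrite mul1r.
have h3 : n r (along T p (s ++ t) u - sew p r u) <= K * e * n p u.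
  exact: le_trans (sew_along pI rI Du e0 pst lst) (le1 _ _ _ _ Du pI rI pI).
have := sn_tri Dr SA Spr Ast; move: h1 h2 h3; lran.
Qed.

Lemma sew_id p u : p \in `[0, 1] -> D p u -> n p (sew p p u - u) = 0.
Proof.
move=> pI Du; have := @sew_along true 1 p p u [::] pI pI Du ltr01 isT erefl.
have Su := sew_mem pI pI Du.
rewrite /= subrr normr0 mulr0 mul0r (snC (Dn pI) Su Du) => le0.
by apply/eqP; rewrite eq_le le0 (sn_ge0 (Dn pI))//; exact: (sn_memB (Dn pI)).
Qed.

(** The constant 3 collects the replacement of [sew] by [T] on the way out, the same on the way
    back, and the composition defect of [T] on the round trip. *)
Lemma sew_back_le p q u : p \in `[0, 1] -> q \in `[0, 1] -> D p u ->
  n p (sew q p (sew p q u) - u) <= 3 * K * `|q - p| ^+ 2 * n p u.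
Proof.
move=> pI qI Du; have Dp := Dn pI; have Sq := sew_mem pI qI Du.
have Tq := T_mem pI qI Du; have STq := sew_mem qI pI Tq.
have TTq := T_mem qI pI Tq; have Tp := T_mem pI pI Du.
have SSq := sew_mem qI pI Sq.
have h1 : n p (sew q p (sew p q u) - sew q p (T p q u)) <= K * `|q - p| ^+ 2 * n p u.
  apply: (le_trans (sew_sub qI pI Sq Tq)); rewrite (snC (Dn qI))//.
  exact: sew_approx.
have h2 : n p (sew q p (T p q u) - T q p (T p q u)) <= K * `|q - p| ^+ 2 * n p u.
  rewrite (snC Dp)//; apply: (le_trans (sew_approx qI pI Tq)).
  rewrite distrC ler_wpM2l ?mulr_ge0//.
  by case: (Top pI qI) => _ _ /(_ u Du); rewrite mul1r.
have h3 : n p (T q p (T p q u) - T p p u) <= K * `|q - p| ^+ 2 * n p u.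
  rewrite (_ : K * _ = K * `|q - p| * `|p - q|); first exact: Tcomp.
  by rewrite (distrC p q) -mulrA -expr2.
have h4 := sn_tri Dp SSq Du STq; have h5 := sn_tri Dp STq Du TTq.
have h6 := sn_tri Dp TTq Du Tp; rewrite (Tid pI Du) in h6.
move: h1 h2 h3 h4 h5 h6; lran.
Qed.

(** With [x] the midpoint, the round trip from [p] to [q] is the round trip from [x] to [q] nested
    in the one from [p] to [x]. The bound being quadratic in the length, the two halves together
    cost half of the whole; [m] halvings give the factor [2 ^- m]. *)
Lemma sew_inv p q u : p \in `[0, 1] -> q \in `[0, 1] -> D p u ->
  n p (sew q p (sew p q u) - u) = 0.
Proof.
move=> pI qI Du.
suff h m : n p (sew q p (sew p q u) - u)
    <= 3 * K * `|q - p| ^+ 2 * n p u / 2 ^+ m.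
  have Dp := Dn pI; have SS : D p (sew q p (sew p q u)).
    by apply: sew_mem => //; exact: sew_mem.
  apply/eqP; rewrite eq_le (sn_ge0 Dp) ?andbT; last exact: (sn_memB Dp).
  set c := 3 * K * _ * _ in h.
  apply: (@ler_addeps _ _ _ c) => e e0; rewrite add0r.
  have c0 : 0 <= c by rewrite !mulr_ge0// (sn_ge0 Dp).
  apply: (le_trans (h (Num.bound e^-1))); apply: ler_wpM2l => //.
  rewrite invf_ple ?posrE ?exprn_gt0//.
  apply: (le_trans (ltW (archi_boundP _))); first by rewrite invr_ge0 ltW.
  by rewrite -natrX ler_nat ltnW// ltn_expl.
elim: m p q pI qI u Du => [|m IH] p q pI qI u Du.
  by rewrite expr0 divr1; exact: sew_back_le.
pose x := (p + q) / 2.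
have [b pq] := ordered_ex p q; pose b' := ~~ b.
have px : ordered b p x by case: b pq {b'} => /=; rewrite /x; lra.
have xq : ordered b x q by case: b pq {b' px} => /=; rewrite /x; lra.
have qx : ordered b' q x by move: xq; rewrite /b'; case: (b).
have xp : ordered b' x p by move: px; rewrite /b'; case: (b).
have xI : x \in `[0, 1] by exact: (ordered_itv px xq).
have dx : `|q - x| = `|x - p| by congr (`|_|); rewrite /x; field.
have dpq : `|q - p| = 2 * `|x - p|.
  by rewrite (ordered_dist px xq) dx; lra.
have Sx := sew_mem pI xI Du; have Sxq := sew_mem xI qI Sx.
have Sq := sew_mem pI qI Du; have Sqp := sew_mem qI pI Sq.
have Dp := Dn pI; have Dq := Dn qI; have Dx := Dn xI.
have Sqx := sew_mem qI xI Sq; have Sqxp := sew_mem xI pI Sqx.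
have SX := sew_mem qI xI Sxq; have SXp := sew_mem xI pI SX.
have Sxp := sew_mem xI pI Sx.
have e1 := sew_comp qI xI pI qx xp Sq.
have e2 : n x (sew q x (sew p q u) - sew q x (sew x q (sew p x u))) <= 0.
  apply: (le_trans (sew_sub qI xI Sq Sxq)).
  by rewrite (snC Dq)// (sew_comp pI xI qI px xq Du).
have h1 := IH x q xI qI _ Sx; have h2 := IH p x pI xI _ Du.
have h3 := sn_tri Dp Sqp Du Sqxp; rewrite (snC Dp Sqp Sqxp) e1 in h3.
have h4 := sn_tri Dp Sqxp Du Sxp.
have h5 := sew_sub xI pI Sqx Sx.
have h6 := sn_tri Dx Sqx Sx SX.
have h7 : 3 * K * `|q - x| ^+ 2 * n x (sew p x u) / 2 ^+ m <=
   3 * K * `|x - p| ^+ 2 * n p u / 2 ^+ m.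
  rewrite ler_wpM2r ?invr_ge0 ?exprn_ge0// dx ler_wpM2l ?mulr_ge0//.
  exact: sew_le.
apply: (@le_trans _ _ (2 * (3 * K * `|x - p| ^+ 2 * n p u / 2 ^+ m))).
  by move: h1 h2 h3 h4 h5 h6 h7 e2; lran.
rewrite dpq [2 ^+ m.+1]exprS le_eqVlt; apply/orP; left; apply/eqP; field.
by rewrite expf_neq0.
Qed.

Lemma sew_isometry p q u : p \in `[0, 1] -> q \in `[0, 1] -> D p u ->
  n q (sew p q u) = n p u.
Proof.
move=> pI qI Du; apply/eqP; rewrite eq_le sew_le//=.
have Sq := sew_mem pI qI Du; have Sp := sew_mem qI pI Sq; have Dp := Dn pI.
apply: (le_trans (sn_le Dp Du Sp)).
by rewrite (snC Dp)// sew_inv// add0r sew_le.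
Qed.

(** The two families are compared along fine chains, where the errors of
    second order add up to a small one. *)
Lemma sew_unique (A : set R) (S : R -> R -> V -> V) :
  A `<=` [set` `[(0:R), 1]] ->
  (forall p q, A p -> A q -> exists M, oper (D p) (n p) (D q) (n q) M (S p q)) ->
  (forall p u, A p -> D p u -> n p (S p p u - u) = 0) ->
  (forall b p q r u, A p -> A q -> A r -> ordered b p q -> ordered b q r ->
    D p u -> n r (S q r (S p q u) - S p r u) = 0) ->
  (forall p q u, A p -> A q -> D p u ->
    n q (S p q u - T p q u) <= K * `|q - p| ^+ 2 * n p u) ->
  forall p q u, A p -> A q -> D p u ->
  (forall dl, 0 < dl -> exists b s, [/\ path (step b dl) p s, last p s = q &
     forall x, x \in s -> A x]) ->
  n q (S p q u - sew p q u) = 0.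
Proof.
move=> AI Sop Sid Scomp Sapp.
(* Each operator of [S] comes with its own bound; closeness to the contraction [T] and
   [|q - p| <= 1] make [1 + K] a common one. *)
have Sbd p q : A p -> A q -> oper (D p) (n p) (D q) (n q) (1 + K) (S p q).
  move=> Ap Aq; have [M [SE Sl _]] := Sop _ _ Ap Aq; split=> // u Du.
  have pI := AI _ Ap; have qI := AI _ Aq; have Dq := Dn qI.
  have Tq := T_mem pI qI Du.
  apply: (le_trans (sn_le Dq (SE _ Du) Tq)).
  have := Sapp p q u Ap Aq Du.
  have : n q (T p q u) <= 1 * n p u by case: (Top pI qI) => _ _; exact.
  have : K * `|q - p| ^+ 2 * n p u <= K * n p u.
    rewrite ler_wpM2r ?(sn_ge0 (Dn pI))// ler_piMr//.
    by rewrite exprn_ile1// dist_itv.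
  lran.
have Smem p q u : A p -> A q -> D p u -> D q (S p q u).
  by move=> Ap Aq; case: (Sbd _ _ Ap Aq) => + _ _; exact.
have near p q u : A p -> A q -> D p u ->
    n q (S p q u - sew p q u) <= 2 * K * `|q - p| ^+ 2 * n p u.
  move=> Ap Aq Du; have pI := AI _ Ap; have qI := AI _ Aq.
  apply: (le_trans (sn_tri (Dn qI) _ (sew_mem pI qI Du) (T_mem pI qI Du))).
    exact: Smem.
  have := Sapp p q u Ap Aq Du; have := sew_approx pI qI Du; lran.
(* Each step contributes [2 K |x - p|^2 <= 2 K dl |x - p|], then carried to [q] by [S]. No power of
   [1 + K] appears: by functoriality the remaining part of the chain is the single operator
   [S x q]. *)
have tel b dl s p q u : A p -> path (step b dl) p s -> last p s = q ->
    (forall x, x \in s -> A x) -> D p u ->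
    n q (S p q u - sew p q u) <= (1 + K) * (2 * K) * dl * `|q - p| * n p u.
  elim: s p q u => [|x s IH] p q u Ap ps ls As Du.
    move: ls => /= <-; have pI := AI _ Ap; rewrite subrr normr0 mulr0 mul0r.
    apply: (le_trans (sn_tri (Dn pI) (Smem _ _ _ Ap Ap Du) (sew_mem pI pI Du) Du)).
    by rewrite Sid// (snC (Dn pI) Du (sew_mem pI pI Du)) sew_id// addr0.
  have Ax : A x by apply: As; rewrite mem_head.
  have As' y : y \in s -> A y by move=> ys; apply: As; rewrite in_cons ys orbT.
  have Aq : A q.
    by rewrite -ls /=; case: (s) As' => [|y s'] // As'; apply: As'; exact: (mem_last y s').
  have pI := AI _ Ap; have xI := AI _ Ax; have qI := AI _ Aq; have Dq := Dn qI.
  case/andP: ps => /andP[px dx] xs; have ls' : last x s = q := ls.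
  have xq : ordered b x q by rewrite -ls'; exact: path_ordered xs.
  have dl0 : 0 <= dl by exact: le_trans dx.
  have Sx := Smem _ _ _ Ap Ax Du; have Sxq := Smem _ _ _ Ax Aq Sx.
  have Spq := Smem _ _ _ Ap Aq Du.
  have Wx := sew_mem pI xI Du; have Wxq := sew_mem xI qI Wx.
  have SW := Smem _ _ _ Ax Aq Wx; have Wpq := sew_mem pI qI Du.
  have nu0 := sn_ge0 (Dn pI) Du.
  have h1 := IH x q _ Ax xs ls' As' Wx.
  have h2 := oper_sub (Dn xI) Dq (Sbd _ _ Ax Aq) Sx Wx.
  have h3 := near p x u Ap Ax Du.
  have h4 := Scomp b p x q u Ap Ax Aq px xq Du.
  have h5 := sew_comp pI xI qI px xq Du.
  have t1 := sn_tri Dq Spq Wpq Sxq; rewrite (snC Dq Spq Sxq) h4 in t1.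
  have t2 := sn_tri Dq Sxq Wpq SW.
  have t3 := sn_tri Dq SW Wpq Wxq; rewrite h5 in t3.
  have h6 : (1 + K) * (2 * K) * dl * `|q - x| * n x (sew p x u) <=
            (1 + K) * (2 * K) * dl * `|q - x| * n p u.
    by apply: ler_wpM2l; [rewrite !mulr_ge0// addr_ge0|exact: sew_le].
  have h7 : (1 + K) * n x (S p x u - sew p x u) <=
            (1 + K) * (2 * K * dl * `|x - p| * n p u).
    apply: ler_wpM2l; first by rewrite addr_ge0.
    apply: (le_trans h3); rewrite ler_wpM2r// expr2 !mulrA ler_wpM2r//.
    by rewrite ler_wpM2l// mulr_ge0.
  rewrite (ordered_dist px xq); move: h1 h2 h3 h6 h7 t1 t2 t3; lran.
move=> p q u Ap Aq Du ch; have pI := AI _ Ap; have qI := AI _ Aq.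
apply/eqP; rewrite eq_le (sn_ge0 (Dn qI)) ?andbT; last first.
  by apply: (sn_memB (Dn qI)); [exact: Smem|exact: sew_mem].
apply: (@ler_addeps _ _ _ ((1 + K) * (2 * K) * `|q - p| * n p u)) => e e0.
have [b [s [ps ls As]]] := ch e e0.
apply: (le_trans (tel b e s p q u Ap ps ls As Du)); rewrite add0r.
by rewrite le_eqVlt; apply/orP; left; apply/eqP; ring.
Qed.

End Sewing.

(** * Orthogonal projection *)

Section SemiInnerProduct.
Context (R : realType) (V : lmodType R).

Definition subspace (D : set V) : Prop :=
  D 0 /\ forall a u v, D u -> D v -> D (a *: u + v).

Definition semi_inner (D : set V) (b : V -> V -> R) : Prop :=
  [/\ subspace D, forall u v, D u -> D v -> b u v = b v u,
      forall a u v w, D u -> D v -> D w -> b (a *: u + v) w = a * b u w + b v w &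
      forall u, D u -> 0 <= b u u].

Definition inorm (b : V -> V -> R) (u : V) : R := Num.sqrt (b u u).

Variables (D : set V) (b : V -> V -> R).
Hypothesis Db : semi_inner D b.
Implicit Types u v w : V.

Lemma si_lin a u v : D u -> D v -> D (a *: u + v).
Proof. by case: Db => -[_ + _ _ _]; apply. Qed.

Lemma si_memZ a u : D u -> D (a *: u).
Proof. by case: Db => -[D0 h] _ _ _ Du; have := h a _ _ Du D0; rewrite addr0. Qed.

Lemma si_memD u v : D u -> D v -> D (u + v).
Proof. by move=> Du Dv; have := si_lin 1 Du Dv; rewrite scale1r. Qed.

Lemma si_memB u v : D u -> D v -> D (u - v).
Proof. by move=> Du Dv; rewrite addrC -scaleN1r; exact: si_lin. Qed.

Lemma siC u v : D u -> D v -> b u v = b v u.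
Proof. by case: Db => _ + _ _; apply. Qed.

Lemma siDl u v w : D u -> D v -> D w -> b (u + v) w = b u w + b v w.
Proof.
move=> Du Dv Dw; case: Db => _ _ + _ => /(_ 1 u v w Du Dv Dw).
by rewrite scale1r mul1r.
Qed.

Lemma si0l w : D w -> b 0 w = 0.
Proof.
have D0 : D 0 by case: Db => -[].
move=> Dw; have := siDl D0 D0 Dw; rewrite addr0; lra.
Qed.

Lemma siZl a u w : D u -> D w -> b (a *: u) w = a * b u w.
Proof.
have D0 : D 0 by case: Db => -[].
move=> Du Dw; case: Db => _ _ + _ => /(_ a u 0 w Du D0 Dw).
by rewrite addr0 si0l// addr0.
Qed.

Lemma siBl u v w : D u -> D v -> D w -> b (u - v) w = b u w - b v w.
Proof.
move=> Du Dv Dw; rewrite -scaleN1r siDl//; last exact: si_memZ.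
by rewrite siZl// mulN1r.
Qed.

Lemma siDr u v w : D u -> D v -> D w -> b w (u + v) = b w u + b w v.
Proof.
by move=> Du Dv Dw; rewrite !(@siC w)// ?siDl//; exact: si_memD.
Qed.

Lemma siZr a u w : D u -> D w -> b w (a *: u) = a * b w u.
Proof.
by move=> Du Dw; rewrite !(@siC w)// ?siZl//; exact: si_memZ.
Qed.

Lemma siBr u v w : D u -> D v -> D w -> b w (u - v) = b w u - b w v.
Proof.
by move=> Du Dv Dw; rewrite !(@siC w)// ?siBl//; exact: si_memB.
Qed.

Lemma si_ge0 u : D u -> 0 <= b u u. Proof. by case: Db => _ _ _; apply. Qed.

Lemma sqr_inorm u : D u -> inorm b u ^+ 2 = b u u.
Proof. by move=> Du; rewrite sqr_sqrtr// si_ge0. Qed.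

Lemma inorm_ge0 u : 0 <= inorm b u. Proof. exact: sqrtr_ge0. Qed.

Lemma si_sqrD u v : D u -> D v -> b (u + v) (u + v) = b u u + 2 * b u v + b v v.
Proof.
move=> Du Dv; rewrite siDl//; last exact: si_memD.
by rewrite !siDr// (siC Dv Du); ring.
Qed.

Lemma si_sqrB u v : D u -> D v -> b (u - v) (u - v) = b u u - 2 * b u v + b v v.
Proof.
move=> Du Dv; rewrite siBl//; last exact: si_memB.
by rewrite !siBr// (siC Dv Du); ring.
Qed.

Lemma parallelogram u v : D u -> D v ->
  b (u - v) (u - v) = 2 * b u u + 2 * b v v - b (u + v) (u + v).
Proof. by move=> Du Dv; rewrite si_sqrB// si_sqrD//; ring. Qed.

Lemma si_sqrZ a u : D u -> b (a *: u) (a *: u) = a ^+ 2 * b u u.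
Proof.
by move=> Du; rewrite siZl// ?siZr// ?mulrA -?expr2//; exact: si_memZ.
Qed.

Lemma cauchy_schwarz_sqr u v : D u -> D v -> b u v ^+ 2 <= b u u * b v v.
Proof.
move=> Du Dv.
have h (t : R) : 0 <= b u u - 2 * (t * b u v) + t ^+ 2 * b v v.
  have := si_ge0 (si_memB Du (si_memZ t Dv)).
  by rewrite si_sqrB ?si_sqrZ ?siZr//; exact: si_memZ.
have u0 := si_ge0 Du; have := si_ge0 Dv; rewrite le_eqVlt => /orP[/eqP v0|v0].
  have [->|uv0] := eqVneq (b u v) 0; first by rewrite expr0n -v0 mulr0.
  (* The form may be degenerate. If [b v v = 0], the expression in [h] is affine in [t], and this
     [t] would give it the value -1. *)
  have := h ((b u u + 1) / (2 * b u v)); rewrite -v0.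
  have -> : 2 * ((b u u + 1) / (2 * b u v) * b u v) = b u u + 1 by field.
  lra.
have := h (b u v / b v v); rewrite -(ler_pM2r v0) mul0r.
suff -> : (b u u - 2 * (b u v / b v v * b u v) + (b u v / b v v) ^+ 2 * b v v)
   * b v v = b u u * b v v - b u v ^+ 2 by lra.
by field; rewrite gt_eqF.
Qed.

Lemma cauchy_schwarz u v : D u -> D v -> `|b u v| <= inorm b u * inorm b v.
Proof.
move=> Du Dv; rewrite -(@ler_pXn2r _ 2)// ?nnegrE ?mulr_ge0 ?inorm_ge0//.
by rewrite exprMn !sqr_inorm// real_normK ?num_real// cauchy_schwarz_sqr.
Qed.

Lemma inorm_seminormed (E : set V) : E `<=` D -> subspace E ->
  seminormed E (inorm b).
Proof.
move=> ED [E0 El]; split=> // [u v /ED Du /ED Dv|a u /ED Du].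
  rewrite -(@ler_pXn2r _ 2)// ?nnegrE ?addr_ge0 ?inorm_ge0//.
  rewrite sqrrD !sqr_inorm// ?si_sqrD//; last exact: si_memD.
  have := le_trans (ler_norm _) (cauchy_schwarz Du Dv); lra.
by rewrite /inorm si_sqrZ// sqrtrM ?sqr_ge0// sqrtr_sqr.
Qed.

Lemma dot_null u v : D u -> D v -> inorm b u = 0 -> b u v = 0.
Proof.
move=> Du Dv u0; have := cauchy_schwarz Du Dv.
by rewrite u0 mul0r normr_le0 => /eqP.
Qed.

Lemma inorm_eq0 u : D u -> (inorm b u == 0) = (b u u == 0).
Proof. by move=> Du; rewrite -sqr_inorm// expf_eq0. Qed.

Definition perp (N : set V) : set V := [set u | D u /\ forall w, N w -> b u w = 0].

Lemma perp_subspace N : N `<=` D -> subspace (perp N).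
Proof.
move=> ND; split=> [|a u v [Du up] [Dv vp]]; split.
- by case: Db => -[].
- by move=> w /ND; exact: si0l.
- exact: si_lin.
- move=> w Nw; case: Db => _ _ + _ => ->//; last exact: ND.
  by rewrite up// vp// mulr0 addr0.
Qed.

Lemma perp_complete N : N `<=` D -> complete_seminormed D (inorm b) ->
  complete_seminormed (perp N) (inorm b).
Proof.
move=> ND Dc u uN uC.
have Du k : D (u k) by case: (uN k).
have [v Dv vl] := Dc _ Du uC; exists v => //; split=> // w Nw.
have Dw := ND _ Nw.
apply/eqP; rewrite -normr_le0; apply: (@ler_addeps _ _ _ (inorm b w)) => e e0.
rewrite add0r; have [M /(_ M (leqnn _)) Me] := vl e e0.
have -> : b v w = - b (u M - v) w.
  by rewrite siBl//; case: (uN M) => _ ->//; rewrite sub0r opprK.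
rewrite normrN; apply: (le_trans (cauchy_schwarz (si_memB (Du M) Dv) Dw)).
by rewrite mulrC ler_wpM2l// inorm_ge0.
Qed.

(** The nearest point of [E] is obtained by the parallelogram identity. *)
Lemma projection_ex (E : set V) u : E `<=` D -> subspace E ->
  complete_seminormed E (inorm b) -> D u ->
  exists2 v, E v & forall w, E w -> b (u - v) w = 0.
Proof.
move=> ED Esub Ec Du; have [E0 El] := Esub.
have Dn : seminormed D (inorm b).
  by apply: inorm_seminormed => //; case: Db.
pose A := [set inorm b (u - v) | v in E].
have A_inf : has_inf A.
  split; first by exists (inorm b (u - 0)); exists 0.
  by exists 0 => _ [v _ <-]; exact: inorm_ge0.
pose d := inf A.
have dle v : E v -> d <= inorm b (u - v).
  by move=> Ev; apply: ge_inf; [case: A_inf|exists v].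
have d0 : 0 <= d by apply: lb_le_inf; [case: A_inf|move=> _ [v _ <-]; exact: inorm_ge0].
have inv0 k : 0 < k.+1%:R^-1 :> R by rewrite invr_gt0.
have near k : exists2 v, E v & inorm b (u - v) < d + k.+1%:R^-1.
  have [_ [v Ev <-] lt] := inf_adherent (inv0 k) A_inf; by exists v.
pose v k := sval (cid2 (near k)).
have Ev k : E (v k) by rewrite /v; case: cid2.
have Dv k : D (v k) by exact: ED.
have vlt k : inorm b (u - v k) < d + k.+1%:R^-1 by rewrite /v; case: cid2.
have [||w Ew wl] := Ec v; first exact: Ev.
  move=> e e0.
  (* The parallelogram identity bounds the squared distance of two terms by
     [4 (d + x)^2 - 4 d^2 = 8 d x + 4 x^2], which is at most [(8 d + 4) x] for [x <= 1]. *)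
  pose c := 8 * d + 4; have c0 : 0 < c by rewrite ltr_wpDl// mulr_ge0.
  pose M := Num.bound (c / e ^+ 2).
  have Me : M.+1%:R^-1 * c <= e ^+ 2.
    rewrite mulrC ler_pdivrMr ?ltr0Sn// -ler_pdivrMl ?exprn_gt0// mulrC.
    have := archi_boundP (ltW (divr_gt0 c0 (exprn_gt0 2 e0))).
    by rewrite -natr1 -/M; lra.
  exists M => i j Mi Mj.
  have inv k : (M <= k)%N -> k.+1%:R^-1 <= M.+1%:R^-1 :> R.
    by move=> Mk; rewrite lef_pV2 ?posrE ?ltr0Sn// ler_nat.
  set x := M.+1%:R^-1 in inv Me.
  have x0 : 0 < x by exact: inv0.
  have x1 : x <= 1 by rewrite /x invf_le1// ler1n.
  have sq k : (M <= k)%N -> b (u - v k) (u - v k) <= (d + x) ^+ 2.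
    move=> Mk; rewrite -sqr_inorm; last exact: si_memB.
    rewrite ler_pXn2r ?nnegrE ?inorm_ge0 ?addr_ge0// ?(ltW x0)//.
    by apply: (le_trans (ltW (vlt k))); rewrite lerD2l; exact: inv.
  pose m := 2^-1 *: (v i + v j).
  have Em : E m.
    have E1 := El 1 _ _ (Ev i) (Ev j); rewrite scale1r in E1.
    by have := El 2^-1 _ _ E1 E0; rewrite addr0.
  have Dm := ED _ Em; have Du_m := si_memB Du Dm.
  have sm : d ^+ 2 <= b (u - m) (u - m).
    by rewrite -sqr_inorm// ler_pXn2r ?nnegrE ?inorm_ge0// dle.
  have Di := si_memB Du (Dv i); have Dj := si_memB Du (Dv j).
  have e1 : v i - v j = (u - v j) - (u - v i) by rewrite opprB [RHS]addrC subrKA.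
  have e2 : 2 *: (u - m) = (u - v j) + (u - v i).
    rewrite scalerBr scalerA divff ?pnatr_eq0// scale1r scaler_nat mulr2n.
    by rewrite opprD (addrC (- v i)) addrACA.
  have si := sq i Mi; have sj := sq j Mj.
  rewrite -(@ler_pXn2r _ 2) ?nnegrE ?inorm_ge0 ?(ltW e0)//.
  rewrite sqr_inorm; last exact: si_memB.
  apply: le_trans Me; rewrite e1 parallelogram// -e2 si_sqrZ//.
  have : x * x <= x by rewrite ler_piMr// ltW.
  rewrite /c; move: si sj sm; rewrite !expr2.
  move: (b (u - v i) _) (b (u - v j) _) (b (u - m) _) => p q r.
  lra.
have Dw := ED _ Ew; have Duw := si_memB Du Dw.
have wd : inorm b (u - w) <= d.
  apply: (@ler_addeps _ _ _ 2) => e e0; have [M Me] := wl e e0.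
  pose k := maxn M (Num.bound e^-1).
  have ke : k.+1%:R^-1 <= e.
    rewrite invf_ple ?posrE ?ltr0Sn//.
    apply: (le_trans (ltW (archi_boundP _))); first by rewrite invr_ge0 ltW.
    by rewrite ler_nat leqW// leq_maxr.
  apply: (le_trans (sn_tri Dn Du Dw (Dv k))).
  rewrite mulr2n mulrDl mul1r addrA; apply: lerD (Me k (leq_maxl _ _)).
  by apply: (le_trans (ltW (vlt k))); rewrite lerD2l.
exists w => // z Ez; have Dz := ED _ Ez.
set B := b (u - w) z; set c := b z z.
have c0 : 0 <= c by exact: si_ge0.
have h (t : R) : 0 <= - 2 * (t * B) + t ^+ 2 * c.
  have Ewz : E (t *: z + w) by exact: El.
  have := dle _ Ewz; rewrite -(@ler_pXn2r _ 2) ?nnegrE ?inorm_ge0//.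
  rewrite sqr_inorm; last by apply: si_memB => //; exact: ED.
  have -> : u - (t *: z + w) = (u - w) - t *: z by rewrite opprD addrA addrAC.
  rewrite si_sqrB ?si_sqrZ ?siZr//; last exact: si_memZ.
  have : b (u - w) (u - w) <= d ^+ 2.
    by rewrite -sqr_inorm// ler_pXn2r ?nnegrE ?inorm_ge0.
  by rewrite -/B -/c; lra.
(* The minimizing [t] would be [B / c]; with [c + 1] there is no division by 0, and the value is
   still negative unless [B = 0]. *)
have := h (B / (c + 1)); have c1 : 0 < c + 1 by rewrite ltr_wpDl.
have -> : - 2 * (B / (c + 1) * B) + (B / (c + 1)) ^+ 2 * c =
  - (B ^+ 2 * ((c + 2) / (c + 1) ^+ 2)) by field; rewrite gt_eqF.
rewrite oppr_ge0 pmulr_lle0; last by rewrite divr_gt0 ?exprn_gt0// ltr_wpDl.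
by rewrite le_eqVlt ltNge sqr_ge0 orbF expf_eq0 => /eqP.
Qed.

(** After projection onto the complete subspace [N], the remainder is in [perp N] and orthogonal to
    itself, hence null; stability of [N] under null changes absorbs it. *)
Lemma perp_perp (N : set V) u : N `<=` D -> subspace N ->
  complete_seminormed N (inorm b) ->
  (forall v w, N v -> D w -> inorm b (w - v) = 0 -> N w) ->
  D u -> (forall w, perp N w -> b u w = 0) -> N u.
Proof.
move=> ND Nsub Nc Nnull Du up.
have [v Nv vp] := projection_ex ND Nsub Nc Du.
have Dv := ND _ Nv; have Duv := si_memB Du Dv.
have puv : perp N (u - v) by split.
apply: (Nnull v) => //; apply/eqP; rewrite inorm_eq0//.
by rewrite siBl// up// (siC Dv Duv) vp// subrr.
Qed.

End SemiInnerProduct.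

(** * Tangent vectors and differentials in charts *)

Section FiniteLimits.
Context (R : realType) (T : Type) (F : set_system T) {FF : Filter F}.

Lemma cvg_sum (I : Type) (r : seq I) (P : pred I) (f : I -> T -> R) (a : I -> R) :
  (forall i, P i -> f i x @[x --> F] --> a i) ->
  \sum_(i <- r | P i) f i x @[x --> F] --> \sum_(i <- r | P i) a i.
Proof. by apply: cvg_big; exact: add_continuous. Qed.

Lemma cvg_prod (I : Type) (r : seq I) (P : pred I) (f : I -> T -> R) (a : I -> R) :
  (forall i, P i -> f i x @[x --> F] --> a i) ->
  \prod_(i <- r | P i) f i x @[x --> F] --> \prod_(i <- r | P i) a i.
Proof. by apply: cvg_big; exact: mul_continuous. Qed.

Lemma cvg_det n (A : T -> 'M[R]_n) (B : 'M[R]_n) :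
  (forall i j, A x i j @[x --> F] --> B i j) -> \det (A x) @[x --> F] --> \det B.
Proof.
move=> AB; apply: cvg_sum => s _; apply: cvgM; first exact: cvg_cst.
exact: cvg_prod.
Qed.

(** By Cramer's formula, which describes [invmx] only on invertible matrices; hence the hypothesis
    along [F]. *)
Lemma cvg_invmx n (A : T -> 'M[R]_n) (B : 'M[R]_n) i j :
  (\forall x \near F, A x \in unitmx) -> B \in unitmx ->
  (forall i j, A x i j @[x --> F] --> B i j) ->
  invmx (A x) i j @[x --> F] --> invmx B i j.
Proof.
move=> uA uB AB.
have inv_entry C : C \in unitmx -> invmx C i j = (\det C)^-1 * cofactor C j i.
  by move=> uC; rewrite /invmx uC !mxE.
rewrite inv_entry//.
apply: (@cvg_trans _ ((\det (A x))^-1 * cofactor (A x) j i @[x --> F])).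
  by apply: near_eq_cvg; apply: filterS uA => x /inv_entry ->.
apply: cvgM.
  by apply: cvgV; [rewrite -unitfE -unitmxE|exact: cvg_det].
apply: cvgM; first exact: cvg_cst.
apply: cvg_det => k l; rewrite !mxE.
by under eq_cvg do rewrite !mxE; exact: AB.
Qed.

End FiniteLimits.

Section C1Differentiable.
Context (R : realType).

Lemma is_derive_line (V W : normedModType R) (f : V -> W) (y v : V) (t : R) :
  derivable f (y + t *: v) v ->
  is_derive t (1 : R) (fun s => f (y + s *: v)) ('D_v f (y + t *: v)).
Proof.
move=> df.
have E : (fun h => h^-1 *: (((fun s => f (y + s *: v)) \o shift t) (h *: 1)
      - f (y + t *: v))) =
    (fun h => h^-1 *: ((f \o shift (y + t *: v)) (h *: v) - f (y + t *: v))).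
  apply/funext => h; congr (_ *: (f _ - _)) => /=.
  by rewrite [h *: 1]mulr1 scalerDl [RHS]addrC -addrA [X in _ + X]addrC.
split; first by rewrite /derivable E.
by rewrite /derive E.
Qed.

Lemma MVT_error (g g' : R -> R) (a c e : R) :
  (forall t, `|t| <= `|a| -> is_derive t (1 : R) g (g' t) /\ `|g' t - c| <= e) ->
  `|g a - g 0 - a * c| <= e * `|a|.
Proof.
move=> h.
have cont (I : set R) : (forall t, I t -> `|t| <= `|a|) -> {within I, continuous g}.
  move=> It; apply: continuous_in_subspaceT => t /[!inE] /It /h[[gt _] _].
  exact/differentiable_continuous/derivable1_diffP.
have fin s : `|s| <= `|a| -> g a - g 0 = g' s * a -> `|g a - g 0 - a * c| <= e * `|a|.
  move=> sa ->; rewrite (mulrC a) -mulrBl normrM ler_wpM2r//.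
  by case: (h s sa).
have [a0|a0] := leP 0 a.
  have sub t : t \in `[0, a] -> `|t| <= `|a|.
    by rewrite in_itv/= => /andP[t0 ta]; rewrite !ger0_norm.
  have [|t|s /sub sa] := @MVT_segment _ g g' 0 a a0.
  - move=> t /subset_itv_oo_cc /sub ta; by case: (h t ta).
  - by apply: cont => // t; exact: sub.
  by rewrite subr0; exact: fin.
have sub t : t \in `[a, 0] -> `|t| <= `|a|.
  by rewrite in_itv/= => /andP[t0 ta]; rewrite !ler0_norm ?lerN2// ltW.
have [|t|s /sub sa] := @MVT_segment _ g g' a 0 (ltW a0).
- move=> t /subset_itv_oo_cc /sub ta; by case: (h t ta).
- by apply: cont => // t; exact: sub.
rewrite sub0r => eqs; apply: (fin s sa).
by rewrite -opprB eqs mulrN opprK.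
Qed.

Definition lform (d : nat) (a : 'I_d -> R) (h : 'rV[R]_d) : R :=
  \sum_k h ord0 k * a k.

Lemma lform_is_linear d (a : 'I_d -> R) : linear (lform a).
Proof.
move=> c u v; rewrite /lform scaler_sumr -big_split; apply: eq_bigr => k _ /=.
by rewrite !mxE mulrDl [_ *: _]mulrA.
Qed.
HB.instance Definition _ d (a : 'I_d -> R) :=
  GRing.isLinear.Build R 'rV[R]_d R _ (lform a) (@lform_is_linear d a).

Lemma lform_continuous d (a : 'I_d -> R) : continuous (lform a).
Proof.
move=> h; apply: (@cvg_sum _ _ (nbhs h) (nbhs_filter h)) => k _; apply: cvgMr_tmp.
exact: coord_continuous.
Qed.

Lemma norm_coord_le d (h : 'rV[R]_d) k : `|h ord0 k| <= `|h|.
Proof. by rewrite [leRHS]mx_normrE; exact: (le_bigmax _ (fun i => `|h i.1 i.2|) (ord0, k)). Qed.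

(** The increment is split along the coordinate axes. *)
Lemma C1_diff d (U : set 'rV[R]_d) (f : 'rV[R]_d -> R) x :
  open U -> Ck_on 1 U f -> U x ->
  differentiable f x /\ 'd f x = lform (fun k => partial k f x) :> ('rV[R]_d -> R).
Proof.
move=> oU [_ Cf] Ux; pose df := lform (fun k => partial k f x).
have dfc : continuous df by exact: lform_continuous.
suff main e : 0 < e ->
    \forall h \near (0 : 'rV[R]_d), `|f (h + x) - f x - df h| <= e * `|h|.
  have e : 'd f x = df :> ('rV[R]_d -> R).
    apply: diff_unique => //; apply/eqaddoP => e /main; apply: filterS => h.
    by rewrite /= opprD addrA.
  split=> //; apply/diff_locallyP; rewrite e; split=> //.
  by apply/eqaddoP => r /main; apply: filterS => h; rewrite /= opprD addrA.
move=> e0.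
(* Each of the [d] coordinate increments may contribute [e' * |h|]; [d.+1] avoids a division by
   0. *)
pose e' := e / d.+1%:R.
have e'0 : 0 < e' by rewrite divr_gt0.
have : \forall y \near x, U y /\ forall k, `|partial k f x - partial k f y| <= e'.
  have Un : \forall y \near x, U y by exact: open_nbhs_nbhs.
  have Pn : \forall y \near x, forall k, `|partial k f x - partial k f y| <= e'.
    apply: (@filter_forall _ _ (fun k y => `|partial k f x - partial k f y| <= e')
      _ (nbhs_filter x)) => k; have [_ [/(_ _ Ux) + _]] := Cf k.
    by move/cvgrPdist_le; exact.
  exact: filterI Un Pn.
move=> /nbhs_ballP[r /= r0 Br].
near=> h.
have hr : `|h| < r.
  by near: h; apply/nbhs_ballP; exists r => //= z; rewrite -ball_normE/= sub0r normrN.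
(* [hh k] keeps the first [k] coordinates of [h]. Consecutive points differ along one axis, and in
   the sup norm the intermediate points stay in the ball. *)
pose hh (k : nat) : 'rV[R]_d := \row_j (if (j < k)%N then h ord0 j else 0).
have hh0 : hh 0 = 0 by apply/rowP => j; rewrite !mxE.
have hhd : hh d = h by apply/rowP => j; rewrite !mxE ltn_ord.
have hhS (k : 'I_d) : hh k.+1 = hh k + h ord0 k *: delta_mx ord0 k.
  apply/rowP => j; rewrite !mxE eqxx/= ltnS leq_eqVlt.
  have [->|jk] := eqVneq j k; first by rewrite eqxx/= ltnn add0r mulr1.
  by rewrite (negbTE (jk : (j != k :> nat))) /= mulr0 addr0.
have hhb (k : 'I_d) t : `|t| <= `|h ord0 k| -> ball x r (hh k + x + t *: delta_mx ord0 k).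
  move=> th; rewrite -ball_normE /= addrAC opprD addrCA subrr addr0 normrN.
  apply: le_lt_trans hr.
  rewrite [leLHS]mx_normrE; apply: bigmax_le => // -[i j] _ /=.
  rewrite !mxE (ord1 i) eqxx/=.
  have [->|jk] := eqVneq j k.
    by rewrite ltnn add0r mulr1 (le_trans th)// norm_coord_le.
  rewrite mulr0 addr0; case: ifP => _; last by rewrite normr0.
  exact: norm_coord_le.
have tele : f (h + x) - f x = \sum_(k < d) (f (hh k.+1 + x) - f (hh k + x)).
  rewrite -[h in LHS]hhd -[x in X in _ - X]add0r -hh0.
  by rewrite -(big_mkord xpredT (fun k => f (hh k.+1 + x) - f (hh k + x))) telescope_sumr.
rewrite tele -sumrB; apply: (le_trans (ler_norm_sum _ _ _)).
have bd (k : 'I_d) : `|f (hh k.+1 + x) - f (hh k + x) - h ord0 k * partial k f x| <= e' * `|h|.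
  apply: (@le_trans _ _ (e' * `|h ord0 k|)); last by rewrite ler_wpM2l ?norm_coord_le// ltW.
  pose g t := f (hh k + x + t *: delta_mx ord0 k).
  have := @MVT_error g (fun t : R => partial k f (hh k + x + t *: delta_mx ord0 k))
    (h ord0 k) (partial k f x) e'.
  have -> : g 0 = f (hh k + x) by rewrite /g scale0r addr0.
  have -> : g (h ord0 k) = f (hh k.+1 + x) by rewrite /g hhS addrAC.
  apply=> t /hhb /Br[Ut pt]; split.
    by apply: is_derive_line; case: (Cf k) => + _; exact.
  by rewrite distrC.
apply: (@le_trans _ _ (\sum_(k < d) e' * `|h|)); first by apply: ler_sum => k _; exact: bd.
rewrite sumr_const card_ord -mulr_natr mulrAC ler_wpM2r//.
rewrite /e' mulrAC ler_pdivrMr// ler_wpM2l ?(ltW e0)//.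
by rewrite ler_nat.
Unshelve. all: by end_near. Qed.

Lemma C1_differentiable d (U : set 'rV[R]_d) (f : 'rV[R]_d -> R) x :
  open U -> Ck_on 1 U f -> U x -> differentiable f x.
Proof. by move=> oU Cf Ux; case: (C1_diff oU Cf Ux). Qed.

Lemma differentiable_rV (V : normedModType R) d (f : V -> 'rV[R]_d) x :
  (forall k, differentiable (fun y => f y ord0 k) x) -> differentiable f x.
Proof.
move=> h.
rewrite (_ : f = \sum_(k < d) (fun y => f y ord0 k *: delta_mx ord0 k)).
  by apply: differentiable_sum => k; exact: differentiableZl.
apply/funext => y; rewrite fct_sumE; apply/rowP => j.
rewrite summxE (bigD1 j)//= !mxE !eqxx mulr1 big1 ?addr0// => k kj.
by rewrite !mxE [j == k]eq_sym (negbTE kj) andbF mulr0.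
Qed.

End C1Differentiable.

(** * Positive definite matrices *)

Section BilinearForm.
Context (R : realType) (d : nat).
Implicit Types (G : 'M[R]_d) (v w : 'rV[R]_d).

Definition gform G v w : R := (v *m G *m w^T) ord0 ord0.

Definition posdef G : Prop :=
  G^T = G /\ forall v, v != 0 -> 0 < gform G v v.

Lemma gform_semi_inner G : posdef G -> semi_inner [set: 'rV[R]_d] (gform G).
Proof.
move=> [Gs Gp]; split=> // [u v _ _|a u v w _ _ _|u _].
- by rewrite /gform -[in LHS](trmxK (u *m G *m v^T)) mxE !trmx_mul trmxK Gs mulmxA.
- by rewrite /gform mulmxDl mulmxDl -!scalemxAl !mxE.
- have [->|/Gp/ltW//] := eqVneq u 0.
  by rewrite /gform !mul0mx mxE.
Qed.

Lemma posdef_unit G : posdef G -> G \in unitmx.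
Proof.
move=> [_ Gp]; rewrite -row_free_unit -kermx_eq0; apply/negPn/negP => k0.
have /rowV0Pn[v /sub_kermxP vG v0] := k0.
by have := Gp v v0; rewrite /gform vG mul0mx mxE ltxx.
Qed.

Lemma gformE G v w :
  gform G v w = \sum_j \sum_i v ord0 i * G i j * w ord0 j.
Proof.
rewrite /gform mxE; apply: eq_bigr => j _; rewrite !mxE mulr_suml.
by apply: eq_bigr.
Qed.

(** Cauchy-Schwarz for [G] against the vector [b] that represents the linear form [a];
    [gform (invmx G)] is the squared dual norm. *)
Lemma dual_bound G (a : 'I_d -> R) w : posdef G ->
  lform a w ^+ 2 <= gform G w w * gform (invmx G) (\row_k a k) (\row_k a k).
Proof.
move=> Gp; set A := \row_k a k; pose b := A *m invmx G.
have Gu := posdef_unit Gp; have Gi := gform_semi_inner Gp.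
have Gt : (invmx G)^T = invmx G by rewrite trmx_inv; case: Gp => ->.
have -> : lform a w = gform G w b.
  rewrite /gform /b trmx_mul Gt mulmxA -(mulmxA w) mulmxV// mulmx1.
  by rewrite !mxE; apply: eq_bigr => k _; rewrite !mxE.
have -> : gform (invmx G) A A = gform G b b.
  by rewrite /gform /b trmx_mul Gt !mulmxA mulmxKV.
exact: (cauchy_schwarz_sqr Gi).
Qed.

Lemma gform_coord_bound G w k : posdef G ->
  w ord0 k ^+ 2 <= gform G w w * invmx G k k.
Proof.
move=> Gp; have := dual_bound (fun l => (l == k)%:R) w Gp.
rewrite /lform (bigD1 k)//= eqxx mulr1 big1 ?addr0; last first.
  by move=> l /negbTE ->; rewrite mulr0.
move=> /le_trans; apply; rewrite le_eqVlt; apply/orP; left; apply/eqP.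
congr (_ * _); rewrite gformE (bigD1 k)//= (bigD1 k)//= !mxE eqxx mul1r mulr1.
rewrite !big1 ?addr0// => l lk; rewrite ?big1// => *; rewrite !mxE (negbTE lk) ?mulr0//.
by rewrite !mul0r.
Qed.

End BilinearForm.

(** * Metric and differentials in a fixed chart *)

Section Pointwise.
Context (R : realType) (d : nat) (N : riemannianManifold R d).
Implicit Types (x : N) (v w : 'rV[R]_d) (i : mindex N).

Definition gmat i x : 'M[R]_d := mmetric i (mchart i x).

Lemma gmat_posdef i x : mdom i x -> posdef (gmat i x).
Proof.
move=> ix; have cx : (mchart i @` mdom i) (mchart i x) by exists x.
by split; [exact: mmetric_sym|move=> v; exact: mmetric_pos].
Qed.

Lemma tdot_semi_inner x : semi_inner [set: 'rV[R]_d] (@tdot _ _ N x).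
Proof. exact: (gform_semi_inner (gmat_posdef (mdom_center x))). Qed.

Lemma tdot_eq0 x v : tdot x v v = 0 -> v = 0.
Proof.
have [_ Gp] := gmat_posdef (mdom_center x).
by move=> v0; apply/eqP/negPn/negP => /Gp; rewrite [X in 0 < X]v0 ltxx.
Qed.

Lemma tcoord_lin i x a v w :
  tcoord i x (a *: v + w) = a *: tcoord i x v + tcoord i x w.
Proof. by rewrite /tcoord mulmxDl scalemxAl. Qed.

Lemma tcoord0 i x : tcoord i x 0 = 0.
Proof. by rewrite /tcoord mul0mx. Qed.

Lemma tdot_chart i x v w : mdom i x ->
  tdot x v w = gform (gmat i x) (tcoord i x v) (tcoord i x w).
Proof.
move=> ix; rewrite /tdot (mmetric_compat (mdom_center x) ix).
by rewrite /gform /tcoord trmx_mul !mulmxA.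
Qed.

Lemma tcoord_eq0 i x v : mdom i x -> tcoord i x v = 0 -> v = 0.
Proof.
move=> ix v0; apply: (@tdot_eq0 x); rewrite (tdot_chart _ _ ix) v0.
by rewrite /gform !mul0mx mxE.
Qed.

Lemma coord_bound (x : N) v k :
  v ord0 k ^+ 2 <= tdot x v v * invmx (gmat (mcenter x) x) k k.
Proof. exact: (gform_coord_bound _ _ (gmat_posdef (mdom_center x))). Qed.

Lemma gmat_continuous i x a b : mdom i x ->
  {for x, continuous (fun y => gmat i y a b)}.
Proof.
move=> ix; apply: (@continuous_comp _ _ _ (mchart i) (fun y => mmetric i y a b)).
  exact: mchart_continuous.
by case: (mmetric_smooth i a b 0) => + _; apply; exists x.
Qed.

Lemma invgmat_continuous i x a b : mdom i x ->
  {for x, continuous (fun y => invmx (gmat i y) a b)}.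
Proof.
move=> ix; apply: cvg_invmx => [||k l]; last exact: gmat_continuous.
  have : \forall y \near x, mdom i y.
    by apply: open_nbhs_nbhs; split => //; exact: mdom_open.
  by apply: filterS => y iy; exact/posdef_unit/gmat_posdef.
exact/posdef_unit/gmat_posdef.
Qed.

Lemma mchart_overlap_open i j : open (mchart i @` (mdom i `&` mdom j)).
Proof.
have oc := @mcod_open _ _ N i.
rewrite openE => _ [x [ix jx] <-].
have cx : (mchart i @` mdom i) (mchart i x) by exists x.
have n1 : \forall y \near mchart i x, (mchart i @` mdom i) y.
  by apply: open_nbhs_nbhs.
have n2 : \forall y \near mchart i x, mdom j (mchartV i y).
  apply: (mchartV_continuous cx); rewrite /= (mchartK ix).
  by apply: open_nbhs_nbhs; split=> //; exact: mdom_open.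
near=> y.
have [z iz zy] : (mchart i @` mdom i) y by near: y.
exists z => //; split=> //; rewrite -(mchartK iz) zy; by near: y.
Unshelve. all: by end_near. Qed.

Lemma transition_differentiable i j x : mdom i x -> mdom j x ->
  differentiable (fun y => mchart j (mchartV i y)) (mchart i x).
Proof.
move=> ix jx; apply: differentiable_rV => k.
apply: (C1_differentiable (mchart_overlap_open (i:=i) (j:=j)) (@mtransition_smooth _ _ N i j k 1)).
by exists x.
Qed.

(** The chart [mcenter x] may jump with [x]. The chain rule through the transition map, whose
    Jacobian enters [tcoord], expresses the differential in a fixed chart, where its coefficients
    depend continuously on [x]: this gives measurability and local bounds. *)
Lemma dfun_chart (f : N -> R) i x v : smooth_fun f -> mdom i x ->
  dfun f x v = lform (fun k => partial k (f \o mchartV i) (mchart i x)) (tcoord i x v).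
Proof.
move=> sf ix; set c := mcenter x; set y := mchart c x.
have cx : mdom c x by exact: mdom_center.
have ci : (mchart i @` mdom i) (mchart i x) by exists x.
pose psi z := mchart i (mchartV c z).
have psi_y : psi y = mchart i x by rewrite /psi /y mchartK.
have [df dfE] := C1_diff (@mcod_open _ _ N i) (sf i 1%N) ci.
have dpsi : differentiable psi y by exact: transition_differentiable.
have E : {near y, f \o mchartV c =1 (f \o mchartV i) \o psi}.
  near=> z; rewrite /= /psi mchartK//; near: z.
  have cy : (mchart c @` mdom c) y by exists x.
  apply: (mchartV_continuous cy); rewrite /= (mchartK cx).
  by apply: open_nbhs_nbhs; split=> //; exact: mdom_open.
rewrite /dfun (near_eq_derive _ E) deriveE; last first.
  by apply: differentiable_comp => //; rewrite psi_y.
rewrite diff_comp//= ?psi_y// dfE; congr (lform _ _).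
by rewrite /tcoord -/c -/y /jacobian mul_rV_lin1.
Unshelve. all: by end_near. Qed.

Lemma dfun_lin (f : N -> R) x a v w : smooth_fun f ->
  dfun f x (a *: v + w) = a * dfun f x v + dfun f x w.
Proof.
move=> sf; rewrite !(dfun_chart _ sf (mdom_center x)) tcoord_lin.
by rewrite linearD linearZ.
Qed.

Lemma partial_continuous (f : N -> R) i k x : smooth_fun f -> mdom i x ->
  {for x, continuous (fun y => partial k (f \o mchartV i) (mchart i y))}.
Proof.
move=> sf ix.
apply: (@continuous_comp _ _ _ (mchart i) (partial k (f \o mchartV i))).
  exact: mchart_continuous.
have [_ /(_ k)[_ [+ _]]] := sf i 1%N; by apply; exists x.
Qed.

(** Near a point the squared dual norm of the differential is continuous in a fixed chart, hence
    bounded; compactness makes the bound global. It yields integrability of [dfun f] along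
    square-integrable fields. *)
Lemma dfun_bound (f : N -> R) : compact [set: N] -> smooth_fun f ->
  exists2 M, 0 <= M & forall x v, dfun f x v ^+ 2 <= M * tdot x v v.
Proof.
move=> cN sf.
have loc x : exists M, 0 <= M /\ \forall y \near x, forall v,
    dfun f y v ^+ 2 <= M * tdot y v v.
  set i := mcenter x; have ix : mdom i x by exact: mdom_center.
  pose a y k := partial k (f \o mchartV i) (mchart i y).
  pose q y := gform (invmx (gmat i y)) (\row_k a y k) (\row_k a y k).
  have cq : q y @[y --> x] --> q x.
    rewrite /q; under eq_cvg do rewrite gformE; rewrite gformE.
    apply: cvg_sum => l _; apply: cvg_sum => k _.
    under eq_cvg do rewrite !mxE; rewrite !mxE.
    apply: cvgM; last exact: partial_continuous.
    by apply: cvgM; [exact: partial_continuous|exact: invgmat_continuous].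
  have bd y v : mdom i y -> dfun f y v ^+ 2 <= q y * tdot y v v.
    move=> iy; rewrite (dfun_chart _ sf iy) (tdot_chart _ _ iy) mulrC.
    exact: dual_bound (gmat_posdef iy).
  exists (`|q x| + 1); split; first by rewrite addr_ge0.
  near=> y => v.
  have iy : mdom i y.
    by near: y; apply: open_nbhs_nbhs; split => //; exact: mdom_open.
  apply: (le_trans (bd y v iy)); apply: ler_wpM2r.
    by apply: (si_ge0 (tdot_semi_inner y)).
  have : `|q x - q y| <= 1.
    by near: y; move/cvgrPdist_le : cq; apply.
  rewrite ler_norml => /andP[h _]; have := ler_norm (q x); lra.
pose M x := sval (cid (loc x)).
have M0 x : 0 <= M x by rewrite /M; case: cid => ? [].
have Mn x : \forall y \near x, forall v, dfun f y v ^+ 2 <= M x * tdot y v v.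
  by rewrite /M; case: cid => ? [].
pose U x : set N := [set y | forall v, dfun f y v ^+ 2 <= M x * tdot y v v]^°.
move: cN; rewrite compact_cover => /(_ N [set: N] U).
case=> [x _|x _|D _ DU]; first exact: open_interior.
  by exists x => //; exact: Mn.
exists (\sum_(x <- D) M x); first by apply: sumr_ge0.
move=> x v; have [y /= yD xy] := DU x I.
have /(_ v) := interior_subset xy => /le_trans; apply; apply: ler_wpM2r.
  by apply: (si_ge0 (tdot_semi_inner x)).
by rewrite (big_rem y)//= lerDl sumr_ge0.
Unshelve. all: by end_near. Qed.

End Pointwise.

(** * Square-integrable vector fields *)

Section AlmostEverywhere.
Context d (T : measurableType d) (R : realType) (P : probability T R).

Lemma ae_imp (A B : T -> Prop) : (forall x, A x -> B x) ->
  {ae P, forall x, A x} -> {ae P, forall x, B x}.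
Proof. by move=> AB; apply: filterS => x /AB. Qed.

Lemma ae_imp2 (A B C : T -> Prop) : (forall x, A x -> B x -> C x) ->
  {ae P, forall x, A x} -> {ae P, forall x, B x} -> {ae P, forall x, C x}.
Proof. by move=> ABC; apply: filterS2 => x Ax; exact: ABC. Qed.

End AlmostEverywhere.

Section VectorFields.
Context (R : realType) (d : nat) (N : riemannianManifold R d).
Hypothesis cN : compact [set: N].
Implicit Types (V W : vfield N) (f : N -> R).

Lemma borel_open (U : set N) : open U -> measurable (U : set (borel N)).
Proof. exact: sub_sigma_algebra. Qed.

Lemma mdom_measurable (i : mindex N) : measurable (mdom i : set (borel N)).
Proof. by apply: borel_open; exact: mdom_open. Qed.

Lemma finite_atlas : exists D : {fset N}, forall x, exists2 y, y \in D &
  mdom (mcenter y) x.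
Proof.
have := cN; rewrite compact_cover => /(_ N setT (fun y => mdom (mcenter y))).
case=> [y _|x _|D _ DU]; first exact: mdom_open.
  by exists x => //; exact: mdom_center.
by exists D => x; have [y yD xy] := DU x I; exists y.
Qed.

Lemma measurable_continuous_dom (i : mindex N) f :
  (forall x, mdom i x -> {for x, continuous f}) ->
  measurable_fun (mdom i : set (borel N)) (f : borel N -> R).
Proof.
move=> fc; apply: (measurability _ (RGenOpens.measurableE R)).
move=> _ [_ [a [b ->] <-]]; apply: borel_open; rewrite openE => x [ix fx].
apply: (@filterI _ (nbhs x)).
  by apply: open_nbhs_nbhs; split => //; exact: mdom_open.
by apply: (fc x ix); apply: open_nbhs_nbhs; split=> //; exact: interval_open.
Qed.

(** The atlas may be uncountable; by compactness finitely many chart domains suffice. *)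
Lemma measurable_charts d' (Y : sigmaRingType d') (f : borel N -> Y) :
  (forall i, measurable_fun (mdom i : set (borel N)) f) ->
  measurable_fun setT f.
Proof.
move=> fi _ B mB; rewrite setTI; have [D DU] := finite_atlas.
rewrite (_ : f @^-1` B = \bigcup_(y in [set` D]) (mdom (mcenter y) `&` f @^-1` B)).
  apply: fin_bigcup_measurable; first exact: finite_fset.
  by move=> y _; apply: fi => //; exact: mdom_measurable.
apply/seteqP; split=> [x fx|x [y _ []]//].
by have [y yD xy] := DU x; exists y.
Qed.

Lemma tdot_measurable V W : measurable_field V -> measurable_field W ->
  measurable_fun [set: borel N] (fun x : borel N => tdot x (V x) (W x)).
Proof.
move=> mV mW; apply: measurable_charts => i.
apply: (@eq_measurable_fun _ _ _ _ _
  (fun x : borel N => gform (gmat i x) (tcoord i x (V x)) (tcoord i x (W x)))).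
  by move=> x; rewrite inE => ix; rewrite -tdot_chart.
under eq_fun do rewrite gformE.
apply: measurable_sum => j; apply: measurable_sum => k.
apply: measurable_funM; last exact: mW.
apply: measurable_funM; first exact: mV.
by apply: measurable_continuous_dom => x; exact: gmat_continuous.
Qed.

Lemma dfun_measurable f V : smooth_fun f -> measurable_field V ->
  measurable_fun [set: borel N] (fun x : borel N => dfun f x (V x)).
Proof.
move=> sf mV; apply: measurable_charts => i.
apply: (@eq_measurable_fun _ _ _ _ _ (fun x : borel N => lform
    (fun k => partial k (f \o mchartV i) (mchart i x)) (tcoord i x (V x)))).
  by move=> x; rewrite inE => ix; rewrite -dfun_chart.
apply: measurable_sum => k; apply: measurable_funM; first exact: mV.
by apply: measurable_continuous_dom => x; exact: partial_continuous.
Qed.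

Lemma measurable_field0 : measurable_field (0 : vfield N).
Proof.
move=> i k; rewrite [X in measurable_fun _ X](_ : _ = cst 0).
  exact: measurable_cst.
apply/funext => x; transitivity ((0 : 'rV[R]_d) ord0 k); last by rewrite mxE.
by congr (fun_of_matrix _ _ _); exact: tcoord0.
Qed.

Lemma tcoord_lin_coord i (x : N) a v w k :
  tcoord i x (a *: v + w) ord0 k = a * tcoord i x v ord0 k + tcoord i x w ord0 k.
Proof.
by rewrite tcoord_lin; move: (tcoord i x v) (tcoord i x w) => ? ?; rewrite !mxE.
Qed.

Lemma measurable_field_lin a V W : measurable_field V -> measurable_field W ->
  measurable_field (a *: V + W).
Proof.
move=> mV mW i k.
rewrite [X in measurable_fun _ X](_ : _ = (fun x : borel N =>
    a * tcoord i x (V x) ord0 k + tcoord i x (W x) ord0 k)); last first.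
  by apply/funext => x; exact: tcoord_lin_coord.
apply: measurable_funD; last exact: mW.
apply: measurable_funM; [exact: measurable_cst|exact: mV].
Qed.

Variable mu : probability (borel N) R.

Lemma tdot_ge0 (x : N) v : 0 <= tdot x v v.
Proof. by apply: (si_ge0 (tdot_semi_inner x)). Qed.

Lemma tdot_le (x : N) v w : `|tdot x v w| <= tdot x v v + tdot x w w.
Proof.
have h := tdot_semi_inner x.
have := tdot_ge0 x (v - w); have := tdot_ge0 x (v + w).
rewrite (si_sqrB h)// (si_sqrD h)//.
have := tdot_ge0 x v; have := tdot_ge0 x w.
by rewrite ler_norml; lra.
Qed.

Lemma tdot_sqr_le (x : N) a v w : tdot x (a *: v + w) (a *: v + w) <=
  2 * a ^+ 2 * tdot x v v + 2 * tdot x w w.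
Proof.
have h := tdot_semi_inner x; have := tdot_ge0 x (a *: v - w).
by rewrite (si_sqrB h)// (si_sqrD h)// !(si_sqrZ h)//; lra.
Qed.

Lemma L2_integrable_sqr V : L2 mu V ->
  mu.-integrable setT (EFin \o (fun x : borel N => tdot x (V x) (V x))).
Proof.
move=> [mV fin]; apply/integrableP; split.
  by apply/measurable_EFinP; exact: tdot_measurable.
apply: le_lt_trans fin; rewrite le_eqVlt; apply/orP; left; apply/eqP.
by apply: eq_integral => x _ /=; rewrite ger0_norm// tdot_ge0.
Qed.

Lemma L2_integrable V W : L2 mu V -> L2 mu W ->
  mu.-integrable setT (EFin \o (fun x : borel N => tdot x (V x) (W x))).
Proof.
move=> LV LW.
apply: (le_integrable measurableT (g := EFin \o (fun x : borel N =>
   tdot x (V x) (V x) + tdot x (W x) (W x)))).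
- by apply/measurable_EFinP; apply: tdot_measurable; [case: LV|case: LW].
- move=> x _ /=; rewrite lee_fin (le_trans (tdot_le _ _ _))//.
  by rewrite ler_norm.
- have := integrableD measurableT (L2_integrable_sqr LV) (L2_integrable_sqr LW).
  by [].
Qed.

Lemma L2_dot0 : L2 mu 0.
Proof.
split; first exact: measurable_field0.
rewrite integral0_eq// => x _; congr (_%:E).
by apply: (si0l (tdot_semi_inner x)).
Qed.

Lemma L2_lin a V W : L2 mu V -> L2 mu W -> L2 mu (a *: V + W).
Proof.
move=> LV LW.
have mF : measurable_field (a *: V + W).
  by apply: measurable_field_lin; [case: LV|case: LW].
split=> //.
have int : mu.-integrable setT (EFin \o (fun x : borel N =>
    2 * a ^+ 2 * tdot x (V x) (V x) + 2 * tdot x (W x) (W x))).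
  have h1 := integrableZl measurableT (2 * a ^+ 2) (L2_integrable_sqr LV).
  have h2 := integrableZl measurableT 2 (L2_integrable_sqr LW).
  exact: (integrableD measurableT h1 h2).
have [_] := integrableP _ _ _ int; apply: le_lt_trans.
apply: ge0_le_integral => //.
- by move=> x _; rewrite lee_fin tdot_ge0.
- by apply/measurable_EFinP; exact: tdot_measurable.
- by apply: measurableT_comp => //; case/integrableP: int.
- move=> x _ /=; rewrite lee_fin; apply: le_trans (ler_norm _).
  exact: tdot_sqr_le.
Qed.

Lemma L2dot_semi_inner : semi_inner (L2 mu) (L2dot mu).
Proof.
split.
- by split; [exact: L2_dot0|exact: L2_lin].
- move=> V W LV LW; apply: eq_Rintegral => x _.
  exact: (siC (tdot_semi_inner x)).
- move=> a V W Z LV LW LZ; rewrite /L2dot.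
  rewrite -RintegralZl//; last exact: L2_integrable.
  rewrite -RintegralD//; last 2 first.
  + exact: (integrableZl measurableT a (L2_integrable LV LZ)).
  + exact: L2_integrable.
  apply: eq_Rintegral => x _; case: (tdot_semi_inner x) => _ _ + _.
  exact.
- by move=> V _; apply: Rintegral_ge0 => x _; exact: tdot_ge0.
Qed.

Lemma L2norm_eq0 V : L2 mu V -> L2norm mu V = 0 <-> {ae mu, forall x, V x = 0}.
Proof.
move=> LV; have mV : measurable_fun [set: borel N]
    (EFin \o (fun x : borel N => tdot x (V x) (V x))).
  by apply/measurable_EFinP; apply: tdot_measurable; case: LV.
have [ae1 ae2] := ae_eq_integral_abs mu measurableT mV.
have E : (\int[mu]_x `|(EFin \o (fun x : borel N => tdot x (V x) (V x))) x|
    = (L2dot mu V V)%:E)%E.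
  rewrite /L2dot /Rintegral fineK; last first.
    by apply: (integrable_fin_num measurableT); exact: L2_integrable_sqr.
  by apply: eq_integral => x _ /=; rewrite ger0_norm// tdot_ge0.
have dE : L2norm mu V = 0 <-> L2dot mu V V = 0.
  have := inorm_eq0 L2dot_semi_inner LV => h.
  by split=> /eqP; [rewrite [_ == _]h => /eqP|rewrite -h => /eqP].
apply: (iff_trans dE); split=> [V0|V0].
  have := ae1 _; rewrite E V0 => /(_ erefl); apply: filterS => x /(_ I) [].
  exact: tdot_eq0.
have : (\int[mu]_x `|(EFin \o (fun x : borel N => tdot x (V x) (V x))) x| = 0)%E.
  apply: ae2; apply: (ae_imp _ V0) => x /= -> _.
  by congr (_%:E); rewrite (si0l (tdot_semi_inner x)).
by rewrite E => -[].
Qed.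

End VectorFields.

(** * Completeness of the space of square-integrable fields *)

Section L2Complete.
Context (R : realType) (d : nat) (N : riemannianManifold R d).
Hypothesis cN : compact [set: N].
Variable mu : probability (borel N) R.
Implicit Types (V W : vfield N).

Let Lsi := L2dot_semi_inner cN mu.

Lemma L2_seminormed : seminormed (L2 mu) (L2norm mu).
Proof. by apply: (inorm_seminormed Lsi) => //; case: Lsi. Qed.

Lemma L2norm_ge0 V : 0 <= L2norm mu V. Proof. exact: sqrtr_ge0. Qed.

Lemma L2norm_sub_eq0 V W : L2 mu V -> L2 mu W ->
  L2norm mu (V - W) = 0 <-> {ae mu, forall x, V x = W x}.
Proof.
move=> LV LW; apply: (iff_trans (L2norm_eq0 cN (sn_memB L2_seminormed LV LW))).
split; apply: ae_imp => x; rewrite [(V - W) x]/(V x - W x).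
  by move/subr0_eq.
by move=> ->; exact: subrr.
Qed.

Lemma L2_ge0_dot V : L2 mu V ->
  (\int[mu]_x (tdot x (V x) (V x))%:E = (L2norm mu V ^+ 2)%:E)%E.
Proof.
move=> LV; rewrite [L2norm mu V](_ : _ = inorm (L2dot mu) V)//.
rewrite (sqr_inorm Lsi)// /L2dot /Rintegral fineK//.
by apply: (integrable_fin_num measurableT); exact: L2_integrable_sqr.
Qed.

Lemma cvg_geometric_steps (a : nat -> R) (M : R) :
  (forall k, `|a k.+1 - a k| <= M * 2^-1 ^+ k) -> cvgn a.
Proof.
move=> aM.
have M0 : 0 <= M.
  by have := aM 0; rewrite expr0 mulr1; exact: le_trans.
have : cvgn (series (telescope a)).
  apply: normed_cvg; apply: (@series_le_cvg _ _ (geometric M 2^-1)) => [n|n|n|].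
  - exact: normr_ge0.
  - by rewrite /= mulr_ge0// exprn_ge0.
  - exact: aM.
  - by apply: is_cvg_geometric_series; rewrite ger0_norm// invf_lt1// ltr1n.
rewrite telescopeK => c.
rewrite (_ : a = (fun n => (a n - a 0) + a 0)); last first.
  by apply/funext => n; rewrite subrK.
by apply: is_cvgD => //; exact: is_cvg_cst.
Qed.

(** Off the measurable set [E] where a series of squares diverges, the fields
    are replaced by 0, so that the limit exists everywhere. *)
Lemma L2_fast_limit (w : nat -> vfield N) : (forall k, L2 mu (w k)) ->
  (forall k, L2norm mu (w k.+1 - w k) <= 4^-1 ^+ k) ->
  exists (w' : nat -> vfield N) V, [/\ forall k, measurable_field (w' k),
    forall k, {ae mu, forall x, w' k x = w k x} &
    forall x j, w' k x ord0 j @[k --> \oo] --> V x ord0 j].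
Proof.
move=> Lw wd; pose D k := w k.+1 - w k.
have LD k : L2 mu (D k) by exact: (sn_memB L2_seminormed).
(* The squared norm of [D k] is at most [16 ^- k], so the weight [4 ^ k] leaves a summable series of
   integrals. Where the weighted sum is a finite [s], the length of [D k x] is at most
   [sqrt s * 2 ^- k], a geometric bound. *)
pose t k (x : borel N) : \bar R := (4 ^+ k * tdot x (D k x) (D k x))%:E.
have t0 k x : (0 <= t k x)%E by rewrite lee_fin mulr_ge0 ?exprn_ge0 ?tdot_ge0.
have mt k : measurable_fun setT (t k).
  apply/measurable_EFinP; apply: measurable_funM; first exact: measurable_cst.
  by apply: tdot_measurable => //; case: (LD k).
pose S x : \bar R := (\sum_(0 <= k <oo) t k x)%E.
have mS : measurable_fun setT S by exact: ge0_emeasurable_sum.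
have S0 x : (0 <= S x)%E by exact: nneseries_ge0.
(* The actual bound [4 ^- k] is relaxed to the form summed by [epsilon_trick0]. *)
have tint k : (\int[mu]_x t k x <= (2 / (2 ^ k.+1)%:R)%:E)%E.
  rewrite /t; under eq_integral do rewrite EFinM.
  rewrite ge0_integralZl//; last 2 first.
  - apply: measurableT_comp => //.
    by apply: tdot_measurable => //; case: (LD k).
  - by move=> x _; rewrite lee_fin tdot_ge0.
  rewrite L2_ge0_dot// -EFinM lee_fin.
  apply: (@le_trans _ _ (4 ^+ k * (4^-1 ^+ k) ^+ 2)).
    rewrite ler_wpM2l ?exprn_ge0// ler_pXn2r ?nnegrE ?exprn_ge0 ?L2norm_ge0//; exact: wd.
  rewrite expr2 mulrA -exprMn mulfV// expr1n mul1r expnS natrM invfM mulrA divff//.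
  rewrite mul1r exprVn lef_pV2 ?posrE ?exprn_gt0 ?ltr0n ?expn_gt0// natrX.
  by rewrite lerXn2r ?nnegrE// ler_nat.
have Sint : mu.-integrable setT S.
  apply/integrableP; split=> //.
  rewrite (eq_integral S); last by move=> x _; rewrite gee0_abs.
  rewrite integral_nneseries//; apply: (@le_lt_trans _ _ 2%:E); last exact: ltry.
  apply: le_trans (epsilon_trick0 _ _) => //.
  apply: lee_nneseries => [k _ _|k _]; first exact: integral_ge0.
  exact: tint.
pose E : set (borel N) := [set x | (S x < +oo)%E].
have mE : measurable E.
  rewrite -[E]setTI; exact: emeasurable_fun_infty_o.
have aeE : {ae mu, forall x, E x}.
  have := integrable_ae measurableT Sint; apply: ae_imp => x /(_ I).
  by rewrite /E /= ge0_fin_numE.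
pose w' k x := if x \in E then w k x else 0.
have conv x j : cvgn (fun k => w' k x ord0 j).
  rewrite /w'; case: (boolP (x \in E)) => xE; last exact: is_cvg_cst.
  have Sfin : S x = (fine (S x))%:E by rewrite fineK// ge0_fin_numE//; exact: set_mem.
  set s := fine (S x) in Sfin.
  have tb k : 4 ^+ k * tdot x (D k x) (D k x) <= s.
    rewrite -lee_fin -Sfin; apply: le_trans (@nneseries_lim_ge _ _ _ 0 k.+1 _) => //.
    by rewrite big_mkord big_ord_recr/= leeDr// sume_ge0.
  have s0 : 0 <= s by rewrite -lee_fin -Sfin.
  pose c := `|invmx (gmat (mcenter x) x) j j|.
  have c0 : 0 <= c by exact: normr_ge0.
  apply: (@cvg_geometric_steps _ (Num.sqrt (s * c))) => k.
  rewrite -(@ler_pXn2r _ 2)// ?nnegrE// ?mulr_ge0// ?exprn_ge0// ?sqrtr_ge0//.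
  rewrite real_normK ?num_real// exprMn sqr_sqrtr ?mulr_ge0//.
  have -> : w k.+1 x ord0 j - w k x ord0 j = D k x ord0 j.
    by rewrite [D k x]/(w k.+1 x - w k x) !mxE.
  apply: (le_trans (coord_bound x (D k x) j)).
  apply: (@le_trans _ _ (tdot x (D k x) (D k x) * c)).
    by rewrite ler_wpM2l ?tdot_ge0// ler_norm.
  rewrite mulrAC; apply: ler_wpM2r => //; rewrite -(@ler_pM2l _ (4 ^+ k)) ?exprn_gt0//.
  apply: (le_trans (tb k)); rewrite mulrCA -exprM mulnC exprM -exprMn.
  by rewrite (_ : 4 * 2^-1 ^+ 2 = 1) ?expr1n ?mulr1//; field.
exists w', (fun x => \row_j limn (fun k => w' k x ord0 j)); split.
- move=> k i j.
  rewrite [X in measurable_fun _ X](_ : _ = (fun x : borel N =>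
    \1_E x * tcoord i x (w k x) ord0 j)); last first.
    apply/funext => x; rewrite /w' indicE; case: (x \in E); first by rewrite mul1r.
    by rewrite mul0r tcoord0; transitivity ((0 : 'rV[R]_d) ord0 j); rewrite ?mxE.
  apply: measurable_funM; first exact: measurable_indic.
  by case: (Lw k).
- move=> k; apply: (ae_imp _ aeE) => x Ex; rewrite /w' ifT//; exact: mem_set.
- by move=> x j; rewrite mxE; exact: conv.
Qed.

Lemma limn_einf_le (u : (\bar R)^nat) c : (forall n, (u n <= c)%E) ->
  (limn_einf u <= c)%E.
Proof.
move=> uc; rewrite limn_einf_lim; apply: lime_le; first exact: is_cvg_einfs.
apply: nearW => n; apply: le_trans (uc n).
by apply: ereal_inf_lbound; exists n => /=.
Qed.

Lemma tdot_cvg (x : N) (v : nat -> 'rV[R]_d) (v' : 'rV[R]_d) :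
  (forall j, v k ord0 j @[k --> \oo] --> v' ord0 j) ->
  tdot x (v k) (v k) @[k --> \oo] --> tdot x v' v'.
Proof.
move=> vv; rewrite [tdot x v' v']gformE.
under eq_cvg do rewrite [tdot _ _ _]gformE.
apply: cvg_sum => j _; apply: cvg_sum => i _.
by apply: cvgM => //; apply: cvgM => //; exact: cvg_cst.
Qed.

(** Riesz-Fischer: a fast subsequence, modified on null sets, converges pointwise, and Fatou's lemma
    turns the pointwise limit into a limit in norm. *)
Theorem L2_complete : complete_seminormed (L2 mu) (L2norm mu).
Proof.
move=> u Lu uC.
have Ln := L2_seminormed.
have e0 k : 0 < 4^-1 ^+ k :> R by rewrite exprn_gt0.
pose M k := sval (cid (uC _ (e0 k))).
have MP k i j : (M k <= i)%N -> (M k <= j)%N -> L2norm mu (u i - u j) <= 4^-1 ^+ k.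
  by rewrite /M; case: cid => m /=; exact.
(* The sum makes [n] nondecreasing and at least [M k]; the term [k] makes [n k >= k], needed at the
   end to pass the rank [m0]. *)
pose n k := (\sum_(l < k.+1) M l + k)%N.
have nS k : (n k <= n k.+1)%N.
  rewrite [n k.+1]/n big_ord_recr/= -addnA leq_add2l addnS.
  by apply: leqW; rewrite leq_addl.
have nm k m : (k <= m)%N -> (n k <= n m)%N by exact: homo_leq leq_trans nS _ _.
have nM k m : (k <= m)%N -> (M k <= n m)%N.
  by move=> km; apply: leq_trans (nm _ _ km); rewrite /n big_ord_recr/= addnAC leq_addl.
pose w k := u (n k).
have [||w' [V [mw' w'w w'V]]] := @L2_fast_limit w.
- by move=> k; exact: Lu.
- by move=> k; apply: MP; exact: nM.
have mV : measurable_field V.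
  move=> i j; apply: (@measurable_fun_cvg _ _ _ _ (fun k (x : borel N) =>
    tcoord i x (w' k x) ord0 j)).
    by move=> k; exact: mw'.
  move=> x ix; rewrite /tcoord !mxE; under eq_cvg do rewrite mxE.
  by apply: cvg_sum => l _; apply: cvgMr_tmp; exact: w'V.
have aeq (A B : vfield N) : measurable_field A -> measurable_field B ->
    {ae mu, forall x, A x = B x} ->
    (\int[mu]_x (tdot x (A x) (A x))%:E = \int[mu]_x (tdot x (B x) (B x))%:E)%E.
  move=> mA mB AB; apply: ge0_ae_eq_integral => //.
  - by apply/measurable_EFinP; exact: tdot_measurable.
  - by apply/measurable_EFinP; exact: tdot_measurable.
  - by move=> x _; rewrite lee_fin tdot_ge0.
  - by move=> x _; rewrite lee_fin tdot_ge0.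
  - by apply: (ae_imp _ AB) => x ->.
have Lw' k : L2 mu (w' k).
  split=> //; rewrite (aeq _ (w k))//; first by case: (Lu (n k)).
  by case: (Lu (n k)).
have mB A B : measurable_field A -> measurable_field B -> measurable_field (A - B).
  move=> mA mB; rewrite addrC -scaleN1r; exact: measurable_field_lin.
have w'0 k : L2norm mu (w' k - w k) = 0 by apply/L2norm_sub_eq0 => //; exact: Lu.
(* The indices are shifted by [k] so that the bound holds for every term of the sequence to which
   Fatou's lemma is applied, as [limn_einf_le] requires. *)
have fat k e : 0 <= e -> (forall m, (k <= m)%N -> L2norm mu (w m - w k) <= e) ->
    (\int[mu]_x (tdot x ((V - w' k) x) ((V - w' k) x))%:E <= (e ^+ 2)%:E)%E.
  move=> ee he.
  pose f m (x : borel N) := (tdot x ((w' (m + k)%N - w' k) x) ((w' (m + k)%N - w' k) x))%:E.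
  have fV x : limn_einf (f ^~ x) = (tdot x ((V - w' k) x) ((V - w' k) x))%:E.
    rewrite limn_einf_lim; apply/cvg_lim => //; apply: cvg_einfs.
    apply: cvg_EFin; first exact: nearW.
    apply: tdot_cvg => j; rewrite [(V - w' k) x]/(V x - w' k x) !mxE.
    rewrite [X in X @ _](_ : _ =
        (fun m => w' (m + k)%N x ord0 j - w' k x ord0 j)); last first.
      by apply/funext => m; rewrite [(w' _ - _) x]/(w' (m + k)%N x - w' k x) !mxE.
    apply: cvgB; last exact: cvg_cst.
    by rewrite (cvg_shiftn k (fun m => w' m x ord0 j)); exact: w'V.
  under eq_integral do rewrite -fV.
  apply: (le_trans (fatou mu measurableT _ _)).
  - move=> m; apply/measurable_EFinP; apply: tdot_measurable => //; exact: mB.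
  - by move=> m x _; rewrite lee_fin tdot_ge0.
  apply: limn_einf_le => m.
  have Lmk := sn_memB Ln (Lw' (m + k)%N) (Lw' k).
  rewrite L2_ge0_dot// lee_fin ler_pXn2r ?nnegrE ?L2norm_ge0//.
  have := he (m + k)%N (leq_addl _ _).
  have t1 := sn_tri Ln (Lw' (m + k)%N) (Lw' k) (Lu (n (m + k)%N)).
  have t2 := sn_tri Ln (Lu (n (m + k)%N)) (Lw' k) (Lu (n k)).
  rewrite (snC Ln (Lu (n k)) (Lw' k)) in t2.
  rewrite w'0 add0r in t1; rewrite w'0 addr0 in t2.
  by move=> h; exact: le_trans t1 (le_trans t2 h).
have LV : L2 mu V.
  have L1 : L2 mu (V - w' 0%N).
    split; first exact: mB.
    apply: (le_lt_trans (fat 0%N 1 _ _)); rewrite ?ltry// => m _.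
    by rewrite -[1](expr0 4^-1); apply: MP; exact: nM.
  by rewrite -(subrK (w' 0%N) V); exact: (sn_memD Ln).
exists V => // e ee; have e2 : 0 < e / 2 by rewrite divr_gt0.
have [m0 hm0] := uC _ e2.
pose K := Num.bound (e / 2)^-1.
have Ke : 4^-1 ^+ K <= e / 2.
  rewrite exprVn invf_ple ?posrE ?exprn_gt0//.
  apply: (le_trans (ltW (archi_boundP _))); first by rewrite invr_ge0 ltW.
  by rewrite -natrX ler_nat ltnW// ltn_expl.
pose k := maxn m0 K.
exists m0 => i im.
have Lw : L2 mu (w k) by exact: Lu.
apply: (le_trans (sn_tri Ln (Lu i) LV Lw)); rewrite (splitr e); apply: lerD.
  by apply: hm0 => //; rewrite (leq_trans (leq_maxl m0 K))// /n leq_addl.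
apply: (le_trans (sn_tri Ln Lw LV (Lw' k))).
rewrite (snC Ln Lw (Lw' k)) w'0 add0r (snC Ln (Lw' k) LV).
rewrite -(@ler_pXn2r _ 2)// ?nnegrE ?L2norm_ge0 ?(ltW e2)//.
rewrite -lee_fin -L2_ge0_dot; last exact: (sn_memB Ln).
apply: fat; first exact: ltW.
move=> m km; apply: le_trans Ke; apply: MP; apply: nM; rewrite ?leq_maxr//.
exact: leq_trans (leq_maxr _ _) km.
Qed.

End L2Complete.

(** * Normal and tangent spaces *)

Section TangentSpace.
Context (R : realType) (d : nat) (N : riemannianManifold R d).
Hypothesis cN : compact [set: N].
Variable mu : probability (borel N) R.
Implicit Types (V W U : vfield N).

Let Lsi := L2dot_semi_inner cN mu.
Let Ln := L2_seminormed cN mu.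

Lemma dfun_integrable (f : N -> R) V : smooth_fun f -> L2 mu V ->
  mu.-integrable setT (EFin \o (fun x : borel N => dfun f x (V x))).
Proof.
move=> sf LV; have [M M0 Mb] := dfun_bound cN sf.
have h1 := integrableZl measurableT M (L2_integrable_sqr cN LV).
have h2 := finite_measure_integrable_cst mu (1 : R).
have h := integrableD measurableT h1 (h2 _ measurableT).
apply: le_integrable h => //.
  by apply/measurable_EFinP; apply: dfun_measurable => //; case: LV.
move=> x _ /=; rewrite lee_fin; apply: le_trans (ler_norm _).
(* Domination by [|z| <= z^2 + 1], a consequence of [(|z| - 1)^2 >= 0]; the constant 1 is integrable
   for a probability. *)
have := Mb x (V x); have := sqr_ge0 (`|dfun f x (V x)| - 1).
rewrite -[in X in _ -> X -> _](real_normK (num_real (dfun f x (V x)))).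
move: (`|_|) (M * _) (sqr_ge0 `|dfun f x (V x)|) => z t z2.
by rewrite sqrrB1; lra.
Qed.

Lemma preserves_subspace : subspace (preserves mu).
Proof.
have [[L0 Llin] _ _ _] := Lsi.
have add f a V W : smooth_fun f -> L2 mu V -> L2 mu W ->
    \int[mu]_x dfun f x ((a *: V + W) x) =
    a * \int[mu]_x dfun f x (V x) + \int[mu]_x dfun f x (W x).
  move=> sf LV LW; have iV := dfun_integrable sf LV.
  have iW := dfun_integrable sf LW.
  rewrite -RintegralZl// -RintegralD//; last exact: (integrableZl measurableT a iV).
  by apply: eq_Rintegral => x _; exact: dfun_lin.
split.
  split=> // f sf; rewrite (_ : \int[mu]_x _ = \int[mu]_(x in [set: borel N]) (cst 0 x)).
    by rewrite Rintegral_cst// mul0r.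
  apply: eq_Rintegral => x _ /=.
  have := dfun_lin x (-1) 0 0 sf; rewrite scaler0 addr0 mulN1r addNr; exact.
move=> a V W [LV pV] [LW pW]; split; first exact: Llin.
by move=> f sf; rewrite add// pV// pW// mulr0 addr0.
Qed.

Lemma Wnormal_L2 : Wnormal_space mu `<=` L2 mu.
Proof. by move=> V []. Qed.

Lemma Wnormal_subspace : subspace (Wnormal_space mu).
Proof.
have [P0 Plin] := preserves_subspace.
split.
  split=> [|e e0]; first exact: (sn_mem0 Ln).
  by exists 0 => //; rewrite subrr (sn0 Ln).
move=> a V W [LV nV] [LW nW].
have Lmem : L2 mu (a *: V + W) by case: Ln => _ + _ _; apply.
split=> // e e0.
have ltr0n2 : 0 < 2 :> R by [].
have a1 : 0 < 2 * (`|a| + 1) by rewrite mulr_gt0// ltr_wpDl.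
have [V' pV' lV] := nV (e / (2 * (`|a| + 1))) (divr_gt0 e0 a1).
have [W' pW' lW] := nW (e / 2) (divr_gt0 e0 ltr0n2).
exists (a *: V' + W'); first exact: Plin.
have LV' : L2 mu V' by case: pV'.
have LW' : L2 mu W' by case: pW'.
have -> : a *: V + W - (a *: V' + W') = a *: (V - V') + (W - W').
  by rewrite scalerBr opprD addrACA.
have LVV := sn_memB Ln LV LV'; have LWW := sn_memB Ln LW LW'.
apply: (le_lt_trans (snD Ln (sn_memZ Ln a LVV) LWW)); rewrite (snZ Ln)//.
rewrite (splitr e); apply: ler_ltD => //.
apply: (@le_trans _ _ (`|a| * (e / (2 * (`|a| + 1))))).
  by apply: ler_wpM2l => //; exact: ltW.
rewrite mulrCA ler_pM2l// ler_pdivrMr//; lra.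
Qed.

Lemma Wnormal_complete : complete_seminormed (Wnormal_space mu) (L2norm mu).
Proof.
move=> u uN uC; have Lu k : L2 mu (u k) by case: (uN k).
have [V LV Vl] := L2_complete cN Lu uC.
exists V => //; split=> // e e0.
have e3 : 0 < e / 2 by rewrite divr_gt0.
have [M /(_ M (leqnn _)) VM] := Vl _ e3.
have [_ /(_ _ e3)[W pW lW]] := uN M; have LW : L2 mu W by case: pW.
exists W => //; apply: (le_lt_trans (sn_tri Ln LV LW (Lu M))).
by rewrite (snC Ln LV (Lu M)) (splitr e); exact: ler_ltD.
Qed.

Lemma Wnormal_null V W : Wnormal_space mu V -> L2 mu W ->
  L2norm mu (W - V) = 0 -> Wnormal_space mu W.
Proof.
move=> [LV nV] LW WV; split=> // e e0; have [Z pZ lZ] := nV e e0.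
exists Z => //; have LZ : L2 mu Z by case: pZ.
by apply: (le_lt_trans (sn_tri Ln LW LZ LV)); rewrite WV add0r.
Qed.

Lemma Wtangent_L2 : Wtangent_space mu `<=` L2 mu.
Proof. by move=> V []. Qed.

Lemma Wtangent_subspace : subspace (Wtangent_space mu).
Proof. exact: (perp_subspace Lsi Wnormal_L2). Qed.

Lemma Wtangent_seminormed : seminormed (Wtangent_space mu) (L2norm mu).
Proof. exact: (inorm_seminormed Lsi Wtangent_L2 Wtangent_subspace). Qed.

Lemma Wtangent_complete : complete_seminormed (Wtangent_space mu) (L2norm mu).
Proof. exact: (perp_complete Lsi Wnormal_L2 (@L2_complete _ _ _ cN mu)). Qed.

Lemma proj_tangentP V : L2 mu V -> Wtangent_space mu (proj_tangent mu V) /\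
  forall W, Wtangent_space mu W -> L2dot mu (V - proj_tangent mu V) W = 0.
Proof.
move=> LV; apply: (xgetPex 0 (P := [set U | Wtangent_space mu U /\
  forall W, Wtangent_space mu W -> L2dot mu (V - U) W = 0])).
have [U TU pU] := projection_ex Lsi Wtangent_L2 Wtangent_subspace (@Wtangent_complete) LV.
by exists U.
Qed.

Lemma proj_tangent_mem V : L2 mu V -> Wtangent_space mu (proj_tangent mu V).
Proof. by move=> /proj_tangentP[]. Qed.

Lemma proj_tangent_L2 V : L2 mu V -> L2 mu (proj_tangent mu V).
Proof. by move=> /proj_tangent_mem; exact: Wtangent_L2. Qed.

Lemma proj_tangent_dot V W : L2 mu V -> Wtangent_space mu W ->
  L2dot mu (proj_tangent mu V) W = L2dot mu V W.
Proof.
move=> LV TW; have [TP /(_ _ TW)] := proj_tangentP LV.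
rewrite (siBl Lsi)//; [|exact: Wtangent_L2..].
by move/eqP; rewrite subr_eq0 => /eqP.
Qed.

(** The normal space is closed and stable under null changes, so it is in turn the orthogonal
    complement of the tangent space. *)
Lemma proj_tangent_residual V : L2 mu V ->
  Wnormal_space mu (V - proj_tangent mu V).
Proof.
move=> LV; have LP := proj_tangent_L2 LV.
apply: (perp_perp Lsi Wnormal_L2 Wnormal_subspace (@Wnormal_complete) Wnormal_null).
  exact: (sn_memB Ln).
by move=> W TW; case: (proj_tangentP LV) => _; apply.
Qed.

(** Testing against the projection itself bounds its squared norm by [c] times its norm. *)
Lemma proj_tangent_le V c : L2 mu V -> 0 <= c ->
  (forall U, Wtangent_space mu U -> L2dot mu V U <= c * L2norm mu U) ->
  L2norm mu (proj_tangent mu V) <= c.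
Proof.
move=> LV c0 h; have TP := proj_tangent_mem LV; have LP := proj_tangent_L2 LV.
have := h _ TP; rewrite -(proj_tangent_dot LV TP).
rewrite -[L2dot _ _ _](sqr_inorm Lsi LP) [inorm _ _]/(L2norm mu _).
have := L2norm_ge0 mu (proj_tangent mu V).
set n := L2norm _ _; rewrite le_eqVlt => /orP[/eqP <-//|n0].
by rewrite expr2 ler_pM2r.
Qed.

Lemma proj_tangent_nonexp V : L2 mu V ->
  L2norm mu (proj_tangent mu V) <= L2norm mu V.
Proof.
move=> LV; apply: proj_tangent_le => // [|U TU]; first exact: L2norm_ge0.
apply: (le_trans (ler_norm _)).
exact: (cauchy_schwarz Lsi LV (Wtangent_L2 TU)).
Qed.

Lemma tangent_dot_null V : Wtangent_space mu V ->
  (forall U, Wtangent_space mu U -> L2dot mu V U = 0) -> L2norm mu V = 0.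
Proof.
move=> TV h; apply/eqP; rewrite (inorm_eq0 Lsi (Wtangent_L2 TV)).
by apply/eqP; exact: h.
Qed.

Lemma proj_tangent_id V : Wtangent_space mu V ->
  L2norm mu (proj_tangent mu V - V) = 0.
Proof.
move=> TV; have LV := Wtangent_L2 TV; have TP := proj_tangent_mem LV.
have Tn := Wtangent_seminormed.
apply: tangent_dot_null; first exact: (sn_memB Tn).
move=> U TU; rewrite (siBl Lsi) ?proj_tangent_dot ?subrr//; exact: Wtangent_L2.
Qed.

Lemma proj_tangent_oper :
  oper (L2 mu) (L2norm mu) (Wtangent_space mu) (L2norm mu) 1 (proj_tangent mu).
Proof.
have Tn := Wtangent_seminormed.
split=> [V|a V W LV LW|V LV]; first exact: proj_tangent_mem.
- have LVW : L2 mu (a *: V + W) by case: Ln => _ + _ _; apply.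
  have TV := proj_tangent_mem LV; have TW := proj_tangent_mem LW.
  have TVW := proj_tangent_mem LVW.
  have T2 : Wtangent_space mu (a *: proj_tangent mu V + proj_tangent mu W).
    by case: Tn => _ + _ _; apply.
  apply: tangent_dot_null; first exact: (sn_memB Tn).
  move=> U TU; have LU := Wtangent_L2 TU.
  rewrite (siBl Lsi); [|exact: Wtangent_L2..|by []].
  rewrite proj_tangent_dot//.
  case: Lsi => _ _ lin _; rewrite !lin//; [|exact: Wtangent_L2..].
  by rewrite !proj_tangent_dot// subrr.
- by rewrite mul1r; exact: proj_tangent_nonexp.
Qed.

End TangentSpace.

(** * Parallel transport *)

Section Gronwall.
Context (R : realType).

Lemma is_derive_expRM (k s : R) :
  is_derive s (1 : R) (fun z => expR (k * z)) (k * expR (k * s)).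
Proof.
have dl : is_derive s (1 : R) (fun z => k * z) k.
  by apply: (is_derive_eq (is_deriveZ k (is_derive_id s (1 : R)))); exact: mulr1.
apply: (is_derive_eq (is_derive1_comp (is_derive_expR (k * s)) dl)).
by rewrite mulrC.
Qed.

Lemma gronwall_right (E E' : R -> R) (k a b : R) : a <= b ->
  (forall s, s \in `[a, b] -> is_derive s (1 : R) E (E' s)) ->
  (forall s, s \in `[a, b] -> E' s <= k * E s) -> E a = 0 -> E b <= 0.
Proof.
move=> ab dE bE Ea.
pose G s := E s * expR (- k * s).
have dG s : s \in `[a, b] ->
    is_derive s (1 : R) G ((E' s - k * E s) * expR (- k * s)).
  move=> sab; have h1 := dE s sab; have h2 := is_derive_expRM (- k) s.
  apply: (is_derive_eq (is_deriveM h1 h2)).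
  by rewrite /GRing.scale/=; ring.
have cG : {within `[a, b], continuous G}.
  apply: continuous_in_subspaceT => s; rewrite inE => /dG[gs _].
  exact/differentiable_continuous/derivable1_diffP.
have dG' s : s \in `]a, b[ -> is_derive s (1 : R) G ((E' s - k * E s) * expR (- k * s)).
  by move=> /subset_itv_oo_cc; exact: dG.
have [s sab eqG] := MVT_segment ab dG' cG.
have : G b <= G a.
  rewrite -subr_le0 eqG; apply: mulr_le0_ge0; last by rewrite subr_ge0.
  by apply: mulr_le0_ge0; [rewrite subr_le0 bE|exact: expR_ge0].
by rewrite /G Ea mul0r pmulr_lle0// expR_gt0.
Qed.

Lemma gronwall_left (E E' : R -> R) (k a b : R) : a <= b ->
  (forall s, s \in `[a, b] -> is_derive s (1 : R) E (E' s)) ->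
  (forall s, s \in `[a, b] -> - E' s <= k * E s) -> E b = 0 -> E a <= 0.
Proof.
move=> ab dE bE Eb.
pose G s := E s * expR (k * s).
have dG s : s \in `[a, b] ->
    is_derive s (1 : R) G ((E' s + k * E s) * expR (k * s)).
  move=> sab; have h1 := dE s sab; have h2 := is_derive_expRM k s.
  apply: (is_derive_eq (is_deriveM h1 h2)).
  by rewrite /GRing.scale/=; ring.
have cG : {within `[a, b], continuous G}.
  apply: continuous_in_subspaceT => s; rewrite inE => /dG[gs _].
  exact/differentiable_continuous/derivable1_diffP.
have dG' s : s \in `]a, b[ -> is_derive s (1 : R) G ((E' s + k * E s) * expR (k * s)).
  by move=> /subset_itv_oo_cc; exact: dG.
have [s sab eqG] := MVT_segment ab dG' cG.
have : G a <= G b.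
  rewrite -subr_ge0 eqG; apply: mulr_ge0; last by rewrite subr_ge0.
  apply: mulr_ge0; last exact: expR_ge0.
  by have := bE s sab; lra.
by rewrite /G Eb mul0r pmulr_lle0// expR_gt0.
Qed.

(** The zero [t1] is anywhere in the ball, so both directions of time are needed. This freedom makes
    the zeros of a parallel field a closed set of times as well as an open one. *)
Lemma gronwall_zero (E E' : R -> R) (k t r t1 : R) :
  (forall s, ball t r s -> is_derive s (1 : R) E (E' s)) ->
  (forall s, ball t r s -> `|E' s| <= k * E s) ->
  ball t r t1 -> E t1 = 0 -> forall s, ball t r s -> E s <= 0.
Proof.
move=> dE bE bt1 E1 s bs.
have sub a b z : ball t r a -> ball t r b -> z \in `[a, b] -> ball t r z.
  rewrite -ball_normE /= !ltr_norml in_itv/=; lra.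
have [ts|st] := leP t1 s.
  apply: (@gronwall_right E E' k t1 s) => // z /(sub _ _ _ bt1 bs) bz; first exact: dE.
  exact: le_trans (ler_norm _) (bE z bz).
apply: (@gronwall_left E E' k s t1) => // [|z|z]; first exact: ltW.
  by move=> /(sub _ _ _ bs bt1); exact: dE.
move=> /(sub _ _ _ bs bt1) bz; apply: le_trans (bE z bz).
by rewrite -normrN ler_norm.
Qed.

End Gronwall.

(** * Uniqueness of parallel fields *)

Section ParallelFields.
Context (R : realType) (d : nat) (N : riemannianManifold R d).
Implicit Types (c : R -> N) (V W : R -> 'rV[R]_d).

Lemma linear_ode_lin (Y Z : R -> 'rV[R]_d) (A : 'I_d -> 'I_d -> 'I_d -> R)
    (u : 'rV[R]_d) (t e : R) :
  derivable Y t 1 -> (forall k, derive1 Y t ord0 k =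
    - \sum_(a < d) \sum_(b < d) A a b k * u ord0 a * Y t ord0 b) ->
  derivable Z t 1 -> (forall k, derive1 Z t ord0 k =
    - \sum_(a < d) \sum_(b < d) A a b k * u ord0 a * Z t ord0 b) ->
  derivable (fun s => e *: Y s + Z s) t 1 /\
  forall k, derive1 (fun s => e *: Y s + Z s) t ord0 k =
    - \sum_(a < d) \sum_(b < d) A a b k * u ord0 a * (e *: Y t + Z t) ord0 b.
Proof.
move=> dY eY dZ eZ.
have iY : is_derive t (1 : R) Y (derive1 Y t).
  by apply: DeriveDef; [exact: dY|rewrite derive1E].
have iZ : is_derive t (1 : R) Z (derive1 Z t).
  by apply: DeriveDef; [exact: dZ|rewrite derive1E].
have [dYZ eYZ] := is_deriveD (is_deriveZ e iY) iZ.
split; first exact: dYZ.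
move=> k; rewrite derive1E eYZ.
have -> : (e *: derive1 Y t + derive1 Z t) ord0 k =
    e * derive1 Y t ord0 k + derive1 Z t ord0 k by rewrite !mxE.
rewrite eY eZ mulrN -opprD; congr (- _); rewrite mulr_sumr -big_split.
apply: eq_bigr => l _; rewrite mulr_sumr -big_split; apply: eq_bigr => b _ /=.
by rewrite !mxE mulrDr; congr (_ + _); rewrite mulrCA.
Qed.

Lemma parallel_along_lin c a V W : parallel_along c V -> parallel_along c W ->
  parallel_along c (fun s => a *: V s + W s).
Proof.
move=> pV pW t i it; have [dV eV] := pV t i it; have [dW eW] := pW t i it.
have := linear_ode_lin a dV eV dW eW.
have E : (fun s => tcoord i (c s) (a *: V s + W s)) =
    (fun s => a *: tcoord i (c s) (V s) + tcoord i (c s) (W s)).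
  by apply/funext => s; exact: tcoord_lin.
move=> h; cbv zeta; rewrite E; exact: h.
Qed.

Lemma parallel_along0 c : parallel_along c (fun _ => 0).
Proof.
move=> t i it.
have -> : (fun s => tcoord i (c s) 0) = cst 0 by apply/funext => s; exact: tcoord0.
split; first exact: derivable_cst.
move=> k; rewrite derive1_cst !mxE big1 ?oppr0// => a _.
by rewrite big1// => b _; rewrite /cst mxE mulr0.
Qed.

Lemma christoffel_cvg c t i a b k : continuous c -> mdom i (c t) ->
  christoffel i (mchart i (c s)) a b k @[s --> t] --> christoffel i (mchart i (c t)) a b k.
Proof.
move=> cc it; have ct : (mchart i @` mdom i) (mchart i (c t)) by exists (c t).
have cy : mchart i (c s) @[s --> t] --> mchart i (c t).
  by apply: (@continuous_comp _ _ _ c (mchart i)); [exact: cc|exact: mchart_continuous].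
have cp l (e f : 'I_d) : partial l (fun z => mmetric i z e f) (mchart i (c s)) @[s --> t] -->
    partial l (fun z => mmetric i z e f) (mchart i (c t)).
  apply: (cvg_comp _ _ cy).
  by have [_ /(_ l)[_ [+ _]]] := @mmetric_smooth _ _ N i e f 1%N; exact.
apply: cvgM; first exact: cvg_cst.
apply: (@cvg_sum _ _ (nbhs t) (nbhs_filter t)) => l _; apply: cvgM.
  exact (@continuous_comp _ _ _ c (fun y => invmx (gmat i y) k l) t (cc t)
    (@invgmat_continuous _ _ _ i (c t) k l it)).
exact (cvgB (cvgD (cp a b l) (cp b a l)) (cp l a b)).
Qed.

(** In the chart around [c t] a parallel field solves a linear equation with coefficients bounded
    near [t]; Gronwall applies to the sum of the squares of its coordinates. *)
Lemma parallel_local c V (t : R) : C1_curve c -> parallel_along c V ->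
  exists2 r, 0 < r & forall t1, ball t r t1 -> V t1 = 0 ->
    forall s, ball t r s -> V s = 0.
Proof.
move=> [cc c1] pV; pose i := mcenter (c t).
have it : mdom i (c t) by exact: mdom_center.
pose A (s : R) (b k : 'I_d) := \sum_(a < d) christoffel i (mchart i (c s)) a b k *
  (derive1 (mchart i \o c) s) ord0 a.
have cA b k : A s b k @[s --> t] --> A t b k.
  apply: (@cvg_sum _ _ (nbhs t) (nbhs_filter t)) => a _; apply: cvgM.
    exact: christoffel_cvg.
  have [_ cu] := c1 t i it.
  exact (@continuous_comp _ _ _ (derive1 (mchart i \o c)) (fun u : 'rV[R]_d => u ord0 a)
    t cu (@coord_continuous _ _ _ ord0 a _)).
(* A sum instead of a maximum: it dominates every [|A t b k| + 1], hence by continuity every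
   [|A s b k|] for [s] near [t]. *)
pose K := \sum_(b < d) \sum_(k < d) (`|A t b k| + 1).
have Kb : \forall s \near t, mdom i (c s) /\ forall b k, `|A s b k| <= K.
  near=> s; split.
    near: s; apply: (cc t); apply: open_nbhs_nbhs; split=> //; exact: mdom_open.
  move=> b k; apply: (@le_trans _ _ (`|A t b k| + 1)).
    have : `|A t b k - A s b k| <= 1.
      move: b k; near: s.
      apply: (@filter_forall _ _ (fun b s => forall k, `|A t b k - A s b k| <= 1)) => b.
      apply: (@filter_forall _ _ (fun k s => `|A t b k - A s b k| <= 1)) => k.
      by move/cvgrPdist_le : (cA b k); apply.
    have := ler_normB (A t b k) (A t b k - A s b k).
    by rewrite opprB addrC subrK; lra.
  rewrite /K (bigD1 b)//= (bigD1 k)//= -addrA lerDl addr_ge0//.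
    by apply: sumr_ge0 => l _; rewrite addr_ge0.
  by apply: sumr_ge0 => e _; apply: sumr_ge0 => l _; rewrite addr_ge0.
move: Kb => /nbhs_ballP[r /= r0 Br]; exists r => // t1 bt1 V1 s bs.
pose Y s := tcoord i (c s) (V s).
pose y (k : 'I_d) s := Y s ord0 k.
pose E s := \sum_(k < d) y k s ^+ 2.
pose y' k s := - \sum_(b < d) A s b k * y b s.
have dy k z : ball t r z -> is_derive z (1 : R) (y k) (y' k z).
  move=> /Br[iz _]; have [dY /(_ k) eY] := pV z i iz.
  split; first by move/derivable_mxP : dY; exact.
  have := eY; rewrite derive1E derive_mx// mxE => ->.
  congr (- _); rewrite exchange_big/=; apply: eq_bigr => b _.
  by rewrite /A mulr_suml.
pose E' s := \sum_(k < d) (2%:R * y k s ^+ 1) *: y' k s.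
have dE z : ball t r z -> is_derive z (1 : R) E (E' z).
  move=> bz; have -> : E = \sum_(k < d) (y k ^+ 2).
    by apply/funext => x; rewrite fct_sumE.
  exact: (is_derive_sum (fun k => is_deriveX 2 (dy k z bz))).
(* From [2 p q <= p^2 + q^2]; summing over pairs of indices counts each square [2 d] times. *)
have bE z : ball t r z -> `|E' z| <= 2 * d%:R * K * E z.
  move=> /Br[_ Ab].
  have -> : 2 * d%:R * K * E z = \sum_(k < d) \sum_(b < d) K * (y k z ^+ 2 + y b z ^+ 2).
    rewrite [RHS](eq_bigr (fun k => K * (d%:R * y k z ^+ 2 + E z))); last first.
      move=> k _; rewrite -mulr_sumr big_split/= sumr_const card_ord.
      by congr (K * (_ + _)); rewrite mulr_natl.
    rewrite -mulr_sumr big_split/= -mulr_sumr sumr_const card_ord -/(E z).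
    have -> : E z *+ d = d%:R * E z by rewrite mulr_natl.
    ring.
  apply: (le_trans (ler_norm_sum _ _ _)); apply: ler_sum => k _.
  rewrite /y' [_ *: _]mulrN normrN expr1 mulr_sumr.
  apply: (le_trans (ler_norm_sum _ _ _)); apply: ler_sum => b _.
  have Kz := Ab b k.
  rewrite !normrM (ger0_norm (ler0n _ 2)) -(real_normK (num_real (y k z))).
  rewrite -(real_normK (num_real (y b z))).
  have p0 := normr_ge0 (y k z); have q0 := normr_ge0 (y b z).
  have a0 := normr_ge0 (A z b k); move: p0 q0 a0 Kz.
  move: `|y k z| `|y b z| `|A z b k| => p q a p0 q0 a0 Kz.
  have : a * (2 * p * q) <= K * (2 * p * q) by rewrite ler_wpM2r// !mulr_ge0.
  have : 0 <= K * (p - q) ^+ 2 by rewrite mulr_ge0 ?sqr_ge0// (le_trans a0).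
  by rewrite !expr2; lra.
have E1 : E t1 = 0.
  rewrite /E big1// => k _; rewrite /y /Y V1 tcoord0 mxE expr0n//.
have Es := gronwall_zero dE bE bt1 E1 bs.
have [is_ _] := Br s bs.
apply: (tcoord_eq0 is_); apply/rowP => k; rewrite [RHS]mxE.
have : \sum_(l < d) y l s ^+ 2 == 0.
  by rewrite eq_le Es/= sumr_ge0// => l _; exact: sqr_ge0.
rewrite psumr_eq0; last by move=> l _; exact: sqr_ge0.
by move=> /allP /(_ k (mem_index_enum _)); rewrite sqrf_eq0 => /eqP.
Unshelve. all: by end_near. Qed.

(** Zeros of a parallel field form an open and closed set of times. *)
Lemma parallel_zero c V t0 : C1_curve c -> parallel_along c V -> V t0 = 0 ->
  forall t, V t = 0.
Proof.
move=> cc pV V0; pose Z := [set t | V t = 0].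
suff ZT : Z = setT by move=> t; have : Z t by rewrite ZT.
have conn : connected [set: R] by exact/connected_intervalP.
apply: conn; first by exists t0.
- exists Z; last by rewrite setTI.
  rewrite openE => t Zt; have [r r0 h] := parallel_local t cc pV.
  by apply/nbhs_ballP; exists r => // s bs; apply: (h t) => //; exact: ballxx.
- exists Z; last by rewrite setTI.
  rewrite -[Z]setCK; apply: open_closedC; rewrite openE => t nZt.
  have [r r0 h] := parallel_local t cc pV.
  apply/nbhs_ballP; exists r => // s bs Zs; apply: nZt.
  by apply: (h s) => //; exact: ballxx.
Qed.

Lemma parallel_transport_unique c s t v w w' : C1_curve c ->
  parallel_transport c s t v w -> parallel_transport c s t v w' -> w = w'.
Proof.
move=> cc [V [pV Vs <-]] [W [pW Ws <-]].
have := parallel_zero cc (parallel_along_lin (-1) pV pW) (t0 := s).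
rewrite Vs Ws scaleN1r addNr => /(_ erefl t).
by rewrite scaleN1r addrC => /subr0_eq.
Qed.

(** The two witnessing fields agree at [t], hence everywhere, so the first one carries the whole
    transport. *)
Lemma parallel_transport_trans c s t r v w z : C1_curve c ->
  parallel_transport c s t v w -> parallel_transport c t r w z ->
  parallel_transport c s r v z.
Proof.
move=> cc [V [pV Vs Vt]] [W [pW Wt <-]]; exists V; split=> //.
have := parallel_zero cc (parallel_along_lin (-1) pV pW) (t0 := t).
rewrite Vt Wt scaleN1r addNr => /(_ erefl r).
by rewrite scaleN1r addrC => /subr0_eq.
Qed.

End ParallelFields.

(** * Parallel transport as a functorial family of unitary operators *)

Section ParallelOperator.
Context (R : realType) (d : nat) (N : riemannianManifold R d).
Hypothesis cN : compact [set: N].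
Variables (mu : R -> probability (borel N) R) (Pi : probability (segments N) R).
Hypothesis muPi : forall (t : R) (B : set (borel N)), t \in `[0, 1] -> measurable B ->
  mu t B = Pi (ev t @^-1` B).
Implicit Types (V W : vfield N) (s t r : R).

Lemma ev_measurable t : t \in `[0, 1] ->
  measurable_fun [set: segments N] (ev t : segments N -> borel N).
Proof.
move=> tI; apply: (@measurability _ _ (segments N) (borel N) setT (ev t) (@open N)) => //.
move=> _ [U oU <-]; rewrite setTI; apply: sub_sigma_algebra.
by exists t, U.
Qed.

Lemma ae_ev t (P : N -> Prop) : t \in `[0, 1] ->
  {ae mu t, forall x, P x} -> {ae Pi, forall g, P (ev t g)}.
Proof.
move=> tI [B [mB B0 PB]]; exists (ev t @^-1` B); split.
- rewrite -[X in measurable X]setTI; exact: ev_measurable.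
- by rewrite -muPi.
- by move=> g nP; apply: PB.
Qed.

(** A property of almost all segments descends to [mu t] through a measurable set of points; here it
    is the set where the squared length of [V - W] is nonzero. *)
Lemma ae_eq_ev t V W : t \in `[0, 1] -> L2 (mu t) V -> L2 (mu t) W ->
  {ae Pi, forall g, V (ev t g) = W (ev t g)} -> L2norm (mu t) (V - W) = 0.
Proof.
move=> tI LV LW VW; apply/(L2norm_sub_eq0 cN LV LW).
have LVW := sn_memB (L2_seminormed cN (mu t)) LV LW.
pose f (x : borel N) := tdot x ((V - W) x) ((V - W) x).
have mf : measurable_fun setT f by apply: tdot_measurable => //; case: LVW.
have mB : measurable (f @^-1` (~` [set 0])).
  by rewrite -[X in measurable X]setTI; apply: mf => //; exact: measurableC.
exists (f @^-1` (~` [set 0])); split=> //.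
  rewrite muPi//; apply: measure_negligible.
    by rewrite -[X in measurable X]setTI; exact: ev_measurable.
  apply: negligibleS VW => g /= fg /= VWg; apply: fg; rewrite /f.
  have -> : (V - W) (ev t g) = V (ev t g) - W (ev t g) by [].
  rewrite VWg subrr; exact: (si0l (tdot_semi_inner (ev t g))).
move=> x /= VWx f0; apply: VWx; apply/subr0_eq; exact: tdot_eq0 f0.
Qed.

Lemma segment_C1 (g : segment N) : C1_curve g.
Proof. by case: g => c [[]]. Qed.

Lemma is_transported_trans s t r (U V W : vfield N) :
  is_transported Pi s t U V -> is_transported Pi t r V W -> is_transported Pi s r U W.
Proof.
by apply: ae_imp2 => g; apply: parallel_transport_trans; exact: segment_C1.
Qed.

Lemma is_transported_unique s t V W W' : t \in `[0, 1] ->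
  L2 (mu t) W -> L2 (mu t) W' ->
  is_transported Pi s t V W -> is_transported Pi s t V W' ->
  L2norm (mu t) (W - W') = 0.
Proof.
move=> tI LW LW' h h'; apply: ae_eq_ev => //.
by apply: (ae_imp2 _ h h') => g; apply: parallel_transport_unique; exact: segment_C1.
Qed.

Hypothesis ParT_unitary : forall s t : R, s \in `[0, 1] -> t \in `[0, 1] ->
  unitary_operator (mu s) (mu t) (L2 (mu s)) (L2 (mu t)) (ParT mu Pi s t).

Lemma ParT_L2 s t V : s \in `[0, 1] -> t \in `[0, 1] -> L2 (mu s) V ->
  L2 (mu t) (ParT mu Pi s t V).
Proof. by move=> sI tI LV; case: (ParT_unitary sI tI) => -[+ _ _] _ _; apply. Qed.

Lemma ParT_dot s t V W : s \in `[0, 1] -> t \in `[0, 1] ->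
  L2 (mu s) V -> L2 (mu s) W ->
  L2dot (mu t) (ParT mu Pi s t V) (ParT mu Pi s t W) = L2dot (mu s) V W.
Proof. by move=> sI tI LV LW; case: (ParT_unitary sI tI) => _ + _; apply. Qed.

Lemma ParT_norm s t V : s \in `[0, 1] -> t \in `[0, 1] -> L2 (mu s) V ->
  L2norm (mu t) (ParT mu Pi s t V) = L2norm (mu s) V.
Proof. by move=> sI tI LV; rewrite /L2norm ParT_dot. Qed.

Lemma ParT_oper s t : s \in `[0, 1] -> t \in `[0, 1] ->
  oper (L2 (mu s)) (L2norm (mu s)) (L2 (mu t)) (L2norm (mu t)) 1 (ParT mu Pi s t).
Proof.
move=> sI tI; split=> [V|a V W LV LW|V LV]; first exact: ParT_L2.
- have [[_ lin _] _ _] := ParT_unitary sI tI.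
  have Ls := L2_seminormed cN (mu s); have Lt := L2_seminormed cN (mu t).
  apply/(L2norm_sub_eq0 cN); last exact: lin.
    by apply: ParT_L2 => //; case: Ls => _ + _ _; apply.
  by case: Lt => _ + _ _; apply; exact: ParT_L2.
- by rewrite ParT_norm// mul1r.
Qed.

(** The default value 0 of [xget] is only taken on null fields, for which it
    is a genuine transport, [ParT] being isometric. *)
Lemma ParT_transported s t V : s \in `[0, 1] -> t \in `[0, 1] -> L2 (mu s) V ->
  is_transported Pi s t V (ParT mu Pi s t V).
Proof.
move=> sI tI LV.
pose A := [set W | L2 (mu t) W /\ is_transported Pi s t V W].
have [[W AW]|nA] := pselect (exists W, A W).
  by have [] := @xgetPex _ 0 A (ex_intro _ W AW).
have P0 : ParT mu Pi s t V = 0.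
  by apply: xgetPN => W AW; apply: nA; exists W.
have V0 : L2norm (mu s) V = 0.
  by rewrite -(ParT_norm sI tI LV) P0 (sn0 (L2_seminormed cN (mu t))).
rewrite P0; move/(L2norm_eq0 cN LV) : V0 => /(ae_ev sI); apply: ae_imp => g ->.
by exists (fun _ => 0); split=> //; exact: parallel_along0.
Qed.

Lemma ParT_trans s t r V : s \in `[0, 1] -> t \in `[0, 1] -> r \in `[0, 1] ->
  L2 (mu s) V ->
  L2norm (mu r) (ParT mu Pi t r (ParT mu Pi s t V) - ParT mu Pi s r V) = 0.
Proof.
move=> sI tI rI LV; have LP := ParT_L2 sI tI LV.
apply: (is_transported_unique (s := s) (V := V) rI).
- exact: ParT_L2.
- exact: ParT_L2.
- exact: (is_transported_trans (ParT_transported sI tI LV) (ParT_transported tI rI LP)).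
- exact: ParT_transported.
Qed.

Lemma ParT_id s V : s \in `[0, 1] -> L2 (mu s) V ->
  L2norm (mu s) (ParT mu Pi s s V - V) = 0.
Proof.
move=> sI LV; apply: ae_eq_ev => //; first exact: ParT_L2.
by apply: (ae_imp _ (ParT_transported sI sI LV)) => g [P [_ <- <-]].
Qed.

(** An isometry has its inverse as adjoint, and by functoriality the inverse is the transport in the
    other direction. *)
Lemma ParT_adjoint s t V W : s \in `[0, 1] -> t \in `[0, 1] ->
  L2 (mu s) V -> L2 (mu t) W ->
  L2dot (mu t) (ParT mu Pi s t V) W = L2dot (mu s) V (ParT mu Pi t s W).
Proof.
move=> sI tI LV LW; have LP := ParT_L2 tI sI LW; have LPV := ParT_L2 sI tI LV.
have Lt := L2_seminormed cN (mu t); have si := L2dot_semi_inner cN (mu t).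
rewrite -(ParT_dot sI tI LV LP); apply/eqP; rewrite -subr_eq0.
have LPP := ParT_L2 sI tI LP; have LPt := ParT_L2 tI tI LW.
rewrite -(siBr si)// (siC si)//; last exact: (sn_memB Lt).
rewrite (dot_null si)//; first exact: (sn_memB Lt).
apply/eqP; rewrite eq_le (sn_ge0 Lt) ?andbT; last exact: (sn_memB Lt).
apply: (le_trans (sn_tri Lt LW LPP LPt)).
by rewrite (snC Lt LW LPt) ParT_id// (snC Lt LPt LPP) ParT_trans// addr0.
Qed.

End ParallelOperator.

(** * Homogenization along dense sets of times *)

Section OperatorNorms.
Context (R : realType) (V : lmodType R).
Variables (D E : set V) (n m : V -> R).
Hypotheses (Dn : seminormed D n) (Em : seminormed E m).

Lemma oper_scale (M : R) (S : V -> V) a u : oper D n E m M S -> D u ->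
  m (S (a *: u)) = `|a| * m (S u).
Proof.
move=> SM Du; have [SE Sl _] := SM.
have D0 := sn_mem0 Dn; have DZ := sn_memZ Dn a Du.
have S0 : m (S 0) = 0.
  by rewrite -(snN Em (SE _ D0)); have := Sl 1 _ _ D0 D0;
     rewrite !scale1r addr0 opprD addrA subrr add0r.
have E1 := sn_memZ Em a (SE _ Du); have E0 := SE _ D0.
have Sau : m (S (a *: u) - a *: S u) = 0.
  apply/eqP; rewrite eq_le (sn_ge0 Em) ?andbT; last exact: (sn_memB Em (SE _ DZ)).
  apply: (le_trans (sn_tri Em (SE _ DZ) E1 (sn_memD Em E1 E0))).
  by have := Sl a _ _ Du D0; rewrite addr0 => ->; rewrite add0r addrC addKr S0.
rewrite -(snZ Em a (SE _ Du)); apply/eqP; rewrite eq_le; apply/andP; split.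
  by have := sn_le Em (SE _ DZ) E1; rewrite Sau add0r.
by have := sn_le Em E1 (SE _ DZ); rewrite (snC Em E1 (SE _ DZ)) Sau add0r.
Qed.

(** Normalization gives the bound, except on null vectors; there the known bound [M] already forces
    the value 0. *)
Lemma oper_unit_ball (M k : R) (S : V -> V) u : oper D n E m M S ->
  (forall v, D v -> n v <= 1 -> m (S v) <= k) -> D u -> m (S u) <= k * n u.
Proof.
move=> SM h Du; have nu0 := sn_ge0 Dn Du; have [SE _ Sb] := SM.
have [u0|u0] := eqVneq (n u) 0.
  by rewrite u0 mulr0; have := Sb _ Du; rewrite u0 mulr0.
have u1 : 0 < n u by rewrite lt_def u0.
have := h _ (sn_memZ Dn (n u)^-1 Du); rewrite (snZ Dn)// (oper_scale _ SM)//.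
rewrite ger0_norm ?invr_ge0// mulVf// => /(_ (lexx _)).
by rewrite mulrC ler_pdivrMr.
Qed.

Lemma oper_diff (M M' : R) (S S' : V -> V) :
  oper D n E m M S -> oper D n E m M' S' ->
  oper D n E m (M + M') (fun u => S u - S' u).
Proof.
move=> [SE Sl Sb] [SE' Sl' Sb']; split=> [u Du|a u v Du Dv|u Du].
- by apply: (sn_memB Em); [exact: SE|exact: SE'].
- have Dz : D (a *: u + v) by case: Dn => _ + _ _; exact.
  have E1 : E (a *: S u + S v) by case: Em => _ + _ _; apply; exact: SE.
  have E2 : E (a *: S' u + S' v) by case: Em => _ + _ _; apply; exact: SE'.
  rewrite (_ : _ - _ = (S (a *: u + v) - (a *: S u + S v)) -
      (S' (a *: u + v) - (a *: S' u + S' v))); last first.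
    rewrite scalerBr (addrACA (a *: S u)) -opprD (opprB (a *: S u + S v)).
    rewrite (opprB (S' _)) [LHS]addrACA [RHS]addrACA; congr (_ + _).
    by rewrite addrC.
  have B1 := sn_memB Em (SE _ Dz) E1; have B2 := sn_memB Em (SE' _ Dz) E2.
  apply/eqP; rewrite eq_le (sn_ge0 Em) ?andbT; last exact: (sn_memB Em).
  apply: (le_trans (snD Em B1 (sn_memN Em B2))); rewrite (snN Em)//.
  by rewrite Sl// Sl'// addr0.
- apply: (le_trans (snD Em (SE _ Du) (sn_memN Em (SE' _ Du)))).
  by rewrite (snN Em) ?mulrDl ?lerD// ?Sb ?Sb'//; exact: SE'.
Qed.

(** On a null vector, use that all its multiples lie in the unit ball. *)
Lemma oper_of_unit_ball (k : R) (S : V -> V) :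
  (forall u, D u -> E (S u)) ->
  (forall a u v, D u -> D v -> m (S (a *: u + v) - (a *: S u + S v)) = 0) ->
  (forall v, D v -> n v <= 1 -> m (S v) <= k) -> oper D n E m k S.
Proof.
move=> SE Sl Sk; split=> // u Du.
have D0 := sn_mem0 Dn.
have S0 : m (S 0) = 0.
  by rewrite -(snN Em (SE _ D0)); have := Sl 1 _ _ D0 D0;
     rewrite !scale1r addr0 opprD addrA subrr add0r.
have scale a : `|a| * m (S u) <= m (S (a *: u)).
  have DZ := sn_memZ Dn a Du; have E0 := SE _ D0.
  have E1 := sn_memZ Em a (SE _ Du); have E2 := sn_memD Em E1 E0.
  rewrite -(snZ Em a (SE _ Du)).
  apply: (le_trans (sn_le Em E1 E2)).
  rewrite opprD addrA subrr add0r (snN Em)// S0 add0r.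
  apply: (le_trans (sn_le Em E2 (SE _ DZ))); rewrite (snC Em E2 (SE _ DZ)).
  by have := Sl a _ _ Du D0; rewrite addr0 => ->; rewrite add0r.
have nu0 := sn_ge0 Dn Du; have [u0|u0] := eqVneq (n u) 0.
  rewrite u0 mulr0; apply: (@ler_addeps _ _ _ k) => e e0; rewrite add0r.
  have := Sk _ (sn_memZ Dn e^-1 Du); rewrite (snZ Dn)// u0 mulr0 => /(_ ler01).
  move=> /(le_trans (scale _)); rewrite ger0_norm ?invr_ge0 ?(ltW e0)//.
  by rewrite mulrC ler_pdivrMr.
have u1 : 0 < n u by rewrite lt_def u0.
have := Sk _ (sn_memZ Dn (n u)^-1 Du); rewrite (snZ Dn)//.
rewrite ger0_norm ?invr_ge0// mulVf// => /(_ (lexx _)) /(le_trans (scale _)).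
by rewrite ger0_norm ?invr_ge0// mulrC ler_pdivrMr.
Qed.

End OperatorNorms.

(** * Finite sets of times as fine chains *)

Section Homogenization.
Context (R : realType) (d : nat) (N : riemannianManifold R d).
Implicit Types (A : {fset R}) (p q : R).

(** The point is strictly between [x] and [y], so that neighbouring points of [A] are at distance at
    most [dl]. *)
Definition mesh_le A (dl : R) : Prop := forall x y,
  x \in `[0, 1] -> y \in `[0, 1] -> x + dl < y -> exists2 z, z \in A & x < z < y.

Lemma mesh_le_ordered A dl b x y : mesh_le A dl -> x \in `[0, 1] ->
  y \in `[0, 1] -> ordered b x y -> dl < `|y - x| ->
  exists z, [/\ z \in A, ordered b x z, ordered b z y, z != x & z != y].
Proof.
move=> mA xI yI; case: b => /= xy.
  rewrite ger0_norm ?subr_ge0// => h; have [|z zA /andP[xz zy]] := mA x y xI yI.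
    by lra.
  by exists z; rewrite zA !ltW// gt_eqF// lt_eqF.
rewrite ler0_norm ?subr_le0// => h; have [|z zA /andP[xz zy]] := mA y x yI xI.
  by lra.
by exists z; rewrite zA !ltW// lt_eqF// gt_eqF.
Qed.

Lemma ordered_anti b (x y : R) : ordered b x y -> ordered b y x -> x = y.
Proof. by case: b => /= h1 h2; apply/eqP; rewrite eq_le h1 h2. Qed.

Lemma path_ordered_last b (p z : R) s : path (ordered b) p s -> z \in s ->
  ordered b z (last p s).
Proof.
move=> ps zs; case/splitPr: zs ps => s1 s2.
rewrite cat_path last_cat /= => /and3P[_ _ h].
elim: s2 z h => [|y s2 IH] z /=; first by rewrite ordered_refl.
by case/andP => zy /IH; exact: ordered_trans.
Qed.

Lemma path_ordered_head b (p z : R) s : path (ordered b) p s -> z \in s ->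
  ordered b p z.
Proof.
rewrite path_sortedE; last by move=> y x w; exact: ordered_trans.
by case/andP => /allP h _ /h.
Qed.

(** A step longer than [dl] would jump over a point of [A] that belongs to the chain. *)
Lemma path_step_mesh b dl A p s : mesh_le A dl -> p \in `[0, 1] ->
  (forall x, x \in s -> x \in `[0, 1]) -> path (ordered b) p s ->
  (forall z, z \in A -> z != p -> ordered b p z -> ordered b z (last p s) ->
     z \in s) ->
  path (step b dl) p s.
Proof.
move=> mA; elim: s p => [//|x s IH] p pI sI /=; case/andP=> px xs As.
have xI : x \in `[0, 1] by apply: sI; rewrite mem_head.
have xl : ordered b x (last x s).
  case: s xs {IH sI As} => [|y s] /= xs; first exact: ordered_refl.
  case/andP: xs => xy ys; apply: ordered_trans xy _.
  case: s ys => [|w s] ys /=; first exact: ordered_refl.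
  by have := path_ordered_head ys (mem_last _ _) .
apply/andP; split.
  rewrite /step px/= leNgt; apply/negP => far.
  have [z [zA pz zx zp zx']] := mesh_le_ordered mA pI xI px far.
  have := As z zA zp pz (ordered_trans zx xl).
  rewrite in_cons (negbTE zx')/= => zs.
  have xz := path_ordered_head xs zs.
  by rewrite (ordered_anti xz zx) eqxx in zx'.
apply: IH => // [y ys|z zA zx xz zl]; first by apply: sI; rewrite in_cons ys orbT.
have [zp|zp] := eqVneq z p.
  by rewrite -zp in px; rewrite (ordered_anti px xz) eqxx in zx.
have := As z zA zp (ordered_trans px xz) zl.
by rewrite in_cons (negbTE zx).
Qed.

Lemma compose_alongE (S : opfamily N) p s : compose_along S p s = along S p s.
Proof. by elim: s p => //= q s IH p; rewrite IH. Qed.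

Lemma homogenization_chain A (S : opfamily N) p q dl :
  [set` A] `<=` [set` `[(0 : R), 1]] -> mesh_le A dl -> p \in A -> q \in A ->
  exists b s, [/\ path (step b dl) p s, last p s = q,
    forall x, x \in s -> x \in A & homogenization A S p q = along S p s].
Proof.
move=> AI mA pA qA; pose b := p <= q.
(* Both branches of [homogenization] as a single filter; strictness at [p] becomes [x != p]. *)
pose s := [seq x <- sort (ordered b) (enum_fset A) |
  [&& x != p, ordered b p x & ordered b x q]].
have sE : homogenization A S p q = along S p s.
  rewrite /homogenization -compose_alongE /s /b; case: ifPn => pq.
    congr (compose_along _ _ _); apply: eq_filter => x /=.
    by rewrite lt_def andbA.
  congr (compose_along _ _ _); apply: eq_filter => x /=.
  by rewrite lt_def (eq_sym p) andbCA [(q <= x) && _]andbC.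
have sA x : x \in s -> x \in A by rewrite mem_filter mem_sort => /andP[_].
have bt : transitive (ordered b : rel R) by move=> y x z; exact: ordered_trans.
have ps : path (ordered b) p s.
  rewrite path_sortedE//; apply/andP; split.
    by apply/allP => x; rewrite mem_filter => /andP[/and3P[]].
  by apply: sorted_filter => //; apply: sort_sorted; exact: ordered_total.
have qps : (q == p) || (q \in s).
  have [//|qp] := eqVneq q p; rewrite /= mem_filter mem_sort qp qA andbT/=.
  rewrite ordered_refl andbT /b /ordered; case: leP => //.
  by move/ltW.
have lq : last p s = q.
  have lqo : ordered b (last p s) q.
    have := mem_last p s; rewrite in_cons => /orP[/eqP ->|].
      by rewrite /b /ordered; case: leP => // /ltW.
    by rewrite mem_filter => /andP[/and3P[]].
  have ql : ordered b q (last p s).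
    case/orP: qps => [/eqP ->|qs]; last exact: path_ordered_last.
    have := mem_last p s; rewrite in_cons => /orP[/eqP ->|]; first exact: ordered_refl.
    exact: path_ordered_head.
  exact: ordered_anti lqo ql.
exists b, s; split=> //; apply: (path_step_mesh mA) => // [|x /sA /AI//|z zA zp pz].
  exact: AI.
by rewrite lq => zq; rewrite mem_filter mem_sort zp pz zq.
Qed.

(** For uses where a chain is needed but not its fineness. *)
Lemma mesh_le1 A : mesh_le A 1.
Proof. by move=> x y; rewrite !in_itv/=; lra. Qed.

Lemma dense_exhaustion_sub (Ak : nat -> {fset R}) k k' : dense_exhaustion Ak ->
  (k <= k')%N -> [set` Ak k] `<=` [set` Ak k'].
Proof.
move=> [_ AS _]; elim: k' => [|k' IH]; first by rewrite leqn0 => /eqP ->.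
rewrite leq_eqVlt => /orP[/eqP ->//|]; rewrite ltnS => /IH h.
exact: subset_trans (AS k').
Qed.

(** Cut [[0, 1]] into [M] equal cells of length at most [dl / 2]. By density each contains a point
    of some [Ak k], and an interval longer than [dl] contains a whole cell. *)
Lemma dense_exhaustion_mesh (Ak : nat -> {fset R}) (dl : R) :
  dense_exhaustion Ak -> 0 < dl ->
  exists k0, forall k, (k0 <= k)%N -> mesh_le (Ak k) dl.
Proof.
move=> dA dl0; have [AI _ Ad] := dA.
pose M := (Num.bound (2 / dl)).+1.
have M0 : 0 < M%:R :> R by rewrite ltr0n.
have Mdl : 2 / M%:R <= dl.
  rewrite ler_pdivrMr// mulrC -ler_pdivrMr//.
  apply: (le_trans (ltW (archi_boundP _))); first by rewrite divr_ge0// ltW.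
  by rewrite ler_nat leqnSn.
have pt (j : nat) : exists k, (j < M)%N ->
    exists2 z, z \in Ak k & j%:R / M%:R < z < j.+1%:R / M%:R.
  have [jM|_] := boolP (j < M)%N; last by exists 0%N.
  pose x : R := (j%:R + 2^-1) / M%:R.
  have xI : [set` `[(0 : R), 1]] x.
    rewrite /= in_itv/= divr_ge0 ?ler_pdivrMr ?mul1r ?addr_ge0//=; last exact: ltW.
    have : j.+1%:R <= M%:R :> R by rewrite ler_nat.
    have -> : j.+1%:R = j%:R + 1 :> R by rewrite natr1.
    lra.
  have r0 : 0 < 2^-1 / M%:R :> R by rewrite divr_gt0.
  have [z [[k _ zk] bz]] := Ad x xI _ (nbhsx_ballx x _ r0).
  exists k => _; exists z => //; move: bz; rewrite -ball_normE /= ltr_norml.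
  have -> : j.+1%:R = j%:R + 1 :> R by rewrite natr1.
  rewrite /x !mulrDl; lra.
pose kk j := sval (cid (pt j)).
have kkP j : (j < M)%N ->
    exists2 z, z \in Ak (kk j) & j%:R / M%:R < z < j.+1%:R / M%:R.
  by rewrite /kk; case: cid.
exists (\sum_(j < M) kk j)%N => k kM x y xI yI xy.
(* The first cell lying to the right of [x]; in the cell of [x] itself the known point could precede
   [x]. *)
pose j := (Num.trunc (x * M%:R)).+1.
have x0' : 0 <= x by move: xI; rewrite in_itv/= => /andP[].
have x0 := mulr_ge0 x0' (ltW M0).
have /andP[j1 j2] := truncn_itv x0.
have xj : x < j%:R / M%:R by rewrite ltr_pdivlMr.
have jy : j.+1%:R / M%:R < y.
  apply: le_lt_trans xy; apply: (@le_trans _ _ (x + 2 / M%:R)); last by rewrite lerD2l.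
  rewrite ler_pdivrMr// mulrDl divfK ?gt_eqF//.
  have -> : j.+1%:R = (Num.trunc (x * M%:R))%:R + 2 :> R by rewrite /j -addn2 natrD.
  lra.
have jM : (j < M)%N.
  rewrite -(ltr_nat R); have : y <= 1 by move: yI; rewrite in_itv/= => /andP[].
  move=> /(lt_le_trans jy); rewrite ltr_pdivrMr// mul1r; apply: lt_trans.
  by rewrite ltr_nat.
have [z zA /andP[z1 z2]] := kkP j jM.
exists z; last by rewrite (lt_trans xj z1) (lt_trans z2 jy).
apply: (dense_exhaustion_sub dA _ zA); apply: leq_trans kM.
by rewrite (bigD1 (Ordinal jM))//= leq_addr.
Qed.

(** Independence of the exhaustion would be vacuous without this: any two times belong to a common
    one, made of [p], [q] and the fractions with bounded denominator. *)
Lemma dense_exhaustion_ex p q : p \in `[0, 1] -> q \in `[0, 1] ->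
  exists Ak : nat -> {fset R}, dense_exhaustion Ak /\
    exists k, p \in Ak k /\ q \in Ak k.
Proof.
move=> pI qI.
pose s k : seq R := [:: p; q] ++ [seq i%:R / j.+1%:R | j <- iota 0 k, i <- iota 0 j.+2].
have sP k x : reflect (x = p \/ x = q \/ exists i j : nat,
    [/\ (j < k)%N, (i <= j.+1)%N & x = i%:R / j.+1%:R]) (x \in s k).
  rewrite mem_cat !inE; apply: (iffP orP) => [[/orP[/eqP|/eqP]|]|].
  - by left.
  - by right; left.
  - move=> /allpairsPdep[j [i [+ + ->]]]; rewrite !mem_iota !add0n /= => jk ij.
    by right; right; exists i, j.
  - move=> [->|[->|[i [j [jk ij ->]]]]]; rewrite ?eqxx ?orbT; [by left..|right].
    by apply/allpairsPdep; exists j, i; rewrite !mem_iota !add0n.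
exists (fun k => [fset x in s k]%fset); split; last first.
  by exists 0%N; rewrite !inE !eqxx ?orbT.
split.
- move=> k x; rewrite /= in_fset => /sP h; suff : x \in `[0, 1] by [].
  case: h => [->//|[->//|[i [j [_ ij ->]]]]].
  rewrite in_itv/= divr_ge0//= ler_pdivrMr ?ltr0n// mul1r ler_nat.
  by [].
- move=> k x; rewrite /= 2!in_fset => /sP h; apply/sP.
  case: h => [->|[->|[i [j [jk ij ->]]]]]; [by left|by right; left|right; right].
  by exists i, j; split=> //; rewrite ltnS ltnW.
- move=> x xI B /nbhs_ballP[r /= r0 rB].
  have x0 : 0 <= x by move: xI; rewrite /= in_itv/= => /andP[].
  have x1 : x <= 1 by move: xI; rewrite /= in_itv/= => /andP[].
  pose j := Num.bound r^-1; pose M : R := j.+1%:R.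
  have M0 : 0 < M by rewrite /M ltr0n.
  have Mr : M^-1 < r.
    rewrite invf_plt ?posrE//; apply: (lt_le_trans (archi_boundP _)).
      by rewrite invr_ge0 ltW.
    by rewrite /M ler_nat.
  pose i := Num.trunc (x * M).
  have xM : 0 <= x * M by rewrite mulr_ge0// ltW.
  have /andP[i1 i2] := truncn_itv xM.
  exists (i%:R / M); split.
    exists j.+1 => //=; rewrite in_fset; apply/sP; right; right; exists i, j; split=> //.
    rewrite -(ler_nat R); apply: (le_trans i1); rewrite -[leRHS]mul1r.
    by rewrite ler_wpM2r// ltW.
  apply: rB; rewrite -ball_normE /= ger0_norm ?subr_ge0 ?ler_pdivrMr//.
  apply: lt_trans Mr; rewrite -(@ltr_pM2r _ M)// mulrBl mulVf ?gt_eqF//.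
  have -> : i%:R / M * M = i%:R by rewrite divfK// gt_eqF.
  move: i2; rewrite -/i; have -> : i.+1%:R = i%:R + 1 :> R by rewrite natr1.
  lra.
Qed.

End Homogenization.

(** * Defect of functoriality *)

Section SecondOrder.
Context (R : realType) (d : nat) (N : riemannianManifold R d).
Hypothesis cN : compact [set: N].
Variables (mu : R -> probability (borel N) R) (Pi : probability (segments N) R).
Variables (phi : R -> R -> borel N -> borel N) (C : R).
Implicit Types (V W U : vfield N) (s t p q r : R).
Hypothesis mu_geo : wasserstein_geodesic mu.
Hypothesis muPi : forall t (B : set (borel N)), t \in `[0, 1] -> measurable B ->
  mu t B = Pi (ev t @^-1` B).
Hypothesis ParT_unitary : forall s t, s \in `[0, 1] -> t \in `[0, 1] ->
  unitary_operator (mu s) (mu t) (L2 (mu s)) (L2 (mu t)) (ParT mu Pi s t).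
Hypothesis pushN : forall s t, s \in `[0, 1] -> t \in `[0, 1] ->
  push_normal mu phi s t.
Hypothesis push_close : forall s t, s \in `[0, 1] -> t \in `[0, 1] ->
  (opnorm (mu s) (mu t) (Wnormal_space (mu s))
     (fun V => Push mu phi s t V - ParT mu Pi s t V)%R
   <= C%:E * wasserstein (mu s) (mu t))%E.

Let w01 := fine (wasserstein (mu 0) (mu 1)).
(** The absolute value makes the rate nonnegative whatever the sign of [C]. *)
Let c := `|C| * w01.
Let T := projT mu Pi.

Lemma wasserstein_ge0 (m1 m2 : probability (borel N) R) :
  (0 <= wasserstein m1 m2)%E.
Proof. exact: poweR_ge0. Qed.

Lemma push_rate_ge0 : 0 <= c.
Proof. by rewrite mulr_ge0// fine_ge0// wasserstein_ge0. Qed.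

Lemma push_sub_le s t V : s \in `[0, 1] -> t \in `[0, 1] ->
  Wnormal_space (mu s) V -> L2norm (mu s) V <= 1 ->
  L2norm (mu t) (Push mu phi s t V - ParT mu Pi s t V) <= c * `|t - s|.
Proof.
move=> sI tI NV V1; rewrite -lee_fin.
have le1 : ((L2norm (mu t) (Push mu phi s t V - ParT mu Pi s t V))%:E <=
    C%:E * wasserstein (mu s) (mu t))%E.
  by apply: le_trans (push_close sI tI); apply: ereal_sup_ubound; exists V.
apply: (le_trans le1); have [fin geo] := mu_geo.
have wfin : wasserstein (mu 0) (mu 1) = w01%:E.
  by rewrite /w01 fineK// ge0_fin_numE// wasserstein_ge0.
rewrite geo// wfin -!EFinM lee_fin /c (distrC t s).
rewrite [X in _ <= X]mulrAC mulrA ler_wpM2r//.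
  by rewrite /w01 fine_ge0// wasserstein_ge0.
by rewrite ler_wpM2r// ler_norm.
Qed.

(** [Push] maps normal fields to normal ones, so that the tangent component of
    [ParT] on normal fields comes from the difference. *)
Lemma ParT_normal_tangent s t W U : s \in `[0, 1] -> t \in `[0, 1] ->
  Wnormal_space (mu s) W -> Wtangent_space (mu t) U ->
  `|L2dot (mu t) (ParT mu Pi s t W) U| <=
    c * `|t - s| * L2norm (mu s) W * L2norm (mu t) U.
Proof.
move=> sI tI NW TU.
have LU := Wtangent_L2 TU; have LW := Wnormal_L2 NW.
have Lt := L2_seminormed cN (mu t); have si := L2dot_semi_inner cN (mu t).
have Ls := L2_seminormed cN (mu s).
have Po := ParT_oper cN ParT_unitary sI tI.
have PL V : L2 (mu s) V -> L2 (mu t) (ParT mu Pi s t V).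
  exact: (ParT_L2 ParT_unitary).
(* [opnorm] controls the unit ball only, so [W] is normalized; null fields are set apart. *)
have [W0|W0] := eqVneq (L2norm (mu s) W) 0.
  rewrite W0 mulr0 mul0r normr_le0; apply/eqP.
  apply: (dot_null si (PL _ LW) LU).
  by rewrite -[LHS]/(L2norm _ _) (ParT_norm ParT_unitary).
have Wp : 0 < L2norm (mu s) W by rewrite lt_def W0 L2norm_ge0.
pose a := (L2norm (mu s) W)^-1; pose W1 := a *: W.
have NW1 : Wnormal_space (mu s) W1.
  have [N0 Nl] := Wnormal_subspace cN (mu s).
  by have := Nl a _ _ NW N0; rewrite addr0.
have LW1 := Wnormal_L2 NW1.
have nW1 : L2norm (mu s) W1 <= 1.
  by rewrite (snZ Ls)// ger0_norm ?invr_ge0 ?L2norm_ge0// mulVf.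
have [_ pN _] := pushN sI tI; have NP := pN _ NW1; have LP := Wnormal_L2 NP.
have P0 : L2dot (mu t) (Push mu phi s t W1) U = 0.
  by rewrite (siC si)//; case: TU => _; apply.
have h1 : `|L2dot (mu t) (ParT mu Pi s t W1) U| <= c * `|t - s| * L2norm (mu t) U.
  rewrite -normrN -[X in `|X|]add0r -P0 -(siBl si)//; last exact: PL.
  apply: (le_trans (cauchy_schwarz si (sn_memB Lt LP (PL _ LW1)) LU)).
  apply: ler_wpM2r; first exact: L2norm_ge0.
  exact: push_sub_le.
have e : L2dot (mu t) (ParT mu Pi s t W1) U = a * L2dot (mu t) (ParT mu Pi s t W) U.
  have [_ lin _] := Po.
  have Z0 : L2 (mu s) 0 by exact: (sn_mem0 Ls).
  have LZ := sn_memZ Lt a (PL _ LW).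
  have nul : L2norm (mu t) (ParT mu Pi s t W1 - a *: ParT mu Pi s t W) = 0.
    have P00 : L2norm (mu t) (ParT mu Pi s t 0) = 0.
      by rewrite (ParT_norm ParT_unitary)// (sn0 Ls).
    have LPW1 := PL _ LW1; have LP0 := PL _ Z0.
    apply/eqP; rewrite eq_le (sn_ge0 Lt (sn_memB Lt LPW1 LZ)) andbT.
    apply: (le_trans (sn_tri Lt LPW1 LZ (sn_memD Lt LZ LP0))).
    by have := lin a _ _ LW Z0; rewrite addr0 => ->; rewrite add0r addrC addKr P00.
  have := dot_null si (sn_memB Lt (PL _ LW1) LZ) LU nul.
  by rewrite (siBl si (PL _ LW1) LZ LU) (siZl si _ (PL _ LW) LU) => /subr0_eq.
move: h1; rewrite e normrM ger0_norm ?invr_ge0 ?L2norm_ge0//.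
by rewrite /a mulrC ler_pdivrMr// [X in _ <= X]mulrAC.
Qed.

Lemma T_oper p q : p \in `[0, 1] -> q \in `[0, 1] ->
  oper (Wtangent_space (mu p)) (L2norm (mu p))
       (Wtangent_space (mu q)) (L2norm (mu q)) 1 (T p q).
Proof.
move=> pI qI; rewrite -[1](mulr1 1).
have [PL Pl Pb] := ParT_oper cN ParT_unitary pI qI.
have PT : oper (Wtangent_space (mu p)) (L2norm (mu p)) (L2 (mu q))
    (L2norm (mu q)) 1 (ParT mu Pi p q).
  by split=> [V /Wtangent_L2|a V W /Wtangent_L2 + /Wtangent_L2|V /Wtangent_L2];
    [exact: PL|exact: Pl|exact: Pb].
exact: (oper_comp (Wtangent_seminormed cN (mu p)) (L2_seminormed cN (mu q))
  (Wtangent_seminormed cN (mu q)) ler01 PT (proj_tangent_oper cN (mu q))).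
Qed.

Lemma T_id p V : p \in `[0, 1] -> Wtangent_space (mu p) V ->
  L2norm (mu p) (T p p V - V) = 0.
Proof.
move=> pI TV; have LV := Wtangent_L2 TV; have Tn := Wtangent_seminormed cN (mu p).
have LP := ParT_L2 ParT_unitary pI pI LV.
have TP := proj_tangent_mem cN LP; have TPV := proj_tangent_mem cN LV.
change (L2norm (mu p) (proj_tangent (mu p) (ParT mu Pi p p V) - V) = 0).
have Ln := L2_seminormed cN (mu p).
have z := ParT_id cN muPi ParT_unitary pI LV.
have z1 := oper_null Ln Tn (proj_tangent_oper cN (mu p)) LP LV z.
have z2 := proj_tangent_id cN TV.
have z3 := sn_tri Tn TP TV TPV.
rewrite z1 z2 addr0 in z3.
by apply/eqP; rewrite eq_le z3 (sn_ge0 Tn (sn_memB Tn TP TV)).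
Qed.

Lemma T_comp p q r V : p \in `[0, 1] -> q \in `[0, 1] -> r \in `[0, 1] ->
  Wtangent_space (mu p) V ->
  L2norm (mu r) (T q r (T p q V) - T p r V) <=
    c ^+ 2 * `|q - p| * `|r - q| * L2norm (mu p) V.
Proof.
move=> pI qI rI TV; have LV := Wtangent_L2 TV; have c0 := push_rate_ge0.
have Lr := L2_seminormed cN (mu r); have Lq := L2_seminormed cN (mu q).
have Tr := Wtangent_seminormed cN (mu r).
have sq := L2dot_semi_inner cN (mu q); have sr := L2dot_semi_inner cN (mu r).
pose A := ParT mu Pi p q V; pose PA := proj_tangent (mu q) A; pose B := A - PA.
have LA : L2 (mu q) A by exact: (ParT_L2 ParT_unitary).
have TPA : Wtangent_space (mu q) PA by exact: proj_tangent_mem.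
have LPA := Wtangent_L2 TPA.
have NB : Wnormal_space (mu q) B by exact: proj_tangent_residual.
have LB := Wnormal_L2 NB.
(* The way in: by orthogonality and adjunction, [|B|^2] is the product of [V] with the transport of
   [B] back to [p], where [B] is normal and [V] tangent. Dividing by [|B|] leaves the rate. *)
have nB : L2norm (mu q) B <= c * `|q - p| * L2norm (mu p) V.
  have e : L2norm (mu q) B ^+ 2 = L2dot (mu p) V (ParT mu Pi q p B).
    rewrite -(ParT_adjoint cN muPi ParT_unitary)//.
    rewrite [L2norm _ _ ^+ 2](sqr_inorm sq LB) {1}/B (siBl sq)//.
    by have [_ /(_ _ NB) ->] := TPA; rewrite subr0.
  have := ParT_normal_tangent qI pI NB TV.
  have LPB : L2 (mu p) (ParT mu Pi q p B) by exact: (ParT_L2 ParT_unitary).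
  rewrite (siC (L2dot_semi_inner cN (mu p)) LPB LV) -e ger0_norm ?sqr_ge0//.
  rewrite (distrC p q); have := L2norm_ge0 (mu q) B.
  rewrite le_eqVlt => /orP[/eqP <- _|n0].
    exact: mulr_ge0 (mulr_ge0 c0 (normr_ge0 _)) (L2norm_ge0 _ _).
  by rewrite expr2 [X in _ <= X]mulrAC ler_pM2r.
have PL W : L2 (mu q) W -> L2 (mu r) (ParT mu Pi q r W).
  exact: (ParT_L2 ParT_unitary).
have LPr : L2 (mu r) (ParT mu Pi p r V) by exact: (ParT_L2 ParT_unitary).
have LD := sn_memB Lr (PL _ LPA) LPr.
have [pT pl _] := proj_tangent_oper cN (mu r).
have T1 := pT _ (PL _ LPA); have T2 := pT _ LPr; have T3 := pT _ LD.
have k0 : 0 <= c * `|r - q| * L2norm (mu q) B.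
  exact: mulr_ge0 (mulr_ge0 c0 (normr_ge0 _)) (L2norm_ge0 _ _).
(* The way out: by functoriality the difference is, up to a null field, minus the transport of [B]
   from [q] to [r], and its projection is tested against tangent fields. *)
have main : L2norm (mu r) (proj_tangent (mu r)
    (ParT mu Pi q r PA - ParT mu Pi p r V)) <= c * `|r - q| * L2norm (mu q) B.
  apply: (proj_tangent_le cN) => // U TU; have LU := Wtangent_L2 TU.
  have e : L2dot (mu r) (ParT mu Pi q r PA - ParT mu Pi p r V) U =
      - L2dot (mu r) (ParT mu Pi q r B) U.
    have LAr := PL _ LA; have LBr := PL _ LB.
    have [_ ql _] := ParT_oper cN ParT_unitary qI rI.
    have n1 : L2norm (mu r) (ParT mu Pi q r A - (ParT mu Pi q r B + ParT mu Pi q r PA)) = 0.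
      by have := ql 1 _ _ LB LPA; rewrite !scale1r subrK.
    have n2 := ParT_trans cN muPi ParT_unitary pI qI rI LV.
    have LS := sn_memD Lr LBr (PL _ LPA).
    have d1 := dot_null sr (sn_memB Lr LAr LS) LU n1.
    have d2 := dot_null sr (sn_memB Lr LAr LPr) LU n2.
    have LPAr := PL _ LPA.
    rewrite (siBl sr LAr LS LU) (siDl sr LBr LPAr LU) in d1.
    rewrite (siBl sr LAr LPr LU) in d2; rewrite (siBl sr LPAr LPr LU).
    have := subr0_eq d1; have := subr0_eq d2 => <- ->.
    by rewrite opprD addrCA subrr addr0.
  rewrite e; apply: (le_trans (ler_norm _)); rewrite normrN.
  exact: ParT_normal_tangent.
have null : L2norm (mu r) (proj_tangent (mu r) (ParT mu Pi q r PA) -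
    proj_tangent (mu r) (ParT mu Pi p r V)) <=
    L2norm (mu r) (proj_tangent (mu r) (ParT mu Pi q r PA - ParT mu Pi p r V)).
  have := pl 1 _ _ LD LPr; rewrite !scale1r subrK => n1.
  exact: (sn_le_remainder Tr T1 T2 T3 n1).
apply: (le_trans null); apply: (le_trans main).
rewrite (_ : c ^+ 2 * _ * _ * _ = c * `|r - q| * (c * `|q - p| * L2norm (mu p) V)).
  exact: ler_wpM2l (mulr_ge0 c0 (normr_ge0 _)) _ _ nB.
by ring.
Qed.

End SecondOrder.

(** * Operator norms between tangent spaces *)

Section TangentOperators.
Context (R : realType) (d : nat) (N : riemannianManifold R d).
Hypothesis cN : compact [set: N].
Variable mu : R -> probability (borel N) R.
Implicit Types (V W : vfield N) (S : vfield N -> vfield N) (p q : R).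

Definition tangent_oper p q (M : R) S : Prop :=
  oper (Wtangent_space (mu p)) (L2norm (mu p))
       (Wtangent_space (mu q)) (L2norm (mu q)) M S.

Let sn p := Wtangent_seminormed cN (mu p).

Lemma tangent_sub_eq0 p V W : Wtangent_space (mu p) V -> Wtangent_space (mu p) W ->
  L2norm (mu p) (V - W) = 0 <-> {ae mu p, forall x, V x = W x}.
Proof. by move=> TV TW; apply: (L2norm_sub_eq0 cN); exact: Wtangent_L2. Qed.

Lemma oper_tangent_operator p q M S : tangent_oper p q M S -> tangent_operator mu p q S.
Proof.
move=> SM; have [SE Sl Sb] := SM; split=> //.
- move=> a V W TV TW.
  have TVW := sn_memD (sn p) (sn_memZ (sn p) a TV) TW.
  have TS := sn_memD (sn q) (sn_memZ (sn q) a (SE _ TV)) (SE _ TW).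
  exact: (proj1 (tangent_sub_eq0 (SE _ TVW) TS) (Sl a V W TV TW)).
- apply: (@le_lt_trans _ _ `|M|%:E); last exact: ltry.
  apply: ge_ereal_sup => _ [V [TV V1] <-]; rewrite lee_fin.
  apply: (le_trans (Sb V TV)); apply: (@le_trans _ _ (`|M| * L2norm (mu p) V)).
    by apply: ler_wpM2r; [exact: L2norm_ge0|exact: ler_norm].
  by rewrite ler_piMr.
Qed.

Lemma opnorm_ge0 p q S : (0 <= tangent_opnorm mu p q S)%E.
Proof.
apply: (@le_trans _ _ (L2norm (mu q) (S 0))%:E).
  by rewrite lee_fin; exact: L2norm_ge0.
apply: ereal_sup_ubound; exists 0 => //; split; first exact: (sn_mem0 (sn p)).
by rewrite (sn0 (sn p)).
Qed.

Lemma opnorm_ub p q S (k : R) V : (tangent_opnorm mu p q S <= k%:E)%E ->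
  Wtangent_space (mu p) V -> L2norm (mu p) V <= 1 -> L2norm (mu q) (S V) <= k.
Proof.
move=> Sk TV V1; rewrite -lee_fin; apply: le_trans Sk.
by apply: ereal_sup_ubound; exists V.
Qed.

Lemma tangent_operator_oper p q S : tangent_operator mu p q S ->
  exists M, tangent_oper p q M S.
Proof.
move=> [SE Sl Sf]; have S0 := opnorm_ge0 p q S.
exists (fine (tangent_opnorm mu p q S)).
have Sfin : tangent_opnorm mu p q S = (fine (tangent_opnorm mu p q S))%:E.
  by rewrite fineK// ge0_fin_numE.
apply: (oper_of_unit_ball (sn p) (sn q) SE).
- move=> a V W TV TW.
  have TVW := sn_memD (sn p) (sn_memZ (sn p) a TV) TW.
  have TS := sn_memD (sn q) (sn_memZ (sn q) a (SE _ TV)) (SE _ TW).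
  exact: (proj2 (tangent_sub_eq0 (SE _ TVW) TS) (Sl a V W TV TW)).
- by move=> V TV V1; apply: (opnorm_ub _ TV V1); rewrite -Sfin.
Qed.

Lemma opnorm_le p q S (k : R) : 0 <= k ->
  (forall V, Wtangent_space (mu p) V -> L2norm (mu q) (S V) <= k * L2norm (mu p) V) ->
  (tangent_opnorm mu p q S <= k%:E)%E.
Proof.
move=> k0 Sk; apply: ge_ereal_sup => _ [V [TV V1] <-]; rewrite lee_fin.
by apply: (le_trans (Sk V TV)); rewrite ler_piMr.
Qed.

Lemma opnorm_sub_le p q M M' S S' (k : R) V :
  tangent_oper p q M S -> tangent_oper p q M' S' ->
  (tangent_opnorm mu p q (fun V => S V - S' V)%R <= k%:E)%E ->
  Wtangent_space (mu p) V ->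
  L2norm (mu q) (S V - S' V) <= k * L2norm (mu p) V.
Proof.
move=> SM SM' Sk TV.
have SB := oper_diff (sn p) (sn q) SM SM'.
apply: (oper_unit_ball (sn p) (sn q) SB _ TV) => W TW W1.
exact: (opnorm_ub Sk TW W1).
Qed.

(** By polarization at [V + W]; [S] is additive only up to a null field, which norms do not see. *)
Lemma tangent_isometry_dot p q M S : tangent_oper p q M S ->
  (forall V, Wtangent_space (mu p) V -> L2norm (mu q) (S V) = L2norm (mu p) V) ->
  forall V W, Wtangent_space (mu p) V -> Wtangent_space (mu p) W ->
  L2dot (mu q) (S V) (S W) = L2dot (mu p) V W.
Proof.
move=> [SE Sl _] Si V W TV TW.
have sip := L2dot_semi_inner cN (mu p); have siq := L2dot_semi_inner cN (mu q).
have TVW := sn_memD (sn p) TV TW; have TS := sn_memD (sn q) (SE _ TV) (SE _ TW).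
have LV := Wtangent_L2 TV; have LW := Wtangent_L2 TW.
have LSV := Wtangent_L2 (SE _ TV); have LSW := Wtangent_L2 (SE _ TW).
have sq p' U : L2 (mu p') U -> L2dot (mu p') U U = L2norm (mu p') U ^+ 2.
  by move=> LU; rewrite [L2norm _ _](_ : _ = inorm (L2dot (mu p')) U)//
     (sqr_inorm (L2dot_semi_inner cN (mu p')) LU).
have z : L2norm (mu q) (S (V + W) - (S V + S W)) = 0.
  by have := Sl 1 V W TV TW; rewrite !scale1r.
have e : L2norm (mu q) (S V + S W) = L2norm (mu p) (V + W).
  rewrite -(Si _ TVW); apply/eqP; rewrite eq_le; apply/andP; split.
    by have := sn_le (sn q) TS (SE _ TVW); rewrite (snC (sn q) TS (SE _ TVW)) z add0r.
  by have := sn_le (sn q) (SE _ TVW) TS; rewrite z add0r.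
have e1 := si_sqrD sip LV LW; have e2 := si_sqrD siq LSV LSW.
rewrite (sq _ _ (Wtangent_L2 TVW)) (sq _ _ LV) (sq _ _ LW) in e1.
rewrite (sq _ _ (Wtangent_L2 TS)) (sq _ _ LSV) (sq _ _ LSW) e (Si _ TV) (Si _ TW) e1 in e2.
move: e2; move: (L2dot _ _ _) (L2dot _ _ _) (L2norm _ _) (L2norm _ _) => x y a b.
lra.
Qed.

End TangentOperators.

Lemma cvge0_le (R : realType) (u : nat -> \bar R) :
  (forall e : R, 0 < e -> \forall k \near \oo, (0 <= u k <= e%:E)%E) ->
  u k @[k --> \oo] --> 0%E.
Proof.
move=> ue.
have fin (x : \bar R) (e : R) : (0 <= x <= e%:E)%E -> x \is a fin_num.
  by move=> /andP[x0 xe]; rewrite ge0_fin_numE//; exact: le_lt_trans xe (ltry _).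
apply/fine_cvgP; split.
  by apply: filterS (ue 1 ltr01) => k; exact: fin.
apply/cvgrPdist_le => e e0; apply: filterS (ue e e0) => k uk.
case/andP: (uk) => u0 ul; rewrite sub0r normrN ger0_norm ?fine_ge0//=.
by rewrite -lee_fin fineK//; exact: fin uk.
Qed.

Lemma sqr_littleo_id (R : realType) (K : R) :
  (fun t : R => K * t ^+ 2) =o_ (0^'+) id.
Proof.
apply/eqoP => e e0; near=> t.
have t0 : 0 < t by [].
rewrite normrM (ger0_norm (sqr_ge0 t)) expr2 mulrA (ger0_norm (ltW t0)).
apply: ler_wpM2r; first exact: ltW.
have : t <= e / (`|K| + 1) by near: t; apply: nbhs_right_le; rewrite divr_gt0// ltr_wpDl.
rewrite ler_pdivlMr ?ltr_wpDl// => /(le_trans _); apply.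
by rewrite mulrC; apply: ler_wpM2l; [exact: ltW|rewrite lerDl].
Unshelve. all: by end_near.
Qed.

(** * The limit family on the tangent spaces *)

Section TangentSewing.
Context (R : realType) (d : nat) (N : riemannianManifold R d).
Hypothesis cN : compact [set: N].
Variables (mu : R -> probability (borel N) R) (T : opfamily N) (K : R).
Implicit Types (V W : vfield N) (p q r dl : R) (Ak Bk : nat -> {fset R}).
Hypothesis K0 : 0 <= K.
Hypothesis Top : forall p q, p \in `[0, 1] -> q \in `[0, 1] ->
  tangent_oper mu p q 1 (T p q).
Hypothesis Tid : forall p V, p \in `[0, 1] -> Wtangent_space (mu p) V ->
  L2norm (mu p) (T p p V - V) = 0.
Hypothesis Tcomp : forall p q r V, p \in `[0, 1] -> q \in `[0, 1] ->
  r \in `[0, 1] -> Wtangent_space (mu p) V ->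
  L2norm (mu r) (T q r (T p q V) - T p r V) <=
    K * `|q - p| * `|r - q| * L2norm (mu p) V.

Let D p := Wtangent_space (mu p).
Let n p := L2norm (mu p).
Let Dn p : p \in `[0, 1] -> seminormed (D p) (n p).
Proof. by move=> _; exact: Wtangent_seminormed. Qed.
Let Dcomplete p : p \in `[0, 1] -> complete_seminormed (D p) (n p).
Proof. by move=> _; exact: Wtangent_complete. Qed.

Definition tangent_sew : opfamily N := sew D n K T.
Let S := tangent_sew.

Lemma tangent_sew_oper p q : p \in `[0, 1] -> q \in `[0, 1] ->
  tangent_oper mu p q 1 (S p q).
Proof. exact: (sew_oper K0 Dn Dcomplete Top Tid Tcomp). Qed.

Lemma homogenization_oper (A : {fset R}) p q : [set` A] `<=` [set` `[(0 : R), 1]] ->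
  p \in A -> q \in A -> tangent_oper mu p q 1 (homogenization A T p q).
Proof.
move=> AI pA qA.
have [b [s [ps ls _ ->]]] := homogenization_chain T AI (@mesh_le1 _ A) pA qA.
have := along_oper Dn Top ps (AI _ pA); rewrite ls => /(_ (AI _ qA)).
exact.
Qed.

Lemma homogenization_close (A : {fset R}) dl p q :
  [set` A] `<=` [set` `[(0 : R), 1]] -> 0 < dl -> mesh_le A dl ->
  p \in A -> q \in A ->
  (tangent_opnorm mu p q (fun V => homogenization A T p q V - S p q V)%R
     <= (K * dl)%:E)%E.
Proof.
move=> AI dl0 mA pA qA; have pI := AI _ pA; have qI := AI _ qA.
have [b [s [ps ls _ ->]]] := homogenization_chain T AI mA pA qA.
have Kdl : 0 <= K * dl by rewrite mulr_ge0// ltW.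
apply: (opnorm_le Kdl) => V TV.
apply: (le_trans (sew_along K0 Dn Dcomplete Top Tid Tcomp pI qI TV dl0 ps ls)).
apply: ler_wpM2r; first exact: L2norm_ge0.
by apply: ler_piMr => //; exact: dist_itv.
Qed.

Lemma homogenization_close_near Ak (e : R) : dense_exhaustion Ak -> 0 < e ->
  exists k0, forall k p q, (k0 <= k)%N -> p \in Ak k -> q \in Ak k ->
  (tangent_opnorm mu p q (fun V => homogenization (Ak k) T p q V - S p q V)%R
     <= e%:E)%E.
Proof.
move=> dA e0; have [AI _ _] := dA.
have dl0 : 0 < e / (K + 1) by rewrite divr_gt0// ltr_wpDl.
have [k0 mesh] := dense_exhaustion_mesh dA dl0.
exists k0 => k p q kk pA qA.
apply: (le_trans (homogenization_close (AI k) dl0 (mesh k kk) pA qA)).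
rewrite lee_fin mulrA ler_pdivrMr ?ltr_wpDl// (mulrC e).
by apply: ler_wpM2r; [exact: ltW|rewrite lerDl].
Qed.

Lemma homogenization_cvg Ak p q : dense_exhaustion Ak ->
  (exists k, p \in Ak k /\ q \in Ak k) ->
  operator_cvg mu p q (fun k => homogenization (Ak k) T p q) (S p q).
Proof.
move=> dA [k1 [pk qk]]; apply: cvge0_le => e e0.
have [k0 h] := homogenization_close_near dA e0.
exists (maxn k0 k1) => // k /=; rewrite geq_max => /andP[kk0 kk1].
rewrite opnorm_ge0//=; apply: h => //; exact: (dense_exhaustion_sub dA kk1).
Qed.

Lemma homogenization_cvg_unif Ak : dense_exhaustion Ak ->
  ereal_sup [set tangent_opnorm mu z.1 z.2
      (fun V => homogenization (Ak k) T z.1 z.2 V - S z.1 z.2 V)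
    | z in [set` Ak k] `*` [set` Ak k]] @[k --> \oo] --> 0%E.
Proof.
move=> dA; apply: cvge0_le => e e0.
have [k0 h] := homogenization_close_near dA e0.
(* A supremum over the empty set would be [-oo]; mesh 1/2 guarantees a point in [Ak k], hence a
   nonnegative supremum. *)
have h2 : 0 < 2^-1 :> R by rewrite invr_gt0.
have [k2 mesh2] := dense_exhaustion_mesh dA h2.
exists (maxn k0 k2) => // k /=; rewrite geq_max => /andP[kk0 kk2].
apply/andP; split; last first.
  by apply: ge_ereal_sup => _ [[p q] [/= pA qA] <-]; exact: h.
have I0 : (0 : R) \in `[0, 1] by rewrite in_itv/= lexx ler01.
have I1 : (1 : R) \in `[0, 1] by rewrite in_itv/= lexx ler01.
have h01 : 0 + 2^-1 < 1 :> R by lra.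
have [z zA _] := mesh2 k kk2 0 1 I0 I1 h01.
apply: (le_trans (opnorm_ge0 cN mu z z
  (fun V => homogenization (Ak k) T z z V - S z z V)%R)).
by apply: ereal_sup_ubound; exists (z, z).
Qed.

Lemma dense_exhaustion_itv Ak : dense_exhaustion Ak ->
  \bigcup_k [set` Ak k] `<=` [set` `[(0 : R), 1]].
Proof. by move=> [AI _ _] x [k _ /AI]. Qed.

Lemma dense_exhaustion_pair Ak p q : dense_exhaustion Ak ->
  (\bigcup_k [set` Ak k]) p -> (\bigcup_k [set` Ak k]) q ->
  exists k, p \in Ak k /\ q \in Ak k.
Proof.
move=> dA [k1 _ p1] [k2 _ q2]; exists (maxn k1 k2); split.
  exact: (dense_exhaustion_sub dA (leq_maxl _ _)).
exact: (dense_exhaustion_sub dA (leq_maxr _ _)).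
Qed.

Lemma ordered_between p q r : (p <= q <= r) || (r <= q <= p) ->
  exists b, ordered b p q /\ ordered b q r.
Proof. by case/orP => /andP[h1 h2]; [exists true|exists false]. Qed.

Lemma tangent_sew_composition (A : set R) : A `<=` [set` `[(0 : R), 1]] ->
  composition_property mu A S.
Proof.
move=> AI; split=> [p V /AI pI TV|p q r V /AI pI /AI qI /AI rI].
  have Sp := sew_mem K0 Dn Dcomplete Top Tid Tcomp pI pI TV.
  apply: (proj1 (tangent_sub_eq0 cN Sp TV)).
  exact: (sew_id K0 Dn Dcomplete Top Tid Tcomp pI TV).
case/ordered_between => b [pq qr] TV.
have Sq := sew_mem K0 Dn Dcomplete Top Tid Tcomp pI qI TV.
have Sr := sew_mem K0 Dn Dcomplete Top Tid Tcomp qI rI Sq.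
have Spr := sew_mem K0 Dn Dcomplete Top Tid Tcomp pI rI TV.
apply: (proj1 (tangent_sub_eq0 cN Sr Spr)).
exact: (sew_comp K0 Dn Dcomplete Top Tid Tcomp pI qI rI pq qr TV).
Qed.

Lemma tangent_sew_approx (A : set R) : A `<=` [set` `[(0 : R), 1]] ->
  F_approximation mu (fun t => K * t ^+ 2) A S T.
Proof.
move=> AI p q /AI pI /AI qI.
have k0 : 0 <= K * `|q - p| ^+ 2 by rewrite mulr_ge0.
apply: (opnorm_le k0) => V TV.
have Sq := sew_mem K0 Dn Dcomplete Top Tid Tcomp pI qI TV.
have [TE _ _] := Top pI qI.
rewrite (snC (Wtangent_seminormed cN (mu q)) Sq (TE _ TV)).
exact: (sew_approx K0 Dn Dcomplete Top Tid Tcomp pI qI TV).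
Qed.

Lemma tangent_sew_unique Ak (S' : opfamily N) :
  dense_exhaustion Ak -> let A := \bigcup_k [set` Ak k] in
  family_on mu A S' -> composition_property mu A S' ->
  F_approximation mu (fun t => K * t ^+ 2) A S' T ->
  forall p q V, A p -> A q -> Wtangent_space (mu p) V ->
  {ae mu q, forall x, S' p q V x = S p q V x}.
Proof.
move=> dA A fS [idS compS] appS p q V Ap Aq TV.
have AI := dense_exhaustion_itv dA; have pI := AI _ Ap; have qI := AI _ Aq.
have S'M p' q' : A p' -> A q' -> exists M, tangent_oper mu p' q' M (S' p' q').
  by move=> Ap' Aq'; apply: (tangent_operator_oper cN); exact: fS.
have S'T p' q' V' : A p' -> A q' -> D p' V' -> D q' (S' p' q' V').
  by move=> Ap' Aq' TV'; have [SE _ _] := fS _ _ Ap' Aq'; exact: SE.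
have Sq := sew_mem K0 Dn Dcomplete Top Tid Tcomp pI qI TV.
apply: (proj1 (tangent_sub_eq0 cN (S'T _ _ _ Ap Aq TV) Sq)).
apply: (sew_unique K0 Dn Dcomplete Top Tid Tcomp AI S'M _ _ _ Ap Aq TV).
- move=> p' V' Ap' TV'.
  exact: (proj2 (tangent_sub_eq0 cN (S'T _ _ _ Ap' Ap' TV') TV') (idS _ _ Ap' TV')).
- move=> b p' q' r' V' Ap' Aq' Ar' pq qr TV'.
  have TS := S'T _ _ _ Ap' Aq' TV'.
  apply: (proj2 (tangent_sub_eq0 cN (S'T _ _ _ Aq' Ar' TS) (S'T _ _ _ Ap' Ar' TV'))).
  apply: compS => //; case: (b) pq qr => /= pq qr; first by rewrite pq qr.
  by rewrite pq qr orbT.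
- move=> p' q' V' Ap' Aq' TV'; have [M S'o] := S'M _ _ Ap' Aq'.
  have To := Top (AI _ Ap') (AI _ Aq').
  exact: (opnorm_sub_le cN S'o To (appS _ _ Ap' Aq') TV').
(* The comparison needs fine chains with all points in [A], where [S'] is controlled; the sets
   [Ak k] of large rank provide them, by density. *)
- move=> dl dl0; have [k0 mesh] := dense_exhaustion_mesh dA dl0.
  have [k1 [pk qk]] := dense_exhaustion_pair dA Ap Aq.
  have kk0 := leq_maxl k0 k1; have kk1 := leq_maxr k0 k1.
  set k := maxn k0 k1 in kk0 kk1.
  have [AkI _ _] := dA.
  have [b [s [ps ls sA _]]] := homogenization_chain T (AkI k) (mesh k kk0)
    (dense_exhaustion_sub dA kk1 pk) (dense_exhaustion_sub dA kk1 qk).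
  by exists b, s; split=> // x xs; exists k => //; exact: sA.
Qed.

Lemma operator_cvg_unique Ak p q L : dense_exhaustion Ak ->
  (exists k, p \in Ak k /\ q \in Ak k) -> tangent_operator mu p q L ->
  operator_cvg mu p q (fun k => homogenization (Ak k) T p q) L ->
  forall V, Wtangent_space (mu p) V -> L2norm (mu q) (S p q V - L V) = 0.
Proof.
move=> dA [k1 [pk qk]] /(tangent_operator_oper cN)[M Lo] /fine_cvgP[Lfin Lcv] V TV.
have [AI _ _] := dA; have pI := AI _ _ pk; have qI := AI _ _ qk.
have So := tangent_sew_oper pI qI; have Tn := Wtangent_seminormed cN (mu q).
have [SE _ _] := So; have [LE _ _] := Lo.
apply/eqP; rewrite eq_le L2norm_ge0 andbT.
apply: (@ler_addeps _ _ _ (2 * L2norm (mu p) V)) => e e0; rewrite add0r.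
have [k0 h] := homogenization_close_near dA e0.
move/cvgrPdist_le: Lcv => /(_ e e0) Lcv.
have : \forall k \near \oo, (tangent_opnorm mu p q
    (fun V => homogenization (Ak k) T p q V - L V)%R <= e%:E)%E.
  apply: filterS2 Lfin Lcv => k fk; rewrite sub0r normrN => le.
  by rewrite -(fineK fk) lee_fin; exact: le_trans (ler_norm _) le.
case=> k2 _ h2.
pose k := maxn k0 (maxn k1 k2).
have kk0 : (k0 <= k)%N by exact: leq_maxl.
have kk1 : (k1 <= k)%N by rewrite /k maxnCA leq_maxl.
have kk2 : (k2 <= k)%N by rewrite /k maxnA leq_maxr.
have pA := dense_exhaustion_sub dA kk1 pk; have qA := dense_exhaustion_sub dA kk1 qk.
have Ho := homogenization_oper (AI k) pA qA; have [HE _ _] := Ho.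
have l1 := opnorm_sub_le cN Ho So (h k p q kk0 pA qA) TV.
have l2 := opnorm_sub_le cN Ho Lo (h2 k kk2) TV.
apply: (le_trans (sn_tri Tn (SE _ TV) (LE _ TV) (HE _ TV))).
rewrite (snC Tn (SE _ TV) (HE _ TV)); apply: (le_trans (lerD l1 l2)).
by move: (L2norm _ _) => x; lra.
Qed.

(** A limit along [Ak] agrees up to null fields with [S p q], whose definition involves no
    exhaustion. *)
Lemma homogenization_cvg_limit Ak Bk p q L :
  dense_exhaustion Ak -> dense_exhaustion Bk ->
  (exists k, p \in Ak k /\ q \in Ak k) -> (exists k, p \in Bk k /\ q \in Bk k) ->
  tangent_operator mu p q L ->
  operator_cvg mu p q (fun k => homogenization (Ak k) T p q) L ->
  operator_cvg mu p q (fun k => homogenization (Bk k) T p q) L.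
Proof.
move=> dA dB pqA pqB tL LA.
have SL := operator_cvg_unique dA pqA tL LA.
have [k1 [pk qk]] := pqB; have [M Lo] := tangent_operator_oper cN tL.
have [BI _ _] := dB; have pI := BI _ _ pk; have qI := BI _ _ qk.
have So := tangent_sew_oper pI qI; have Tn := Wtangent_seminormed cN (mu q).
have [SE _ _] := So; have [LE _ _] := Lo.
apply: cvge0_le => e e0.
have [k0 h] := homogenization_close_near dB e0.
exists (maxn k0 k1) => // k /=; rewrite geq_max => /andP[kk0 kk1].
have pA := dense_exhaustion_sub dB kk1 pk; have qA := dense_exhaustion_sub dB kk1 qk.
have Ho := homogenization_oper (BI k) pA qA; have [HE _ _] := Ho.
rewrite opnorm_ge0//=; apply: (opnorm_le (ltW e0)) => V TV.
apply: (le_trans (sn_tri Tn (HE _ TV) (LE _ TV) (SE _ TV))).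
rewrite (SL V TV) addr0.
exact: (opnorm_sub_le cN Ho So (h k p q kk0 pA qA) TV).
Qed.

Lemma tangent_sew_unitary p q : p \in `[0, 1] -> q \in `[0, 1] ->
  unitary_operator (mu p) (mu q) (Wtangent_space (mu p))
    (Wtangent_space (mu q)) (S p q).
Proof.
move=> pI qI; have So := tangent_sew_oper pI qI.
split; first exact: (oper_tangent_operator cN So).
  apply: (tangent_isometry_dot cN So) => V TV.
  exact: (sew_isometry K0 Dn Dcomplete Top Tid Tcomp pI qI TV).
move=> W TW; have Sp := sew_mem K0 Dn Dcomplete Top Tid Tcomp qI pI TW.
have Sq := sew_mem K0 Dn Dcomplete Top Tid Tcomp pI qI Sp.
exists (S q p W) => //; apply: (proj1 (tangent_sub_eq0 cN Sq TW)).
exact: (sew_inv K0 Dn Dcomplete Top Tid Tcomp qI pI TW).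
Qed.

End TangentSewing.

Theorem mainTheorem2 (R : realType) (d : nat) (N : riemannianManifold R d)
    (mu : R -> probability (borel N) R)
    (Pi : probability (segments N) R)
    (phi : R -> R -> borel N -> borel N)
    (X : R -> vfield N) (B C : R) :
  compact [set: N] ->
  monge_geodesic mu Pi phi ->
  transport_field Pi X ->
  (forall t : R, t \in `[0, 1] -> bounded_derivative (mu t) (X t) B) ->
  (forall s t : R, s \in `[0, 1] -> t \in `[0, 1] ->
     unitary_operator (mu s) (mu t) (L2 (mu s)) (L2 (mu t)) (ParT mu Pi s t)) ->
  (forall s t : R, s \in `[0, 1] -> t \in `[0, 1] ->
     push_normal mu phi s t) ->
  (forall s t : R, s \in `[0, 1] -> t \in `[0, 1] ->
     (opnorm (mu s) (mu t) (Wnormal_space (mu s))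
        (fun V => Push mu phi s t V - ParT mu Pi s t V)%R
      <= C%:E * wasserstein (mu s) (mu t))%E) ->
  let T := projT mu Pi in
  let I01 := [set` `[(0 : R), 1]] in
  exists F : R -> R,
    [/\ (forall t : R, 0 <= t -> 0 <= F t),
        F =o_ (0^'+) id &
        exists S : opfamily N,
          [/\ family_on mu I01 S,
              forall Ak : nat -> {fset R}, dense_exhaustion Ak ->
                let A := \bigcup_k [set` Ak k] in
                let Sk := fun k => homogenization (Ak k) T in
                [/\ forall p q : R, A p -> A q ->
                      operator_cvg mu p q (fun k => Sk k p q) (S p q),
                    ereal_sup [set tangent_opnorm mu z.1 z.2
                        (fun V => Sk k z.1 z.2 V - S z.1 z.2 V)
                      | z in [set` Ak k] `*` [set` Ak k]] @[k --> \oo] --> 0%E,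
                    composition_property mu A S,
                    F_approximation mu F A S T &
                    forall S' : opfamily N, family_on mu A S' ->
                      composition_property mu A S' ->
                      F_approximation mu F A S' T ->
                      forall p q V, A p -> A q -> Wtangent_space (mu p) V ->
                        {ae mu q, forall x, S' p q V x = S p q V x}],
              forall p q : R, I01 p -> I01 q ->
                (exists Ak : nat -> {fset R}, dense_exhaustion Ak /\
                   exists k, p \in Ak k /\ q \in Ak k) /\
                forall Ak Bk : nat -> {fset R},
                  dense_exhaustion Ak -> dense_exhaustion Bk ->
                  (exists k, p \in Ak k /\ q \in Ak k) ->
                  (exists k, p \in Bk k /\ q \in Bk k) ->
                  forall L, tangent_operator mu p q L ->
                    operator_cvg mu p q
                      (fun k => homogenization (Ak k) T p q) L ->
                    operator_cvg mu p q
                      (fun k => homogenization (Bk k) T p q) L &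
              forall p q : R, I01 p -> I01 q ->
                unitary_operator (mu p) (mu q) (Wtangent_space (mu p))
                  (Wtangent_space (mu q)) (S p q)]].
Proof.
move=> cN [mu_geo [muPi _] _ _] _ _ ParT_unitary pushN push_close T I01.
pose K := (`|C| * fine (wasserstein (mu 0) (mu 1))) ^+ 2.
have K0 : 0 <= K by exact: sqr_ge0.
have Top p q pI qI := T_oper cN ParT_unitary (p := p) (q := q) pI qI.
have Tid p V pI TV := T_id cN muPi ParT_unitary (p := p) (V := V) pI TV.
have Tcomp p q r V pI qI rI TV := T_comp cN mu_geo muPi ParT_unitary pushN
  push_close (p := p) (q := q) (r := r) (V := V) pI qI rI TV.
exists (fun t => K * t ^+ 2); split.
- by move=> t _; rewrite mulr_ge0// sqr_ge0.
- exact: sqr_littleo_id.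
(* One family on the whole of [[0, 1]], fixed before any exhaustion is given. *)
exists (tangent_sew mu T K); split.
- move=> p q pI qI.
  exact: (oper_tangent_operator cN (tangent_sew_oper cN K0 Top Tid Tcomp pI qI)).
- move=> Ak dA A Sk; have AI := dense_exhaustion_itv dA; split.
  + move=> p q Ap Aq.
    exact: (homogenization_cvg cN K0 Top Tid Tcomp dA (dense_exhaustion_pair dA Ap Aq)).
  + exact: (homogenization_cvg_unif cN K0 Top Tid Tcomp dA).
  + exact: (tangent_sew_composition cN K0 Top Tid Tcomp AI).
  + exact: (tangent_sew_approx cN K0 Top Tid Tcomp AI).
  + move=> S' fS cS aS p q V Ap Aq TV.
    exact: (tangent_sew_unique cN K0 Top Tid Tcomp dA fS cS aS Ap Aq TV).
- move=> p q pI qI; split; first exact: dense_exhaustion_ex.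
  move=> Ak Bk dA dB pqA pqB L.
  exact: (homogenization_cvg_limit cN K0 Top Tid Tcomp dA dB pqA pqB).
- move=> p q pI qI; exact: (tangent_sew_unitary cN K0 Top Tid Tcomp pI qI).
Qed.
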